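(* Suppose $\delta\in(0,1)$ is a real number and $h\ge 3$ is an integer. For any integer $K$ with $[h/3]\le K\le h-1$ and any positive reals $\alpha_k$ (for integers $k$ with $[h/3]\le k\le K-1$) we have $$T(h,\delta)\leq X\left(\sum_{k=[h/3]}^{K-1}\frac{\exp\left(-\alpha_k\frac{h-k-3}{h-k-1}\right)}{k!}\left(\int_\delta^{\frac{3-(k-1)\delta}{h-k+1}}\exp(\alpha_k s)\frac{ds}{s}\right)^k+\frac{1}{K!}\left(\log\frac{3-(K-1)\delta}{(h-K+1)\delta}\right)^K+o(1)\right).$$
   Context: $[\cdot]$ denotes the integer part. For a real parameter $X$ and $\delta>0$, and an integer $n\in(X,2X]$, $\Omega_\delta(n^3+2)$ denotes the number of primes $p\mid n^3+2$ with $p\ge X^\delta$, counted with multiplicity. For an integer $h$, $$T(h,\delta)=\#\{n\in\mathbb{Z}: X<n\le 2X,\ \Omega_\delta(n^3+2)\ge h\},$$ which depends on $X$. The term $o(1)$ denotes a quantity tending to $0$ as $X\to\infty$ with $h,\delta,K$ and the $\alpha_k$ fixed. An empty sum is $0$.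
   Formalization: The displayed bound is proved for hδ ≤ 3; for hδ > 3, where the bracket can be negative or the logarithm undefined (e.g. h=4, K=1, δ=0.8 gives log(3/3.2)<0), the main term is replaced by 0, i.e. T(h,δ) ≤ X·o(1), which implies the bound whenever the bracket is nonnegative. *)

(* Defs.v *)
From HB Require Import structures.
From mathcomp Require Import all_boot all_order all_algebra finmap.
From mathcomp Require Import all_classical all_reals all_analysis.

Set Implicit Arguments.
Unset Strict Implicit.
Unset Printing Implicit Defensive.

Import Order.TTheory GRing.Theory Num.Theory.
Import numFieldNormedType.Exports.

Local Open Scope classical_set_scope.
Local Open Scope ring_scope.

Definition Omega (R : realType) (X delta : R) (m : nat) : nat :=
  (\sum_(p <- primes m | (X `^ delta <= p%:R)%R) logn p m)%N.

(* The set is finite, being bounded, so fset_set does not return its default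
   value here. *)
Definition T (R : realType) (X : R) (h : nat) (delta : R) : nat :=
  #|` fset_set [set n : int | X < n%:~R <= 2 * X /\
                              (h <= Omega X delta `|(n ^+ 3 + 2)%R|)%N] |.

Definition upper_limit (R : realType) (h : nat) (delta : R) (k : nat) : R :=
  (3 - (k%:R - 1) * delta) / (h%:R - k%:R + 1).

(* The numerator h - k - 3 equals -1 at k = h - 2, so the subtractions are
   taken in R. *)
Definition main_term (R : realType) (h : nat) (delta : R) (K : nat)
    (alpha : nat -> R) : R :=
  \sum_((h %/ 3)%N <= k < K)
     expR (- alpha k * ((h%:R - k%:R - 3) / (h%:R - k%:R - 1))) / k`!%:R *
     (\int[lebesgue_measure]_(s in `[delta, upper_limit h delta k])
        (expR (alpha k * s) / s)) ^+ k
  + (K`!%:R)^-1 *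
    ln ((3 - (K%:R - 1) * delta) / ((h%:R - K%:R + 1) * delta)) ^+ K.

(* T(h, delta) <= X (c + o(1)) as X tends to infinity. *)
Definition T_bound (R : realType) (h : nat) (delta c : R) : Prop :=
  exists2 err : R -> R,
    err X @[X --> +oo] --> (0 : R) &
    forall X : R, 0 < X -> (T X h delta)%:R <= X * (c + err X).

(* Main.v *)
(* The number rho(p) of roots of r^3 + 2 modulo p satisfies Mertens' formula
   sum_{p <= x} rho(p) log p / p ~ log x, proved without class groups or units.
   Let N be the norm form of Z[theta], theta^3 = -2, and let (a, b, c) run over
   a cube of side Y on which N has exact order Y^3.  For a root r modulo p, the
   lattice p | a + b r + c r^2 is an ideal of norm p, so its nonzero vectors
   have length >> p^(1/3), and it contains Y^3 / p + O(Y^2 / p^(2/3)) points of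
   the cube.  Summing log |N| over the cube, for all p << Y^3, gives the upper
   bound; restricting to points congruent to 1 modulo P! whose norm is
   squarefree gives the lower bound.

   Now let p_1 <= ... <= p_h be the h smallest primes p >= X^delta dividing
   n^3 + 2, with multiplicity, and take k maximal with p_1 ... p_k <= 3 X.
   If k >= K, the product p_1 ... p_K counts n with weight 1 in the last term.
   If k < K, then p_k is at most X to the upper limit of integration up to o(1),
   and p_1 ... p_(k+1) > 3 X forces
   log (p_1 ... p_k) >= (h - k - 3) / (h - k - 1) * log X, so that Rankin's
   trick with exponent alpha_k / log X gives the k-th term.  The constant 3
   absorbs n^3 + 2 <= 9 X^3 and makes k >= [h/3] exact; the rounding errors
   rho(d), d <= 3 X, contribute O(X / log X) by Chebyshev's bound. *)
Require Import Defs.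
From HB Require Import structures.
From mathcomp Require Import all_boot all_order all_algebra finmap.
From mathcomp Require Import all_classical all_reals all_analysis.
From mathcomp Require Import ring lra zify.

Set Implicit Arguments.
Unset Strict Implicit.
Unset Printing Implicit Defensive.

Import Order.TTheory GRing.Theory Num.Theory.
Import numFieldNormedType.Exports.

Local Open Scope ring_scope.

(** * The norm form of the field generated by a cube root of -2 *)

(** Summing log |N| detects rho because, at one point of the cube, the number of roots r with p | a
    + b r + c r^2 is at most the exponent of p in N. This is the upper bound. The reverse inequality
    can fail where p^2 | N. Such points are discarded; the congruence modulo P! rules out the primes
    p <= P, so that for large Y the discarded proportion is O(1 / P). Hence the lower bound is only
    (1 - eps) log x - C with C depending on eps. That suffices, since the formula is used between
    X^a and X^b with a and b fixed, where an error eps log X is harmless. The discarded points are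
    counted by the same principle as the lattice points, with p^2 in place of p: distinct points
    whose difference has norm divisible by q are q^(1/3) apart, up to a constant.

    The Chinese remainder theorem handles a tuple p_1, ..., p_k only when its primes are distinct. A
    repeated prime has its square dividing a product that is at most 3 X, so p <= sqrt (3 X), and
    the n with p^2 | n^3 + 2 for some such p >= X^delta number o(X). *)

Definition nform (K : comNzRingType) (a b c : K) : K :=
  a ^+ 3 - 2 * b ^+ 3 + 4 * c ^+ 3 + 6 * a * b * c.

(** The image of a + b theta + c theta^2 under theta -> r, a ring morphism modulo any q dividing r^3
    + 2; its kernel is the ideal lattice. *)
Definition ell (K : comNzRingType) (r a b c : K) : K := a + b * r + c * r ^+ 2.

(** The second factor is the adjugate N / (a + b theta + c theta^2), evaluated at r; the correction
    vanishes at the roots of r^3 + 2. *)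
Lemma nformE (K : comNzRingType) (r a b c : K) :
  nform a b c =
  ell r a b c * ell r (a ^+ 2 + 2 * b * c) (- 2 * c ^+ 2 - a * b) (b ^+ 2 - a * c)
  - (r ^+ 3 + 2) * (b * (b ^+ 2 - a * c) + c * (- 2 * c ^+ 2 - a * b)
                    + c * (b ^+ 2 - a * c) * r).
Proof. by rewrite /nform /ell; ring. Qed.

Lemma nform_scale (K : comNzRingType) (k a b c : K) :
  nform (k * a) (k * b) (k * c) = k ^+ 3 * nform a b c.
Proof. by rewrite /nform; ring. Qed.

(* In the second case (a, b, c) is a multiple of s^2 + s theta + theta^2, the
   cofactor of theta - s in theta^3 - s^3 = 0; the third case is the generic one,
   where the adjugate of (a, b, c) is such a multiple. *)
Lemma nform_eq0_field (F : fieldType) (a b c : F) : nform a b c = 0 ->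
  [\/ [/\ a = 0, b = 0 & c = 0],
      exists s, [/\ s ^+ 3 + 2 = 0, a = c * s ^+ 2 & b = c * s] |
      exists s, [/\ s ^+ 3 + 2 = 0, ell s a b c = 0,
        b ^+ 2 - a * c != 0 &
        ell s (a ^+ 2 + 2 * b * c) (- 2 * c ^+ 2 - a * b) (b ^+ 2 - a * c)
          = 3 * (b ^+ 2 - a * c) * s ^+ 2]].
Proof.
have adj0 (x y z : F) : x ^+ 2 + 2 * y * z = 0 -> - 2 * z ^+ 2 - x * y = 0 ->
    y ^+ 2 - x * z = 0 -> [/\ x = 0, y = 0 & z = 0] \/
    z != 0 /\ exists s, [/\ s ^+ 3 + 2 = 0, x = z * s ^+ 2 & y = z * s].
  move=> e1 e2 e3; have [z0|z0] := eqVneq z 0.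
    left; move: e1 e3; rewrite z0 !mulr0 subr0 addr0.
    by move=> /eqP; rewrite expf_eq0 => /eqP-> /eqP; rewrite expf_eq0 => /eqP->.
  right; split=> //; exists (y / z).
  have xE : x = y ^+ 2 / z.
    apply: (mulIf z0); rewrite divfK //; apply/eqP; rewrite eq_sym -subr_eq0.
    by rewrite e3.
  have h2 : y ^+ 3 + 2 * z ^+ 3 = 0.
    have -> : y ^+ 3 + 2 * z ^+ 3 = z * - (- 2 * z ^+ 2 - x * y).
      by rewrite xE; field.
    by rewrite e2 oppr0 mulr0.
  split; last by field.
    have -> : (y / z) ^+ 3 + 2 = (y ^+ 3 + 2 * z ^+ 3) / z ^+ 3 by field.
    by rewrite h2 mul0r.
  by rewrite xE; field.
move=> N0.
pose A := a ^+ 2 + 2 * b * c; pose B := - 2 * c ^+ 2 - a * b.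
pose C := b ^+ 2 - a * c.
have [] := adj0 A B C.
- have -> : A ^+ 2 + 2 * B * C = a * nform a b c.
    by rewrite /A /B /C /nform; ring.
  by rewrite N0 mulr0.
- have -> : - 2 * C ^+ 2 - A * B = b * nform a b c.
    by rewrite /A /B /C /nform; ring.
  by rewrite N0 mulr0.
- have -> : B ^+ 2 - A * C = c * nform a b c.
    by rewrite /A /B /C /nform; ring.
  by rewrite N0 mulr0.
- case=> A0 B0 C0; case: (adj0 a b c A0 B0 C0) => [h|[_ h]].
    exact: Or31.
  exact: Or32.
case=> C0 [s [s3 AE BE]]; apply: Or33; exists s.
rewrite -/A -/B -/C; split => //; last by rewrite /ell AE BE; ring.
apply: (mulfI C0); rewrite mulr0.
have -> : C * ell s a b c = a * C + b * (C * s) + c * (C * s ^+ 2).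
  by rewrite /ell; ring.
by rewrite -AE -BE /A /B /C; ring.
Qed.

(** Here -(r + r') is again a root, so the conclusion is the cofactor shape of [nform_eq0_field]
    with s = -(r + r'); [nform_cofactor_dvd] then gives p^2 | N. *)
Lemma two_roots_field (F : fieldType) (r r' a b c : F) : r != r' ->
  r ^+ 3 + 2 = 0 -> r' ^+ 3 + 2 = 0 -> ell r a b c = 0 -> ell r' a b c = 0 ->
  [/\ (r + r') ^+ 3 = 2, a = c * (r + r') ^+ 2 & b = - c * (r + r')].
Proof.
move=> ne e e' l l'; have ne0 : r - r' != 0 by rewrite subr_eq0.
have h : r ^+ 2 + r * r' + r' ^+ 2 = 0.
  apply: (mulfI ne0); rewrite mulr0.
  have -> : (r - r') * (r ^+ 2 + r * r' + r' ^+ 2) =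
    (r ^+ 3 + 2) - (r' ^+ 3 + 2) by ring.
  by rewrite e e' subr0.
have hb : b + c * (r + r') = 0.
  apply: (mulfI ne0); rewrite mulr0.
  have -> : (r - r') * (b + c * (r + r')) = ell r a b c - ell r' a b c.
    by rewrite /ell; ring.
  by rewrite l l' subr0.
have bE : b = - c * (r + r').
  by apply/eqP; rewrite -subr_eq0 -hb; apply/eqP; ring.
split=> //.
  have -> : (r + r') ^+ 3 = 2 - (r' ^+ 3 + 2) +
     (r + 2 * r') * (r ^+ 2 + r * r' + r' ^+ 2) by ring.
  by rewrite e' h; ring.
have aE : a = ell r a b c - b * r - c * r ^+ 2 by rewrite /ell; ring.
rewrite aE l bE.
have -> : c * (r + r') ^+ 2 = 0 - - c * (r + r') * r - c * r ^+ 2 +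
  c * (r ^+ 2 + r * r' + r' ^+ 2) by ring.
by rewrite h mulr0 addr0.
Qed.

(** Vieta for a cubic without quadratic term. It limits the roots modulo p to three, since two of
    them determine any further one. *)
Lemma three_roots_sum_field (F : fieldType) (r r' r'' : F) :
  r != r' -> r != r'' -> r' != r'' ->
  r ^+ 3 + 2 = 0 -> r' ^+ 3 + 2 = 0 -> r'' ^+ 3 + 2 = 0 -> r + r' + r'' = 0.
Proof.
rewrite -![r == _]subr_eq0 -[r' == _]subr_eq0 => n1 n2 n3 e e' e''.
apply: (mulfI n1); apply: (mulfI n2); apply: (mulfI n3); rewrite !mulr0.
have -> : (r' - r'') * ((r - r'') * ((r - r') * (r + r' + r''))) =
  (r - r'') * (r ^+ 3 - r' ^+ 3) - (r - r') * (r ^+ 3 - r'' ^+ 3) by ring.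
have -> : r ^+ 3 = - 2 by rewrite -[LHS](addrK 2) e sub0r.
have -> : r' ^+ 3 = - 2 by rewrite -[LHS](addrK 2) e' sub0r.
have -> : r'' ^+ 3 = - 2 by rewrite -[LHS](addrK 2) e'' sub0r.
by rewrite subrr !mulr0 subrr.
Qed.

(** The vector (s^2, s, 1) has norm (s^3 + 2)^2, and moving its first two coordinates by multiples
    of p adds only terms with a factor p (s^3 + 2) or p^2. *)
Lemma nform_cofactor_dvd (p a b c s : int) : (p %| s ^+ 3 + 2)%Z ->
  (p %| a - c * s ^+ 2)%Z -> (p %| b - c * s)%Z ->
  (p ^+ 2 %| nform a b c)%Z.
Proof.
move=> /dvdzP[e he] /dvdzP[A hA] /dvdzP[B hB].
have -> : a = c * s ^+ 2 + p * A by rewrite [p * A]mulrC -hA; ring.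
have -> : b = c * s + p * B by rewrite [p * B]mulrC -hB; ring.
apply/dvdzP; exists (c ^+ 3 * e ^+ 2 + 3 * s * c ^+ 2 * e * A +
  3 * c * s ^+ 2 * A ^+ 2 + p * A ^+ 3 - 2 * (3 * c * s * B ^+ 2 + p * B ^+ 3)
  + 6 * c * A * B).
have -> : nform (c * s ^+ 2 + p * A) (c * s + p * B) c =
  c ^+ 3 * (s ^+ 3 + 2) ^+ 2 + 3 * s * c ^+ 2 * (s ^+ 3 + 2) * (p * A)
  + 3 * c * s ^+ 2 * p ^+ 2 * A ^+ 2 + p ^+ 3 * A ^+ 3
  - 2 * (3 * c * s * p ^+ 2 * B ^+ 2 + p ^+ 3 * B ^+ 3)
  + 6 * c * p ^+ 2 * A * B.
  by rewrite /nform; ring.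
by rewrite he; ring.
Qed.

(** Infinite descent at 2: N = 0 makes a, then b, then c even, and halving all three decreases |a| +
    |b| + |c|. *)
Lemma nform_int_neq0 (a b c : int) : nform a b c = 0 ->
  [/\ a = 0, b = 0 & c = 0].
Proof.
have descent n : forall a b c : int, (`|a| + `|b| + `|c| < n)%N ->
    nform a b c = 0 -> [/\ a = 0, b = 0 & c = 0].
  elim: n => [//|n IH] {}a {}b {}c lt N0.
  have even3 (x y : int) : x ^+ 3 = 2 * y -> exists z, x = 2 * z.
    move=> h; exists (x %/ 2)%Z; rewrite mulrC divzK //.
    have : (2 %| x ^+ 3)%Z by rewrite h dvdz_mulr.
    by rewrite !dvdzE abszX (Euclid_dvdX _ _ (isT : prime 2)) andbT.
  have [a' aE] : exists z, a = 2 * z.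
    apply: (even3 _ (b ^+ 3 - 2 * c ^+ 3 - 3 * a * b * c)).
    by apply/eqP; rewrite -subr_eq0 -N0 /nform; apply/eqP; ring.
  have [b' bE] : exists z, b = 2 * z.
    apply: (even3 _ (2 * a' ^+ 3 + c ^+ 3 + 3 * a' * b * c)).
    apply: (mulfI (_ : (2 : int) != 0)) => //; apply/eqP; rewrite -subr_eq0.
    by rewrite -oppr_eq0 -N0 /nform aE; apply/eqP; ring.
  have [c' cE] : exists z, c = 2 * z.
    apply: (even3 _ (2 * b' ^+ 3 - a' ^+ 3 - 3 * a' * b' * c)).
    apply: (mulfI (_ : (4 : int) != 0)) => //; apply/eqP; rewrite -subr_eq0.
    by rewrite -N0 /nform aE bE; apply/eqP; ring.
  have N0' : nform a' b' c' = 0.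
    by move/eqP: N0; rewrite aE bE cE nform_scale mulf_eq0 /= => /eqP.
  have [z|nz] := boolP ((a == 0) && (b == 0) && (c == 0)).
    by move: z => /andP[/andP[/eqP-> /eqP->] /eqP->].
  have [] := IH a' b' c' _ N0'; first by move: lt nz; rewrite aE bE cE; lia.
  by rewrite aE bE cE => -> -> ->; rewrite mulr0.
exact: (descent (`|a| + `|b| + `|c|).+1).
Qed.

(** 13 = 1 + 2 + 4 + 6, the absolute values of the coefficients of the form. *)
Lemma nform_bound (n : nat) (a b c : int) : (`|a| <= n)%N -> (`|b| <= n)%N ->
  (`|c| <= n)%N -> (`|nform a b c| <= 13 * n ^ 3)%N.
Proof.
move=> ha hb hc.
have : `|nform a b c| <= `|a| ^+ 3 + 2 * `|b| ^+ 3 + 4 * `|c| ^+ 3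
   + 6 * `|a| * `|b| * `|c|.
  have -> : `|a| ^+ 3 + 2 * `|b| ^+ 3 + 4 * `|c| ^+ 3 + 6 * `|a| * `|b| * `|c|
    = `|a ^+ 3| + `|2 * b ^+ 3| + `|4 * c ^+ 3| + `|6 * a * b * c|.
    rewrite normrX (normrM 2) normrX (normrM 4) normrX (normrM (6 * a * b)).
    by rewrite (normrM (6 * a)) (normrM 6) !normr_nat.
  rewrite /nform; apply: (le_trans (ler_normD _ _)); rewrite lerD2r.
  apply: (le_trans (ler_normD _ _)); rewrite lerD2r; exact: ler_normB.
rewrite -lez_nat abszE => h; apply: (le_trans h).
have ha' : `|a| <= n%:Z by rewrite -abszE lez_nat.
have hb' : `|b| <= n%:Z by rewrite -abszE lez_nat.
have hc' : `|c| <= n%:Z by rewrite -abszE lez_nat.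
have -> : ((13 * n ^ 3)%N)%:Z = 13 * n%:Z ^+ 3 by rewrite -[LHS]natz natrM natrX !natz.
have -> : 13 * n%:Z ^+ 3 = n%:Z ^+ 3 + 2 * n%:Z ^+ 3 + 4 * n%:Z ^+ 3
   + 6 * n%:Z * n%:Z * n%:Z by ring.
apply: lerD; first apply: lerD; first apply: lerD.
- by rewrite lerXn2r ?nnegrE.
- by rewrite ler_pM2l // lerXn2r ?nnegrE.
- by rewrite ler_pM2l // lerXn2r ?nnegrE.
- have h6 : 6 * `|a| <= 6 * n%:Z by rewrite ler_pM2l.
  have h7 : 6 * `|a| * `|b| <= 6 * n%:Z * n%:Z by exact: ler_pM.
  exact: ler_pM.
Qed.

Lemma nform_dvd_ell (q r a b c : int) : (q %| r ^+ 3 + 2)%Z ->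
  (q %| ell r a b c)%Z -> (q %| nform a b c)%Z.
Proof.
by move=> h1 h2; rewrite (nformE r) rpredB ?dvdz_mulr.
Qed.

(** Combined with [nform_dvd_ell], this bounds the minimum of the ideal lattice from below: a norm
    that is divisible by q and smaller than q is 0, and then so is the vector. *)
Lemma nform_small (q : nat) (n : nat) (a b c : int) :
  (`|a| <= n)%N -> (`|b| <= n)%N -> (`|c| <= n)%N -> (13 * n ^ 3 < q)%N ->
  (q %| nform a b c)%Z -> [/\ a = 0, b = 0 & c = 0].
Proof.
move=> ha hb hc lt dv; apply: nform_int_neq0.
apply/eqP; rewrite -absz_eq0; apply/negP => /negP; rewrite -lt0n => pos.
have := dvdn_leq pos dv; have := nform_bound ha hb hc; lia.
Qed.

(** * Roots of the cubic modulo a prime, and the primes dividing a norm *)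

Definition croots (p : nat) : seq nat :=
  [seq r <- iota 0 p | (p %| r ^ 3 + 2)%N].

Definition rho (p : nat) : nat := size (croots p).

Lemma croots_uniq p : uniq (croots p).
Proof. exact/filter_uniq/iota_uniq. Qed.

Lemma mem_croots p r : (r \in croots p) = (r < p)%N && (p %| r ^ 3 + 2)%N.
Proof. by rewrite mem_filter mem_iota /= add0n andbC. Qed.

Lemma dvdz_Fp p (z : int) : prime p -> (p %| z)%Z = (z%:~R == 0 :> 'F_p).
Proof. by move=> pp; rewrite (dvdz_pcharf (pchar_Fp pp)). Qed.

Lemma intrX (K : nzRingType) (z : int) n : (z ^+ n)%:~R = z%:~R ^+ n :> K.
Proof. by rewrite rmorphXn. Qed.

Lemma intr_nat (K : nzRingType) (n : nat) : (n%:R : int)%:~R = n%:R :> K.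
Proof. by rewrite natz. Qed.

Definition intrE := (intr_nat, intrX, intrN, intrD, intrM).

Lemma intr_nform (K : comNzRingType) (a b c : int) :
  (nform a b c)%:~R = nform a%:~R b%:~R c%:~R :> K.
Proof. by rewrite /nform !intrE. Qed.

Lemma intr_ell (K : comNzRingType) (r a b c : int) :
  (ell r a b c)%:~R = ell r%:~R a%:~R b%:~R c%:~R :> K.
Proof. by rewrite /ell !intrE. Qed.

Lemma croots_dvdz p r : r \in croots p -> (p %| r%:Z ^+ 3 + 2)%Z.
Proof.
rewrite mem_croots => /andP[_].
by rewrite -[(r%:Z ^+ 3 + 2)](_ : ((r ^ 3 + 2)%N)%:Z = _) //; lia.
Qed.

Lemma dvdz_cubic (p : nat) (r : int) :  (p %| (r ^+ 3 + 2)%R)%Z ->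
  prime p -> (r%:~R : 'F_p) ^+ 3 + 2 = 0.
Proof.
move=> h pp; move: h; rewrite dvdz_Fp // => /eqP.
by rewrite rmorphD rmorphXn /= rmorph_nat.
Qed.

Lemma croots_Fp p r : prime p -> r \in croots p -> (r%:R : 'F_p) ^+ 3 + 2 = 0.
Proof. by move=> pp /croots_dvdz /dvdz_cubic - /(_ pp). Qed.

Lemma croots_Fp_inj p r r' : prime p -> r \in croots p -> r' \in croots p ->
  r != r' -> (r%:R : 'F_p) != r'%:R.
Proof.
move=> pp; rewrite !mem_croots => /andP[rp _] /andP[rp' _]; apply: contra => /eqP e.
apply/eqP; have := congr1 val e; rewrite /= !val_Fp_nat //.
by rewrite !modn_small.
Qed.

Lemma Fp_croots p (s : 'F_p) : prime p -> s ^+ 3 + 2 = 0 ->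
  exists2 r, r \in croots p & s = r%:R.
Proof.
move=> pp s0; have sE : s = (s : nat)%:R by rewrite natr_Zp.
exists (s : nat) => //; rewrite mem_croots; apply/andP; split.
  by rewrite -[X in (_ < X)%N](Fp_cast pp) ltn_ord.
rewrite (dvdn_pcharf (pchar_Fp pp)) natrD natrX -sE; exact/eqP.
Qed.

Lemma uniq_size_croots_sub p (s : seq nat) : prime p -> uniq s ->
  {subset s <= croots p} -> (size s <= 3)%N.
Proof.
move=> pp; case: s => [|x [|y [|z [|w s]]]] //= u sub.
have mem t : t \in [:: x, y, z, w & s] -> t \in croots p by apply: sub.
have mx : x \in croots p by apply: mem; rewrite !inE eqxx.
have my : y \in croots p by apply: mem; rewrite !inE eqxx !orbT.
have mz : z \in croots p by apply: mem; rewrite !inE eqxx !orbT.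
have mw : w \in croots p by apply: mem; rewrite !inE eqxx !orbT.
move: u; rewrite !inE !negb_or -!andbA.
case/and5P=> xy xz xw _ /and5P[yz yw _ zw _].
have ne := croots_Fp_inj pp; have e := croots_Fp pp.
have h1 := three_roots_sum_field (ne _ _ mx my xy) (ne _ _ mx mz xz)
  (ne _ _ my mz yz) (e _ mx) (e _ my) (e _ mz).
have h2 := three_roots_sum_field (ne _ _ mx my xy) (ne _ _ mx mw xw)
  (ne _ _ my mw yw) (e _ mx) (e _ my) (e _ mw).
have := ne _ _ mz mw zw; rewrite -(inj_eq (addrI (x%:R + y%:R))) h1 h2.
by rewrite eqxx.
Qed.

Lemma rho_le3 p : prime p -> (rho p <= 3)%N.
Proof. by move=> pp; apply: (uniq_size_croots_sub pp (croots_uniq p)). Qed.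

(** Each root that annihilates (a, b, c) is paid for by one factor p of N. Two roots fall under the
    cofactor case; three force p to divide a, b and c. *)
Lemma expn_count_croots_dvd p (a b c : int) : prime p ->
  (p ^ count (fun r : nat => (p %| ell r%:Z a b c)%Z) (croots p)
     %| `|nform a b c|)%N.
Proof.
move=> pp; rewrite -size_filter.
set P := fun r : nat => _; set s := seq.filter P _.
have us : uniq s by rewrite filter_uniq ?croots_uniq.
have sub x : x \in s -> x \in croots p /\ P x.
  by rewrite mem_filter => /andP[].
have le3 := uniq_size_croots_sub pp us (fun x h => (sub x h).1).
have ellF x : x \in s -> ell x%:R a%:~R b%:~R c%:~R = 0 :> 'F_p.
  move/sub => [_]; rewrite /P dvdz_Fp // => /eqP; by rewrite intr_ell.
case: s us sub le3 ellF => [|x [|y [|z [|]]]] //= us sub _ ellF.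
- have [/croots_dvdz h1 h2] := sub x (mem_head _ _).
  by have := nform_dvd_ell h1 h2; rewrite dvdzE.
- have mx : x \in [:: x; y] by rewrite !inE eqxx.
  have my : y \in [:: x; y] by rewrite !inE eqxx orbT.
  have [cx _] := sub _ mx; have [cy _] := sub _ my.
  move: us; rewrite inE andbT => xy.
  have [h1 h2 h3] := two_roots_field (croots_Fp_inj pp cx cy xy)
    (croots_Fp pp cx) (croots_Fp pp cy) (ellF _ mx) (ellF _ my).
  rewrite -[(p ^ 2)%N]/(`|(p ^ 2)%N|)%N -[(p ^ 2)%N%:Z]natz natrX natz -dvdzE.
  apply: (@nform_cofactor_dvd p a b c (- (x%:Z + y%:Z)));
    rewrite dvdz_Fp // !intrE ?h3 ?h2.
  + apply/eqP; rewrite (_ : (- (x%:R + y%:R)) ^+ 3 = - (x%:R + y%:R) ^+ 3);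
      last by ring.
    by rewrite h1 addNr.
  + by rewrite sqrrN subrr.
  + by rewrite mulrN mulNr subrr.
- have mx : x \in [:: x; y; z] by rewrite !inE eqxx.
  have my : y \in [:: x; y; z] by rewrite !inE eqxx orbT.
  have mz : z \in [:: x; y; z] by rewrite !inE eqxx !orbT.
  have [cx _] := sub _ mx; have [cy _] := sub _ my; have [cz _] := sub _ mz.
  move: us; rewrite !inE !negb_or andbT -andbA => /and3P[xy xz yz].
  have [h1 h2 h3] := two_roots_field (croots_Fp_inj pp cx cy xy)
    (croots_Fp pp cx) (croots_Fp pp cy) (ellF _ mx) (ellF _ my).
  have [_ _ h3'] := two_roots_field (croots_Fp_inj pp cx cz xz)
    (croots_Fp pp cx) (croots_Fp pp cz) (ellF _ mx) (ellF _ mz).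
  (* The pairs x, y and x, z give b = - c (x + y) = - c (x + z), and y - z is nonzero. *)
  have c0 : c%:~R = 0 :> 'F_p.
    have ne := croots_Fp_inj pp cy cz yz.
    apply/eqP; move: h3; rewrite h3' => /eqP.
    rewrite -subr_eq0 -mulrBr mulf_eq0 oppr_eq0 => /orP[//|].
    by rewrite addrAC opprD addrA subrr sub0r addrC subr_eq0 eq_sym (negbTE ne).
  have a0 : a%:~R = 0 :> 'F_p by rewrite h2 c0 mul0r.
  have b0 : b%:~R = 0 :> 'F_p by rewrite h3 c0 oppr0 mul0r.
  have /dvdzP[a' ->] : (p %| a)%Z by rewrite dvdz_Fp // a0.
  have /dvdzP[b' ->] : (p %| b)%Z by rewrite dvdz_Fp // b0.
  have /dvdzP[c' ->] : (p %| c)%Z by rewrite dvdz_Fp // c0.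
  by rewrite ![_ * p%:Z]mulrC nform_scale abszM abszX dvdn_mulr.
Qed.

Lemma nform_dvd_cases p (a b c : int) : prime p -> (p %| nform a b c)%Z ->
  [\/ [/\ (p %| a)%Z, (p %| b)%Z & (p %| c)%Z],
      exists2 s, s \in croots p &
        (p %| (a - c * s%:Z ^+ 2)%R)%Z /\ (p %| (b - c * s%:Z)%R)%Z |
      exists2 s, s \in croots p &
        [/\ (p %| ell s%:Z a b c)%Z, ~~ (p %| (b ^+ 2 - a * c)%R)%Z &
         (p %| (ell s%:Z (a ^+ 2 + 2 * b * c) (- 2 * c ^+ 2 - a * b)
                     (b ^+ 2 - a * c) - 3 * (b ^+ 2 - a * c) * s%:Z ^+ 2)%R)%Z]].
Proof.
move=> pp; rewrite (dvdz_Fp (nform a b c)) // intr_nform => /eqP /nform_eq0_field.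
rewrite /= => -[[a0 b0 c0]|[s [s3 aE bE]]|[s [s3 l0 C0 lE]]].
- by apply: Or31; rewrite !dvdz_Fp // a0 b0 c0.
- have [r rr sE] := Fp_croots pp s3; apply: Or32; exists r => //.
  rewrite !dvdz_Fp // !intrE.
  by rewrite aE bE sE !subrr.
have [r rr sE] := Fp_croots pp s3; apply: Or33; exists r => //.
rewrite !dvdz_Fp // intrB !intr_ell.
rewrite !intrE.
by move: l0 C0 lE; rewrite sE => -> -> lE; split=> //; rewrite subr_eq0; apply/eqP.
Qed.

(** One Newton step. The derivative 3 s^2 is a unit modulo p > 3, since p | s would give p | 2; in
    the witness, v is its inverse. *)
Lemma croots_lift p s : prime p -> (3 < p)%N -> s \in croots p ->
  exists2 t : int, (p %| t - s%:Z)%Z & (p%:Z ^+ 2 %| t ^+ 3 + 2)%Z.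
Proof.
move=> pp p3 cs; have /dvdzP[e he] := croots_dvdz cs.
have s0 : ~~ (p %| s)%N.
  apply/negP => ps; have := cs; rewrite mem_croots => /andP[_].
  rewrite dvdn_addr ?dvdn_exp // => /dvdn_leq => /(_ isT); lia.
have cop : coprime p (3 * s ^ 2).
  rewrite prime_coprime // Euclid_dvdM // Euclid_dvdX // (negbTE s0) orbF.
  by apply/negP => /dvdn_leq => /(_ isT); lia.
have /(coprimezP p (3 * s%:Z ^+ 2))[[u v] /= uv] :
    coprimez p (3 * s%:Z ^+ 2).
  by rewrite coprimezE; move: cop; rewrite abszM abszX.
exists (s%:Z - (s%:Z ^+ 3 + 2) * v).
  by rewrite addrAC subrr sub0r rpredN dvdz_mulr // croots_dvdz.
apply/dvdzP; exists (e * u + e ^+ 2 * (3 * s%:Z * v ^+ 2 - e * p%:Z * v ^+ 3)).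
have -> : (s%:Z - (s%:Z ^+ 3 + 2) * v) ^+ 3 + 2 =
  (s%:Z ^+ 3 + 2) * (1 - v * (3 * s%:Z ^+ 2)) +
   (s%:Z ^+ 3 + 2) ^+ 2 * (3 * s%:Z * v ^+ 2 - (s%:Z ^+ 3 + 2) * v ^+ 3) by ring.
have -> : 1 - v * (3 * s%:Z ^+ 2) = u * p%:Z by apply/eqP; rewrite subr_eq uv.
by rewrite he; ring.
Qed.

(** In the generic case the adjugate at t is congruent to 3 (b^2 - a c) s^2, a unit modulo p > 3, so
    the whole of p^2 divides [ell t a b c]. As t is any lift of s, one fixed lift per root serves
    all points. *)
Lemma nform_sqr_dvd_cases p (a b c : int) : prime p -> (3 < p)%N ->
  (p%:Z ^+ 2 %| nform a b c)%Z ->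
  [\/ [/\ (p %| a)%Z, (p %| b)%Z & (p %| c)%Z],
      exists2 s, s \in croots p &
        (p %| (a - c * s%:Z ^+ 2)%R)%Z /\ (p %| (b - c * s%:Z)%R)%Z |
      exists2 s, s \in croots p & forall t : int,
        (p %| t - s%:Z)%Z -> (p%:Z ^+ 2 %| t ^+ 3 + 2)%Z ->
        (p%:Z ^+ 2 %| ell t a b c)%Z].
Proof.
move=> pp p3 dv; have pdv : (p %| nform a b c)%Z.
  by apply: dvdz_trans dv; rewrite expr2 dvdz_mulr.
case: (nform_dvd_cases pp pdv) => [h|h|[s cs [ls nC lE]]].
- exact: Or31.
- exact: Or32.
apply: Or33; exists s => // t ts t3.
move: dv; rewrite (nformE t) => dv.
have : (p%:Z ^+ 2 %| ell t a b c * ell t (a ^+ 2 + 2 * b * c)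
   (- 2 * c ^+ 2 - a * b) (b ^+ 2 - a * c))%Z.
  rewrite -[X in (_ %| X)%Z](subrK ((t ^+ 3 + 2) * (b * (b ^+ 2 - a * c) +
    c * (- 2 * c ^+ 2 - a * b) + c * (b ^+ 2 - a * c) * t))).
  by rewrite rpredD // dvdz_mulr.
rewrite Gauss_dvdzl // coprimezXl // coprimezE /= prime_coprime //.
have -> : (p %| `|ell t (a ^+ 2 + 2 * b * c) (- 2 * c ^+ 2 - a * b)
     (b ^+ 2 - a * c)|)%N = (p %| ell t (a ^+ 2 + 2 * b * c)
     (- 2 * c ^+ 2 - a * b) (b ^+ 2 - a * c))%Z by [].
have tsF : t%:~R = s%:R :> 'F_p.
  by move: ts; rewrite dvdz_Fp // intrB subr_eq0 => /eqP.
move: lE nC; rewrite !dvdz_Fp // intrB !intr_ell tsF subr_eq0 => /eqP -> nC.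
rewrite (intrM _ (3 * (b ^+ 2 - a * c))) (intrM _ 3) (intrX _ s%:Z).
apply: mulf_neq0; first apply: mulf_neq0 => //.
- rewrite -[3]/(Posz 3) -dvdz_Fp //.
  by apply/negP => /dvdn_leq => /(_ isT) /=; lia.
- rewrite expf_neq0 //; apply/negP => /eqP; rewrite -[s%:~R]/(s%:R) => s0.
  have := croots_Fp pp cs; rewrite s0 expr0n add0r => /eqP.
  rewrite -[2]/(2%:Z%:~R) -dvdz_Fp // => /dvdn_leq => /(_ isT) /=; lia.
Qed.

(** * Equidistribution of boxes in ideal lattices *)

(** Required for every [z], this bounds a covering radius: each coset of the lattice meets the cube
    of radius [k] around 0. *)
Definition attained (q : nat) (r : int) (k : nat) (z : int) :=
  exists a b c : int, [/\ (`|a| <= k)%N, (`|b| <= k)%N, (`|c| <= k)%N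
                        & (q %| ell r a b c - z)%Z].

Lemma attained_leq q r k k' z : (k <= k')%N ->
  attained q r k z -> attained q r k' z.
Proof.
move=> kk [a [b [c [ha hb hc h]]]]; exists a, b, c.
by split=> //; apply: leq_trans kk.
Qed.

(** Replacing a by a + 1 raises the value by 1 and the radius by at most 1, so a radius whose
    enlargement brings nothing new already reaches every residue. *)
Lemma attained_stable q r k :
  (forall z : nat, attained q r k.+1 z -> attained q r k z) ->
  forall z : nat, attained q r k z.
Proof.
move=> h; elim=> [|z IH].
  by exists 0, 0, 0; split=> //; rewrite /ell !mul0r dvdz0.
apply: h; case: IH => a [b [c [ha hb hc d]]]; exists (a + 1), b, c.
split; [lia|lia|lia|].
by rewrite (_ : _ - _ = ell r a b c - z%:Z) // /ell; lia.
Qed.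

Lemma dvdz_eqD (q x y z : int) : (q %| x)%Z -> (q %| y)%Z -> z = x + y ->
  (q %| z)%Z.
Proof. by move=> hx hy ->; rewrite rpredD. Qed.

Lemma dvdz_eqB (q x y z : int) : (q %| x)%Z -> (q %| y)%Z -> z = x - y ->
  (q %| z)%Z.
Proof. by move=> hx hy ->; rewrite rpredB. Qed.

Lemma absz_shift (a : int) (k m i j : nat) : (`|a| <= k)%N -> (i < m)%N ->
  (j < m)%N -> (`|(a + (i%:Z - j%:Z))%R| <= k + m.-1)%N.
Proof. lia. Qed.

Lemma absz_subn_lt (m i j : nat) : (i < m)%N -> (j < m)%N ->
  (`|(i%:Z - j%:Z)%R| <= m.-1)%N.
Proof. lia. Qed.

(* If the residue z0 were missed, each radius 2mi (i < 14) would first attain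
   some residue z_i; the 14 translates of [0,m)^3 by the z_i would then be
   disjoint modulo q. *)
Lemma attained_all (q m : nat) (r : int) : (0 < m)%N ->
  (q %| r ^+ 3 + 2)%Z -> (13 * m.-1 ^ 3 < q <= 13 * m ^ 3)%N ->
  forall z : nat, attained q r (26 * m) z.
Proof.
move=> m0 hr /andP[lt le] z0; apply: contrapT => nz0.
have ex (i : 'I_14) : exists z : nat, attained q r (2 * m * i) z /\
    forall k, (k < 2 * m * i)%N -> ~ attained q r k z.
  have [i0|i0] := posnP i.
    exists 0%N; split; last by move=> k; rewrite i0 muln0.
    by exists 0, 0, 0; split=> //; rewrite /ell !mul0r dvdz0.
  have e : (2 * m * i).-1.+1 = (2 * m * i)%N by lia.
  (* Without a new residue the radius 2 m i - 1 would be stable and, being below 26 m, would reach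
     z0. *)
  apply: contrapT => /forallNP nex; apply: nz0.
  apply: (@attained_leq _ _ (2 * m * i).-1); first by have := ltn_ord i; nia.
  apply: attained_stable => z; rewrite e => hz; apply: contrapT => nz.
  apply: (nex z); split=> // k kl hk; apply: nz; apply: attained_leq hk; lia.
have [zf zfP] := choice ex.
(* A collision with i < i' would reach z_i' within radius 2 m i + (m - 1) < 2 m i', against its
   choice. *)
have key (i i' : 'I_14) (t t' : 'I_m * 'I_m * 'I_m) :
    (q %| ((zf i)%:Z + ell r t.1.1 t.1.2 t.2) -
          ((zf i')%:Z + ell r t'.1.1 t'.1.2 t'.2))%Z -> (i' <= i)%N.
  move=> d; rewrite leqNgt; apply/negP => ii'.
  have [[a [b [c [ha hb hc e]]]] _] := zfP i; have [_ nrep] := zfP i'.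
  apply: (nrep (2 * m * i + m.-1)%N).
    apply: leq_trans (leq_mul (leqnn (2 * m)) ii').
    by rewrite -addnS prednK // mulnS addnC leq_add2r leq_pmull.
  exists (a + (t.1.1%:Z - t'.1.1%:Z)), (b + (t.1.2%:Z - t'.1.2%:Z)),
    (c + (t.2%:Z - t'.2%:Z)).
  split; [exact: absz_shift ha (ltn_ord _) (ltn_ord _) |
    exact: absz_shift hb (ltn_ord _) (ltn_ord _) |
    exact: absz_shift hc (ltn_ord _) (ltn_ord _) | ].
  by apply: (dvdz_eqD d e); rewrite /ell; ring.
case: q hr lt le nz0 ex zf zfP key => [//|q] hr lt le nz0 ex zf zfP key.
pose v (x : 'I_14 * ('I_m * 'I_m * 'I_m)) : int :=
  (zf x.1)%:Z + ell r x.2.1.1 x.2.1.2 x.2.2.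
pose phi x : 'I_q.+1 := inord `|(v x %% q.+1)%Z|.
have phi_inj : injective phi.
  have q0 : q.+1%:Z != 0 by [].
  have phi_dvd x y : phi x = phi y -> (q.+1 %| v x - v y)%Z.
    move=> e; rewrite -eqz_mod_dvd; apply/eqP.
    have lt_mod z : (`|(z %% q.+1)%Z| < q.+1)%N.
      by rewrite -ltz_nat gez0_abs ?modz_ge0 // ltz_pmod.
    have := congr1 val e; rewrite /= !inordK // => e'.
    by rewrite -[LHS]gez0_abs ?modz_ge0 // e' gez0_abs ?modz_ge0.
  move=> [i [[a b] c]] [i' [[a' b'] c']] e.
  have ii' : i = i'.
    apply/val_inj/eqP; rewrite eqn_leq.
    by rewrite (key _ _ _ _ (phi_dvd _ _ e)) (key _ _ _ _ (phi_dvd _ _ (esym e))).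
  have := phi_dvd _ _ e; rewrite /v /= ii'.
  rewrite (_ : _ - _ = ell r (a%:Z - a'%:Z) (b%:Z - b'%:Z) (c%:Z - c'%:Z));
    last by rewrite /ell; ring.
  move=> /(nform_dvd_ell hr) dN.
  have [] := @nform_small q.+1 m.-1 (a%:Z - a'%:Z) (b%:Z - b'%:Z)
    (c%:Z - c'%:Z) _ _ _ lt dN.
  - exact: absz_subn_lt (ltn_ord _) (ltn_ord _).
  - exact: absz_subn_lt (ltn_ord _) (ltn_ord _).
  - exact: absz_subn_lt (ltn_ord _) (ltn_ord _).
  move=> /eqP; rewrite subr_eq0 => /eqP[/val_inj ->].
  move=> /eqP; rewrite subr_eq0 => /eqP[/val_inj ->].
  by move=> /eqP; rewrite subr_eq0 => /eqP[/val_inj ->].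
(* 14 m^3 distinct residues modulo q, while q <= 13 m^3. *)
have := leq_card phi phi_inj; rewrite !card_prod !card_ord.
have m3 : (0 < m ^ 3)%N by rewrite expn_gt0 m0.
have -> : (m * m * m = m ^ 3)%N by rewrite !expnS expn0 muln1 mulnA.
lia.
Qed.

Definition lattice_count (q : nat) (r : int) (Y : nat) (z : int) : nat :=
  #|[set t : 'I_Y * 'I_Y * 'I_Y | (q %| ell r t.1.1 t.1.2 t.2 - z)%Z]|.

Lemma sum_lattice_count q r Y : (0 < q)%N ->
  (\sum_(z < q) lattice_count q r Y z = Y ^ 3)%N.
Proof.
move=> q0; have q0' : q%:Z != 0 by lia.
under eq_bigr do rewrite /lattice_count -sum1_card.
under eq_bigr do rewrite big_mkcond /=.
rewrite exchange_big /= (eq_bigr (fun=> 1%N)) => [|t _].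
  by rewrite sum1_card !card_prod !card_ord expnS expnS expn1 mulnA.
pose w := ell r t.1.1 t.1.2 t.2.
have ltw : (`|(w %% q)%Z| < q)%N.
  by rewrite -ltz_nat gez0_abs ?modz_ge0 // ltz_pmod.
rewrite (bigD1 (Ordinal ltw)) //= inE -/w -eqz_mod_dvd.
rewrite gez0_abs ?modz_ge0 // modz_mod eqxx big1 // => i ne.
rewrite inE -/w -eqz_mod_dvd; case: eqP => // e; case/eqP: ne.
apply: val_inj => /=; rewrite e modz_small //; first by have := ltn_ord i; lia.
Qed.

(** A vector (a, b, c) of the cube of radius J with the right residue carries one coset into the
    other. The extra translation by (J, J, J) keeps the coordinates nonnegative, at the cost of 2 J
    in the side. *)
Lemma lattice_count_shift q r Y J e z : (0 < q)%N ->
  (forall z : nat, attained q r J z) ->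
  (lattice_count q r Y e <= lattice_count q r (Y + 2 * J) z)%N.
Proof.
move=> q0 H; have q0' : q%:Z != 0 by lia.
pose w := z - e - ell r J J J.
have [a [b [c [ha hb hc d]]]] := H `|(w %% q)%Z|%N.
have {}d : (q %| ell r a b c - w)%Z.
  move: d; rewrite gez0_abs ?modz_ge0 // -!eqz_mod_dvd modz_mod //.
case: (posnP Y) => [Y0|Y0].
  rewrite /lattice_count (_ : [set _ | _] = finset.set0) ?cards0 //.
  by apply/setP => -[[[i hi] ?] ?]; exfalso; lia.
have pos : (0 < Y + 2 * J)%N by lia.
have eY : (Y + 2 * J).-1.+1 = (Y + 2 * J)%N by lia.
pose sh (u : int) (i : 'I_Y) : 'I_(Y + 2 * J) :=
  cast_ord eY (inord `|i%:Z + J%:Z + u|).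
have shE u (i : 'I_Y) : (`|u| <= J)%N -> (sh u i)%:Z = i%:Z + J%:Z + u.
  move=> hu; rewrite /= inordK; have := ltn_ord i; lia.
pose psi (t : 'I_Y * 'I_Y * 'I_Y) := (sh a t.1.1, sh b t.1.2, sh c t.2).
have sh_inj u : (`|u| <= J)%N -> injective (sh u).
  move=> hu i j /(congr1 (fun i => (val i)%:Z)); rewrite !shE //.
  by move=> /addIr /addIr [/val_inj].
have psi_inj : injective psi.
  move=> [[i j] l] [[i' j'] l'] eq_psi.
  have /= /(sh_inj _ ha) -> := congr1 (fun t => t.1.1) eq_psi.
  have /= /(sh_inj _ hb) -> := congr1 (fun t => t.1.2) eq_psi.
  by have /= /(sh_inj _ hc) -> := congr1 (fun t => t.2) eq_psi.
rewrite /lattice_count -(card_imset _ psi_inj); apply: subset_leq_card.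
apply/fintype.subsetP => _ /imsetP[t ht ->]; rewrite inE !shE //.
move: ht; rewrite inE => ht; apply: (dvdz_eqD ht d).
by rewrite /w /ell; ring.
Qed.

(** The shift bound is averaged over the q cosets, whose counts add up to the volume of the larger
    cube. *)
Lemma lattice_count_le q r Y J e : (0 < q)%N ->
  (forall z : nat, attained q r J z) ->
  (q * lattice_count q r Y e <= (Y + 2 * J) ^ 3)%N.
Proof.
move=> q0 H; rewrite -(sum_lattice_count r _ q0) -{1}(card_ord q).
by rewrite -sum_nat_const; apply: leq_sum => z _; exact: lattice_count_shift.
Qed.

Lemma lattice_count_ge q r Y J e : (0 < q)%N ->
  (forall z : nat, attained q r J z) ->
  (Y ^ 3 <= q * lattice_count q r (Y + 2 * J) e)%N.
Proof.
move=> q0 H; rewrite -(sum_lattice_count r _ q0) -[X in (_ <= X * _)%N](card_ord q).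
by rewrite -sum_nat_const; apply: leq_sum => z _; exact: lattice_count_shift.
Qed.

(** Cut the cube into boxes of side m: two points of E in one box differ by a vector of size at most
    m - 1, which [nform_small] makes zero. *)
Lemma card_separated (q m Y : nat) (E : {set 'I_Y * 'I_Y * 'I_Y}) :
  (0 < m)%N -> (13 * m.-1 ^ 3 < q)%N ->
  (forall t t', t \in E -> t' \in E ->
     (q %| nform (t.1.1%:Z - t'.1.1%:Z) (t.1.2%:Z - t'.1.2%:Z)
                 (t.2%:Z - t'.2%:Z))%Z) ->
  (#|E| <= (Y %/ m).+1 ^ 3)%N.
Proof.
move=> m0 lt sep.
pose d (i : 'I_Y) : 'I_(Y %/ m).+1 := inord (i %/ m).
have dE i : d i = (i %/ m)%N :> nat.
  by rewrite inordK // ltnS leq_div2r // ltnW.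
have dclose (i j : 'I_Y) : d i = d j -> (`|(i%:Z - j%:Z)%R| <= m.-1)%N.
  move=> /(congr1 val); rewrite /= !dE => e.
  have := divn_eq i m; have := divn_eq j m; rewrite e.
  have := ltn_pmod i m0; have := ltn_pmod j m0; lia.
pose phi (t : 'I_Y * 'I_Y * 'I_Y) := (d t.1.1, d t.1.2, d t.2).
have inj : {in E &, injective phi}.
  move=> [[i j] l] [[i' j'] l'] h h' [/dclose e1 /dclose e2 /dclose e3].
  have [] := nform_small e1 e2 e3 lt (sep _ _ h h').
  move=> /eqP; rewrite subr_eq0 => /eqP[/val_inj ->].
  move=> /eqP; rewrite subr_eq0 => /eqP[/val_inj ->].
  by move=> /eqP; rewrite subr_eq0 => /eqP[/val_inj ->].
rewrite -(card_in_imset inj); apply: (leq_trans (max_card _)).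
by rewrite !card_prod !card_ord expnS expnS expn1 mulnA.
Qed.

(** m is the least integer with q <= 13 m^3, so it has order q^(1/3). *)
Lemma scale_exists (q : nat) : (0 < q)%N ->
  exists2 m : nat, (0 < m)%N & (13 * m.-1 ^ 3 < q <= 13 * m ^ 3)%N.
Proof.
move=> q0; have ex : exists m, (q <= 13 * m ^ 3)%N.
  exists q; have := leq_pexp2l q0 (isT : (1 <= 3)%N); rewrite expn1; lia.
case: (ex_minnP ex) => m hm min; have m0 : (0 < m)%N.
  by case: m hm {min} => //; rewrite exp0n // muln0; lia.
exists m => //; rewrite hm andbT ltnNge; apply/negP => h.
have := min _ h; lia.
Qed.

(** * Chebyshev's bound *)

Section Chebyshev.
Variable R : realType.

Lemma ln_natr_ge0 n : 0 <= ln n%:R :> R.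
Proof.
case: n => [|n]; first by rewrite ln0.
by rewrite ln_ge0 // ler1n.
Qed.

Lemma ln_nat_primes (N B : nat) : (0 < N < B)%N ->
  ln N%:R = \sum_(0 <= p < B | prime p) (logn p N)%:R * ln p%:R :> R.
Proof.
move=> /andP[N0 NB]; rewrite -[RHS]expRK; congr (ln _).
rewrite expR_sum -{1}(partnT N0).
case: B NB => // B NB; rewrite (widen_partn _ (NB : (N <= B)%N)).
rewrite natr_prod [RHS]big_mkcond [LHS]big_mkcond /=.
apply: eq_bigr => p _; case: ifP => pp.
- by rewrite natrX expRM_natl lnK // posrE ltr0n prime_gt0.
- by rewrite lognE pp expn0.
Qed.

Lemma sum_ln_le (N B : nat) (m : nat -> nat) : (0 < N)%N ->
  (forall p, prime p -> (p ^ m p %| N)%N) ->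
  \sum_(0 <= p < B | prime p) (m p)%:R * ln p%:R <= ln N%:R :> R.
Proof.
move=> N0 dv; rewrite (@ln_nat_primes N (maxn B N.+1)) ?N0 ?leq_max ?leqnn ?orbT //.
rewrite [leRHS](big_cat_nat (n := B)) ?leq_maxl //=.
apply: (@le_trans _ _
  (\sum_(0 <= p < B | prime p) (logn p N)%:R * ln p%:R)); last first.
  by rewrite lerDl sumr_ge0 // => p _; rewrite mulr_ge0 // ln_natr_ge0.
apply: ler_sum => p pp; rewrite ler_wpM2r ?ln_natr_ge0 // ler_nat.
by rewrite -pfactor_dvdn // dv.
Qed.

Lemma central_bin_le n : ('C(n.*2, n) <= 2 ^ n.*2)%N.
Proof.
have := expnDn 1 1 n.*2; rewrite -/(addn 1 1) => ->.
have nn : (n < n.*2.+1)%N by rewrite ltnS -addnn leq_addr.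
by rewrite (bigD1 (Ordinal nn)) //= !exp1n !muln1 leq_addr.
Qed.

Lemma prime_dvd_central_bin n p : prime p -> (n < p <= n.*2)%N ->
  (p %| 'C(n.*2, n))%N.
Proof.
move=> pp /andP[np pn].
have : (p %| (n.*2)`!)%N by rewrite dvdn_fact // prime_gt0.
have nn : (n <= n.*2)%N by rewrite -addnn leq_addr.
rewrite -(bin_fact nn) -addnn addnK addnn !Euclid_dvdM // => /orP[//|].
suff -> : (p %| n`!)%N = false by [].
apply/negbTE/negP; elim: n np {pn nn} => [|n IH] np.
  by rewrite fact0 Euclid_dvd1.
rewrite factS Euclid_dvdM // => /orP[/dvdn_leq|]; last by apply: IH; exact: ltnW.
by move=> /(_ isT); rewrite leqNgt np.
Qed.

(** With n = 2^i, the primes in (n, 2 n] divide the central binomial coefficient, which is at most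
    4^n; as log 2 <= 1, passing from n to 2 n adds at most 2 n. *)
Lemma theta_pow2_le i :
  \sum_(0 <= p < (2 ^ i).+1 | prime p) ln p%:R <= 2 ^+ i.+1 :> R.
Proof.
elim: i => [|i IH].
  rewrite expn0 big_mkcond big_nat_recl // big_nat1 /= add0r.
  by rewrite ler0n.
set n := (2 ^ i)%N in IH *.
have e : (2 ^ i.+1)%N = n.*2 by rewrite expnS mul2n.
rewrite e (big_cat_nat (n := n.+1)) //=; last by rewrite ltnS -addnn leq_addr.
rewrite exprS mulr_natl mulr2n lerD //.
have : \sum_(0 <= p < n.*2.+1 | prime p) (n < p)%N%:R * ln p%:R <=
    ln ('C(n.*2, n)%N%:R) :> R.
  apply: le_trans (sum_ln_le n.*2.+1 (N := 'C(n.*2, n))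
    (m := fun p => (n < p <= n.*2)%N) _ _); last 2 first.
  - by rewrite bin_gt0 -addnn leq_addr.
  - by move=> p pp; case h : (n < p <= n.*2)%N; rewrite ?expn0 // expn1
      prime_dvd_central_bin.
  rewrite big_nat_cond [leRHS]big_nat_cond; apply: ler_sum => p.
  by rewrite ltnS => /andP[/andP[_ h] _]; rewrite h andbT.
move=> h; apply: le_trans (le_trans h _).
  rewrite [leRHS](big_cat_nat (n := n.+1)) //=; last by rewrite ltnS -addnn leq_addr.
  rewrite -[leLHS]add0r lerD //.
    by rewrite sumr_ge0 // => p _; rewrite mulr_ge0 // ln_natr_ge0.
  rewrite big_nat_cond [leRHS]big_nat_cond; apply: ler_sum => p.
  by move=> /andP[/andP[np _] _]; rewrite np mul1r.
apply: (@le_trans _ _ (ln (2 ^ n.*2)%N%:R)).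
  by rewrite ler_ln ?posrE ?ltr0n ?expn_gt0 ?bin_gt0 -?addnn ?leq_addr //
     addnn ler_nat central_bin_le.
rewrite natrX lnXn // -[ln _ *+ _]mulr_natl -addnn natrD /n natrX exprS.
have l2 : ln 2 <= 1 :> R.
  by have := @le_ln1Dx R 1; rewrite (_ : 1 + 1 = 2) //; apply; lra.
have : 0 <= 2 ^+ i :> R by exact: exprn_ge0.
set x := 2 ^+ i => x0; nra.
Qed.

Lemma theta_pow8_le i :
  \sum_(0 <= p < 8 ^ i | prime p) ln p%:R <= 2 * 8 ^+ i :> R.
Proof.
have := theta_pow2_le (3 * i); rewrite expnM exprS exprM.
rewrite [X in 2 * X ^+ i](_ : _ = 8); last by rewrite -natrX.
apply: le_trans; rewrite [leRHS](big_cat_nat (n := (8 ^ i))) //=.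
by rewrite lerDl sumr_ge0 // => p _; exact: ln_natr_ge0.
Qed.

Lemma trunc_log8E i p : (8 ^ i <= p < 8 ^ i.+1)%N -> trunc_log 8 p = i.
Proof. by move=> h; apply: trunc_log_eq. Qed.

(** [2 ^+ trunc_log 8 p] stands for p^(1/3) up to a factor 2. The primes between 8^I and 8^(I + 1)
    contribute at most 2 * 8 * 2^I, and the bound is the geometric sum of these. *)
Lemma sum_ln_scale_le I :
  \sum_(0 <= p < 8 ^ I | prime p) ln p%:R / p%:R * 2 ^+ trunc_log 8 p
    <= 16 * 2 ^+ I :> R.
Proof.
elim: I => [|I IH].
  by rewrite expn0 expr0 mulr1 big_mkcond big_nat1 /= ler0n.
rewrite (big_cat_nat (n := 8 ^ I)) ?leq_exp2l //=.
have -> : 16 * 2 ^+ I.+1 = 16 * 2 ^+ I + 16 * 2 ^+ I :> R by rewrite exprS; ring.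
rewrite lerD //.
apply: (@le_trans _ _ (\sum_(8 ^ I <= p < 8 ^ I.+1 | prime p)
   ln p%:R * (2 ^+ I / 8 ^+ I))).
  rewrite big_nat_cond [leRHS]big_nat_cond; apply: ler_sum => p.
  move=> /andP[pI pp]; rewrite (trunc_log8E pI) -mulrA.
  rewrite ler_wpM2l ?ln_natr_ge0 // mulrC ler_wpM2l ?exprn_ge0 //.
  have : 0 < 8 ^+ I :> R by exact: exprn_gt0.
  move=> h8; rewrite lef_pV2 ?posrE //; last by rewrite ltr0n prime_gt0.
  by rewrite -natrX ler_nat; case/andP: pI.
rewrite -mulr_suml.
have := theta_pow8_le I.+1; rewrite (big_cat_nat (n := 8 ^ I)) ?leq_exp2l //=.
set x := \sum_(_ <= _ < _ | _) _; set y := \sum_(_ <= _ < _ | _) _ => h.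
have {h} : y <= 2 * 8 ^+ I.+1.
  apply: le_trans h; rewrite lerDr sumr_ge0 // => p _; exact: ln_natr_ge0.
have h8 : 0 < 8 ^+ I :> R by exact: exprn_gt0.
have h2 : 0 < 2 ^+ I :> R by exact: exprn_gt0.
move=> h; rewrite mulrA ler_pdivrMr //; rewrite exprS in h.
apply: (@le_trans _ _ (2 * (8 * 8 ^+ I) * 2 ^+ I)).
  by rewrite ler_wpM2r // ltW.
lra.
Qed.

End Chebyshev.

(** * Mertens' theorem for the roots of r^3 + 2 *)

Notation cube Y := ('I_Y * 'I_Y * 'I_Y)%type.

(* On this box a > 3MY and 0 <= b, c < MY, away from the zeros of the norm form.
   Its points are congruent to (1, 0, 0) modulo M, so their norms are prime to M. *)
Definition box_a (M Y : nat) (t : cube Y) : int := 1 + M%:Z * (3 * Y%:Z + t.1.1%:Z).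
Definition box_b (M Y : nat) (t : cube Y) : int := M%:Z * t.1.2%:Z.
Definition box_c (M Y : nat) (t : cube Y) : int := M%:Z * t.2%:Z.

Definition box_norm (M Y : nat) (t : cube Y) : int :=
  nform (box_a M t) (box_b M t) (box_c M t).
Definition box_ell (r : int) (M Y : nat) (t : cube Y) : int :=
  ell r (box_a M t) (box_b M t) (box_c M t).

Definition box_count (p : nat) (r : int) (M Y : nat) : nat :=
  #|[set t : cube Y | (p %| box_ell r M t)%Z]|.

(** a^3 >= 27 y^3 outweighs - 2 b^3, the only negative term. *)
Lemma nform_ge (y a b c : int) : 3 * y <= a -> 0 <= b <= y -> 0 <= c <= y ->
  y ^+ 3 <= nform a b c.
Proof.
move=> ha /andP[b0 hb] /andP[c0 hc]; have y0 : 0 <= y by apply: le_trans hb.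
have a0 : 0 <= a by apply: le_trans ha; apply: mulr_ge0.
have h1 : (3 * y) ^+ 3 <= a ^+ 3 by rewrite lerXn2r ?nnegrE // mulr_ge0.
have h2 : b ^+ 3 <= y ^+ 3 by rewrite lerXn2r ?nnegrE.
have h3 : 0 <= c ^+ 3 by exact: exprn_ge0.
have h4 : 0 <= a * b * c by rewrite !mulr_ge0.
have h5 : 0 <= y ^+ 3 by exact: exprn_ge0.
rewrite /nform (_ : 6 * a * b * c = 6 * (a * b * c)); last by ring.
rewrite (_ : (3 * y) ^+ 3 = 27 * y ^+ 3) in h1; last by ring.
move: h1 h2 h3 h4 h5.
set A := a ^+ 3; set B := b ^+ 3; set C := c ^+ 3; set D := a * b * c.
set Z := y ^+ 3; lia.
Qed.

(** 92 = 4^3 + 4 + 6 * 4, from a^3, 4 c^3 and 6 a b c. *)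
Lemma nform_le (y a b c : int) : 0 <= a <= 4 * y -> 0 <= b <= y ->
  0 <= c <= y -> nform a b c <= 92 * y ^+ 3.
Proof.
move=> /andP[a0 ha] /andP[b0 hb] /andP[c0 hc].
have y0 : 0 <= y by apply: le_trans hb.
have h1 : a ^+ 3 <= (4 * y) ^+ 3 by rewrite lerXn2r ?nnegrE // mulr_ge0.
have h2 : 0 <= b ^+ 3 by exact: exprn_ge0.
have h3 : c ^+ 3 <= y ^+ 3 by rewrite lerXn2r ?nnegrE.
have h4 : a * b * c <= 4 * y * y * y.
  by apply: ler_pM => //; [exact: mulr_ge0|exact: ler_pM].
rewrite /nform (_ : 6 * a * b * c = 6 * (a * b * c)); last by ring.
rewrite (_ : (4 * y) ^+ 3 = 64 * y ^+ 3) in h1; last by ring.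
rewrite (_ : 4 * y * y * y = 4 * y ^+ 3) in h4; last by ring.
move: h1 h2 h3 h4.
set A := a ^+ 3; set B := b ^+ 3; set C := c ^+ 3; set D := a * b * c.
set Z := y ^+ 3; lia.
Qed.

Lemma box_coord_bounds (M Y : nat) (t : cube Y) : (0 < M)%N ->
  [/\ 3 * (M%:Z * Y%:Z) <= box_a M t, 0 <= box_a M t <= 4 * (M%:Z * Y%:Z),
      0 <= box_b M t <= M%:Z * Y%:Z & 0 <= box_c M t <= M%:Z * Y%:Z].
Proof.
move=> M0; have mono (i : 'I_Y) : 0 <= M%:Z * i%:Z <= M%:Z * Y%:Z - M%:Z.
  rewrite -!PoszM; apply/andP; split => //.
  have := leq_mul (leqnn M) (ltn_ord i); rewrite mulnS; lia.
have := mono t.1.1; have := mono t.1.2; have := mono t.2.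
rewrite /box_a /box_b /box_c mulrDr.
have -> : M%:Z * (3 * Y%:Z) = 3 * (M%:Z * Y%:Z) by ring.
have : 0 <= M%:Z * Y%:Z by [].
set u := M%:Z * Y%:Z; set x := M%:Z * t.1.1%:Z; set y := M%:Z * t.1.2%:Z.
set z := M%:Z * t.2%:Z.
by clearbody u x y z; move=> *; split; lia.
Qed.

Lemma box_norm_bounds (M Y : nat) (t : cube Y) : (0 < M)%N ->
  ((M * Y) ^ 3 <= `|box_norm M t| <= 92 * (M * Y) ^ 3)%N.
Proof.
move=> M0; have [h1 h2 h3 h4] := box_coord_bounds t M0.
have l := nform_ge h1 h3 h4; have u := nform_le h2 h3 h4.
have e : ((M * Y) ^ 3)%N%:Z = (M%:Z * Y%:Z) ^+ 3.
  by rewrite -[LHS]natz natrX natrM !natz.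
have p0 : 0 <= (M%:Z * Y%:Z) ^+ 3 by rewrite -e.
have pos : 0 <= box_norm M t by apply: le_trans l.
by rewrite -!lez_nat gez0_abs // PoszM e l u.
Qed.

Lemma box_ellE r M Y (t : cube Y) : box_ell r M t =
  1 + 3 * (M%:Z * Y%:Z) + M%:Z * ell r t.1.1%:Z t.1.2%:Z t.2%:Z.
Proof. by rewrite /box_ell /box_a /box_b /box_c /ell; ring. Qed.

Lemma box_count1 p r Y :
  box_count p r 1 Y = lattice_count p r Y (- (1 + 3 * Y%:Z)).
Proof.
rewrite /box_count /lattice_count; congr #|pred_of_set _|.
apply/setP => t; rewrite !inE box_ellE.
congr dvdn; congr absz; ring.
Qed.

(** With k = trunc_log 8 q, 13 (m - 1)^3 < q < 8^(k + 1) gives m <= 2^(k + 1), so the radius 26 m is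
    at most 52 * 2^k. *)
Lemma attained_trunc_log (q : nat) (r : int) : (0 < q)%N ->
  (q %| r ^+ 3 + 2)%Z ->
  forall z : nat, attained q r (52 * 2 ^ trunc_log 8 q) z.
Proof.
move=> q0 hr; have [m m0 hm] := scale_exists q0.
move=> z; apply: attained_leq (attained_all m0 hr hm z).
have /andP[lt _] := hm; have := trunc_log_ltn q (isT : (1 < 8)%N).
set k := trunc_log 8 q; rewrite (_ : 8 = 2 ^ 3)%N // -expnM mulnC expnM => lt2.
have : (m.-1 ^ 3 < (2 ^ k.+1) ^ 3)%N by lia.
rewrite ltn_exp2r // expnS; lia.
Qed.

(** Since M is a unit modulo p, all counted points lie in the lattice coset of any one of them. The
    enlargement 104 * 2^k is twice the covering radius. *)
Lemma box_count_le p r M Y : (0 < p)%N -> coprime p M ->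
  (p %| r ^+ 3 + 2)%Z ->
  (p * box_count p r M Y <= (Y + 104 * 2 ^ trunc_log 8 p) ^ 3)%N.
Proof.
move=> p0 cop hr; rewrite /box_count.
set E := [set t | _]; have [->|[t0 Et0]] := set_0Vmem E.
  by rewrite cards0 muln0.
pose e := ell r t0.1.1 t0.1.2 t0.2.
rewrite (_ : 104 = 2 * 52)%N // -mulnA.
apply: leq_trans (lattice_count_le Y e p0 (attained_trunc_log p0 hr)).
rewrite leq_mul2l; apply/orP; right; apply: subset_leq_card.
apply/fintype.subsetP => t; move: Et0; rewrite !inE !box_ellE => h0 h.
have : (p %| M%:Z * (ell r t.1.1 t.1.2 t.2 - e))%Z.
  by apply: (dvdz_eqB h h0); rewrite /e; ring.
by rewrite Gauss_dvdzr.
Qed.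

Lemma box_count1_ge p r Y w : (0 < p)%N -> (p %| r ^+ 3 + 2)%Z ->
  w = (104 * 2 ^ trunc_log 8 p)%N ->
  (w <= Y -> (Y - w) ^ 3 <= p * box_count p r 1 Y)%N.
Proof.
move=> p0 hr -> le; rewrite box_count1.
rewrite -[X in lattice_count _ _ X](subnK le) (_ : 104 = 2 * 52)%N // -mulnA.
exact: lattice_count_ge (attained_trunc_log p0 hr).
Qed.

(** * The upper bound in Mertens' formula *)

Section MertensUpper.
Variable R : realType.

Definition mertens (B : nat) : R :=
  \sum_(0 <= p < B | prime p) (rho p)%:R * ln p%:R / p%:R.

Definition hits (M Y : nat) (t : cube Y) (p : nat) : nat :=
  count (fun r : nat => (p %| box_ell r%:Z M t)%Z) (croots p).

Lemma sum_box_count p M Y :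
  (\sum_(r <- croots p) box_count p r%:Z M Y = \sum_(t : cube Y) hits M t p)%N.
Proof.
rewrite /box_count /hits.
under eq_bigr do rewrite -sum1_card big_mkcond /=.
rewrite exchange_big /=; apply: eq_bigr => t _.
by rewrite -sum1_count [RHS]big_mkcond /=; apply: eq_bigr => r _; rewrite inE.
Qed.

Lemma sum_box_count_ln B M Y :
  \sum_(0 <= p < B | prime p) (\sum_(r <- croots p) box_count p r%:Z M Y)%N%:R
     * ln p%:R =
  \sum_(t : cube Y) \sum_(0 <= p < B | prime p) (hits M t p)%:R * ln p%:R :> R.
Proof.
rewrite exchange_big /=; apply: eq_bigr => p pp.
by rewrite sum_box_count natr_sum mulr_suml.
Qed.

Lemma card_cube Y : #|{: cube Y}| = (Y ^ 3)%N.
Proof. by rewrite !card_prod !card_ord expnS expnS expn1 mulnA. Qed.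

Lemma sum_rho_scale_le I :
  \sum_(0 <= p < 8 ^ I | prime p)
    (rho p)%:R * ln p%:R / p%:R * 2 ^+ trunc_log 8 p <= 48 * 2 ^+ I :> R.
Proof.
have -> : 48 * 2 ^+ I = 3 * (16 * 2 ^+ I) :> R by ring.
apply: le_trans (ler_wpM2l _ (sum_ln_scale_le R I)) => //.
rewrite mulr_sumr; apply: ler_sum => p pp.
rewrite -!mulrA ler_wpM2r //; last by rewrite (ler_nat _ _ 3) rho_le3.
by rewrite mulr_ge0 ?ln_natr_ge0 // mulr_ge0 ?invr_ge0 // exprn_ge0.
Qed.

(** A linear minorant of (Y - w)^3. It remains valid for w > Y, where it is negative. *)
Lemma box_count1_lower p r Y : prime p -> r \in croots p ->
  (Y%:R ^+ 3 - 3 * Y%:R ^+ 2 * (104 * 2 ^+ trunc_log 8 p)) / p%:R <=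
  (box_count p r%:Z 1 Y)%:R :> R.
Proof.
move=> pp cr; have p0 := prime_gt0 pp.
rewrite ler_pdivrMr ?ltr0n // [leRHS]mulrC -natrM.
pose w := (104 * 2 ^ trunc_log 8 p)%N.
have -> : 104 * 2 ^+ trunc_log 8 p = w%:R :> R by rewrite natrM natrX.
have [wY|Yw] := leqP w Y.
  have := box_count1_ge p0 (croots_dvdz cr) (erefl w) wY.
  rewrite -(ler_nat R) natrX natrB //; apply: le_trans.
  have : w%:R <= Y%:R :> R by rewrite ler_nat.
  have : 0 <= w%:R :> R by [].
  set x := Y%:R; set y := w%:R => y0 yx.
  have -> : (x - y) ^+ 3 = x ^+ 3 - 3 * x ^+ 2 * y + y ^+ 2 * (3 * x - y) by ring.
  by rewrite lerDl mulr_ge0 ?sqr_ge0 //; lra.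
apply: (@le_trans _ _ 0) => //.
have : Y%:R <= w%:R :> R by rewrite ler_nat ltnW.
have : 0 <= Y%:R :> R by [].
set x := Y%:R; set y := w%:R => x0 xy.
have -> : x ^+ 3 - 3 * x ^+ 2 * y = x ^+ 2 * (x - 3 * y) by ring.
by rewrite mulr_ge0_le0 ?sqr_ge0 //; lra.
Qed.

(** With Y = 2^I the primes run up to Y^3. In the constant, log 92 comes from the size of the norms
    and 3 * 104 * 48 from the boundary error 3 Y^2 * 104 summed against at most 48 Y. *)
Lemma mertens_pow8_le I :
  mertens (8 ^ I) <= I%:R * ln 8 + (ln 92 + 3 * 104 * 48).
Proof.
pose Y := (2 ^ I)%N; pose y : R := Y%:R.
have y0 : 0 < y by rewrite ltr0n expn_gt0.
have yE : y = 2 ^+ I by rewrite /y natrX.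
have y3 : 0 < y ^+ 3 by exact: exprn_gt0.
rewrite -(ler_pM2l y3).
pose G := \sum_(t : cube Y) ln (`|box_norm 1 t|%N%:R) : R.
have upG : G <= y ^+ 3 * (ln 92 + I%:R * ln 8).
  apply: (@le_trans _ _ (\sum_(t : cube Y) (ln 92 + I%:R * ln 8))); last first.
    by rewrite sumr_const card_cube -[X in X <= _]mulr_natl natrX.
  apply: ler_sum => t _; have /andP[h1 h2] := box_norm_bounds t (isT : (0 < 1)%N).
  have Y3 : (0 < (1 * Y) ^ 3)%N by rewrite expn_gt0 mul1n expn_gt0.
  have -> : ln 92 + I%:R * ln 8 = ln ((92 * (1 * Y) ^ 3)%N%:R) :> R.
    rewrite natrM lnM ?posrE ?ltr0n //; congr (_ + _).
    by rewrite mul1n -expnM mulnC expnM natrX lnXn ?ltr0n // mulr_natl.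
  have N0 := leq_trans Y3 h1.
  by rewrite ler_ln ?ler_nat // posrE ltr0n // muln_gt0 Y3.
have loG : \sum_(0 <= p < 8 ^ I | prime p)
    (\sum_(r <- croots p) box_count p r%:Z 1 Y)%N%:R * ln p%:R <= G.
  rewrite sum_box_count_ln; apply: ler_sum => t _.
  have /andP[h1 _] := box_norm_bounds t (isT : (0 < 1)%N).
  apply: sum_ln_le; last by move=> p pp; exact: expn_count_croots_dvd.
  by apply: leq_trans h1; rewrite expn_gt0 mul1n expn_gt0.
have lo2 : y ^+ 3 * mertens (8 ^ I) - 3 * y ^+ 2 * 104 *
    (\sum_(0 <= p < 8 ^ I | prime p)
       (rho p)%:R * ln p%:R / p%:R * 2 ^+ trunc_log 8 p) <= G.
  apply: le_trans loG; rewrite /mertens !mulr_sumr -sumrB.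
  apply: ler_sum => p pp.
  rewrite natr_sum.
  apply: (@le_trans _ _ ((\sum_(r <- croots p)
     ((y ^+ 3 - 3 * y ^+ 2 * (104 * 2 ^+ trunc_log 8 p)) / p%:R)) * ln p%:R)).
    rewrite big_const_seq count_predT iter_addr_0 -/(rho p) -[X in _ <= X * _]mulr_natl.
    by rewrite le_eqVlt; apply/orP; left; apply/eqP; ring.
  rewrite ler_wpM2r ?ln_natr_ge0 // !big_seq.
  by apply: ler_sum => r cr; exact: box_count1_lower.
have := sum_rho_scale_le I; rewrite -yE => hs.
have := lo2; set S := \sum_(_ <= _ < _ | _) _ in hs * => {}lo2.
have e : 3 * y ^+ 2 * 104 * S <= 3 * y ^+ 2 * 104 * (48 * y).
  by rewrite ler_wpM2l // !mulr_ge0 // sqr_ge0.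
rewrite mulrDr.
have -> : y ^+ 3 * (ln 92 + 3 * 104 * 48) =
   y ^+ 3 * ln 92 + 3 * y ^+ 2 * 104 * (48 * y) by ring.
rewrite mulrDr in upG; move: upG lo2 e.
set a := 3 * y ^+ 2 * 104 * S; set b := 3 * y ^+ 2 * 104 * (48 * y).
set c := y ^+ 3 * mertens _; set d := y ^+ 3 * (_ * _); set f := y ^+ 3 * ln 92.
by move=> *; lra.
Qed.

End MertensUpper.

(** * Box points whose norm is divisible by the square of a prime *)

Lemma PoszX (p n : nat) : (p ^ n)%N%:Z = p%:Z ^+ n.
Proof. by rewrite -[LHS]natz natrX natz. Qed.

(** Differences of box points are M times differences of cube points, and M^3 is prime to p^2, so
    the separation bound applies with q = p^2. *)
Lemma box_class_card (p m M Y : nat) (E : {set cube Y}) :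
  prime p -> coprime p M -> (0 < m)%N -> (13 * m.-1 ^ 3 < p ^ 2)%N ->
  (forall t t', t \in E -> t' \in E ->
     (p%:Z ^+ 2 %| nform (box_a M t - box_a M t') (box_b M t - box_b M t')
                  (box_c M t - box_c M t'))%Z) ->
  (#|E| <= (Y %/ m).+1 ^ 3)%N.
Proof.
move=> pp cop m0 lt sep; apply: (card_separated m0 lt) => t t' Et Et'.
have := sep t t' Et Et'; rewrite PoszX.
rewrite (_ : box_a M t - box_a M t' = M%:Z * (t.1.1%:Z - t'.1.1%:Z));
  last by rewrite /box_a; ring.
rewrite (_ : box_b M t - box_b M t' = M%:Z * (t.1.2%:Z - t'.1.2%:Z));
  last by rewrite /box_b; ring.
rewrite (_ : box_c M t - box_c M t' = M%:Z * (t.2%:Z - t'.2%:Z));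
  last by rewrite /box_c; ring.
rewrite nform_scale Gauss_dvdzr // -!PoszX coprimezE /=.
by rewrite coprimeXl // coprimeXr.
Qed.

(** 7 = 1 + 3 + 3: one class where p divides all coordinates, and for each of at most three roots a
    cofactor class and a class given by the lifted root. In each class the differences again have
    norm divisible by p^2. *)
Lemma box_bad_card (p m M Y : nat) : prime p -> (3 < p)%N -> coprime p M ->
  (0 < m)%N -> (13 * m.-1 ^ 3 < p ^ 2)%N ->
  (#|[set t : cube Y | (p%:Z ^+ 2 %| box_norm M t)%Z]| <=
     7 * (Y %/ m).+1 ^ 3)%N.
Proof.
move=> pp p3 cop m0 lt.
have [lf lfP] : exists lf : nat -> int, forall s, s \in croots p ->
    (p %| lf s - s%:Z)%Z /\ (p%:Z ^+ 2 %| lf s ^+ 3 + 2)%Z.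
  have ex s : exists t : int, s \in croots p ->
      (p %| t - s%:Z)%Z /\ (p%:Z ^+ 2 %| t ^+ 3 + 2)%Z.
    case cs : (s \in croots p); last by exists 0.
    by have [t h1 h2] := croots_lift pp p3 cs; exists t.
  by have [lf lfP] := choice ex; exists lf.
pose Z := [set t : cube Y | [&& (p %| box_a M t)%Z, (p %| box_b M t)%Z &
  (p %| box_c M t)%Z]].
pose Bs (s : nat) := [set t : cube Y |
  (p %| (box_a M t - box_c M t * s%:Z ^+ 2)%R)%Z &&
  (p %| (box_b M t - box_c M t * s%:Z)%R)%Z].
pose As (s : nat) := [set t : cube Y | (p%:Z ^+ 2 %| box_ell (lf s) M t)%Z].
have cardZ : (#|Z| <= (Y %/ m).+1 ^ 3)%N.
  apply: (box_class_card pp cop m0 lt) => t t'; rewrite !inE.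
  move=> /and3P[a1 b1 c1] /and3P[a2 b2 c2].
  have /dvdzP[a ->] := dvdz_eqB a1 a2 (erefl _).
  have /dvdzP[b ->] := dvdz_eqB b1 b2 (erefl _).
  have /dvdzP[c ->] := dvdz_eqB c1 c2 (erefl _).
  rewrite ![_ * p%:Z]mulrC nform_scale (_ : p%:Z ^+ 3 = p%:Z ^+ 2 * p%:Z);
    last by ring.
  by rewrite -mulrA dvdz_mulr.
have cardB s : s \in croots p -> (#|Bs s| <= (Y %/ m).+1 ^ 3)%N.
  move=> cs; apply: (box_class_card pp cop m0 lt) => t t'; rewrite !inE.
  move=> /andP[h1 k1] /andP[h2 k2].
  apply: (nform_cofactor_dvd (croots_dvdz cs)).
    by apply: (dvdz_eqB h1 h2); ring.
  by apply: (dvdz_eqB k1 k2); ring.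
have cardA s : s \in croots p -> (#|As s| <= (Y %/ m).+1 ^ 3)%N.
  move=> cs; apply: (box_class_card pp cop m0 lt) => t t'; rewrite !inE => h h'.
  apply: (nform_dvd_ell (lfP s cs).2); apply: (dvdz_eqB h h').
  by rewrite /box_ell /ell; ring.
apply: (@leq_trans (#|Z| + \sum_(s <- croots p) #|Bs s| +
    \sum_(s <- croots p) #|As s|)); last first.
  have r3 := rho_le3 pp; set X := ((Y %/ m).+1 ^ 3)%N in cardZ cardA cardB *.
  have hB : (\sum_(s <- croots p) #|Bs s| <= 3 * X)%N.
    apply: (@leq_trans (\sum_(s <- croots p) X)).
      by rewrite !big_seq; apply: leq_sum => s; exact: cardB.
    by rewrite big_const_seq count_predT iter_addn_0 mulnC leq_mul2r r3 orbT.
  have hA : (\sum_(s <- croots p) #|As s| <= 3 * X)%N.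
    apply: (@leq_trans (\sum_(s <- croots p) X)).
      by rewrite !big_seq; apply: leq_sum => s; exact: cardA.
    by rewrite big_const_seq count_predT iter_addn_0 mulnC leq_mul2r r3 orbT.
  by apply: leq_trans (leq_add (leq_add cardZ hB) hA) _; rewrite -!mulSn addnC -mulnDl.
have sw (F : nat -> {set cube Y}) : (\sum_(s <- croots p) #|F s| =
    \sum_(t : cube Y) \sum_(s <- croots p) (t \in F s))%N.
  rewrite exchange_big /=; apply: eq_bigr => s _.
  by rewrite -sum1_card big_mkcond.
have one (F : nat -> {set cube Y}) s t : s \in croots p -> t \in F s ->
    (0 < \sum_(s <- croots p) (t \in F s))%N.
  move=> cs ts; rewrite (bigD1_seq s) ?croots_uniq //= ts; exact: ltn_addr.
have cardE (F : {set cube Y}) : #|F| = (\sum_(t : cube Y) (t \in F))%N.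
  by rewrite -sum1_card big_mkcond.
rewrite !sw !cardE -!big_split /=; apply: leq_sum => t _.
rewrite inE; case D : (p%:Z ^+ 2 %| box_norm M t)%Z => //.
move: D => /(nform_sqr_dvd_cases pp p3).
case=> [[ha hb hc]|[s cs [h1 h2]]|[s cs h]].
- by rewrite inE ha hb hc.
- have := one Bs s t cs; rewrite inE h1 h2 => /(_ isT) h.
  by apply: leq_trans h _; rewrite addnAC leq_addl.
have := one As s t cs; rewrite inE (h _ (lfP _ cs).1 (lfP _ cs).2).
by move=> /(_ isT) h'; apply: leq_trans h' _; rewrite leq_addl.
Qed.

Lemma box_norm_dvd_sub1 M Y (t : cube Y) : (M %| box_norm M t - 1)%Z.
Proof.
rewrite /box_norm /box_a /box_b /box_c.
set u := 3 * Y%:Z + _; set v := t.1.2%:Z; set w := t.2%:Z.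
apply/dvdzP; exists (3 * u + 3 * M%:Z * u ^+ 2 + M%:Z ^+ 2 * u ^+ 3
  - 2 * M%:Z ^+ 2 * v ^+ 3 + 4 * M%:Z ^+ 2 * w ^+ 3
  + 6 * (1 + M%:Z * u) * M%:Z * v * w).
by rewrite /nform; ring.
Qed.

Lemma box_norm_ndvd p M Y (t : cube Y) : prime p -> (p %| M)%N ->
  ~~ (p %| box_norm M t)%Z.
Proof.
move=> pp pM; apply/negP => h.
have h2 : (p %| box_norm M t - 1)%Z.
  by apply: dvdz_trans (box_norm_dvd_sub1 M t); exact: pM.
have : (p %| 1)%Z by apply: (dvdz_eqB h h2); ring.
by rewrite dvdz1 /= => /eqP p1; rewrite p1 in pp.
Qed.

Section MertensLower.
Variable R : realType.

(** Telescoping, from 1 / (x + 1)^2 <= 1 / x - 1 / (x + 1). *)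
Lemma sum_inv_sqr_le a b : (0 < a)%N ->
  \sum_(a.+1 <= p < b) (p%:R ^+ 2)^-1 <= a%:R^-1 :> R.
Proof.
move=> a0; have [ba|ab] := leqP b a.+1.
  by rewrite big_geq // invr_ge0.
rewrite -(subnK (ltnW ab)); move: (b - a.+1)%N => n.
apply: (@le_trans _ _ (a%:R^-1 - ((n + a)%:R)^-1)); last first.
  by rewrite gerBl invr_ge0.
elim: n => [|n IH]; first by rewrite add0n big_geq ?add0n // subrr.
rewrite addSn big_nat_recr ?leq_addl //=.
apply: (le_trans (lerD IH (lexx _))).
have x0 : 0 < (n + a)%:R :> R by rewrite ltr0n addn_gt0 a0 orbT.
rewrite !addSn !addnS -!natr1.
set x := (n + a)%:R in x0 *.
rewrite -addrA lerD2l -subr_ge0.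
have -> : - (x + 1)^-1 - (- x^-1 + ((x + 1) ^+ 2)^-1) = (x * (x + 1) ^+ 2)^-1.
  by field; rewrite !lt0r_neq0 //; lra.
by rewrite invr_ge0 mulr_ge0 ?sqr_ge0 // ltW.
Qed.

(** 28 = 7 * 4 and 364 = 28 * 13, by (x + 1)^3 <= 4 (x^3 + 1) for x = [Y / m] and p^2 <= 13 m^3. *)
Lemma box_bad_card_real p M Y : prime p -> (3 < p)%N -> coprime p M ->
  #|[set t : cube Y | (p%:Z ^+ 2 %| box_norm M t)%Z]|%:R <=
  364 * Y%:R ^+ 3 / p%:R ^+ 2 + 28 :> R.
Proof.
move=> pp p3 cop; have p0 := prime_gt0 pp.
have [|m m0 /andP[lt le]] := @scale_exists (p ^ 2); first by rewrite expn_gt0 p0.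
have := box_bad_card Y pp p3 cop m0 lt; rewrite -(ler_nat R) => /le_trans; apply.
have xm : ((Y %/ m) ^ 3 * p ^ 2 <= 13 * Y ^ 3)%N.
  apply: (@leq_trans ((Y %/ m) ^ 3 * (13 * m ^ 3))); first by rewrite leq_mul2l le orbT.
  rewrite mulnCA leq_mul2l -expnMn leq_exp2r // leq_trunc_div orbT //.
rewrite natrM natrX -natr1; move: xm; rewrite -(ler_nat R) natrM !natrX natrM natrX.
set x := (Y %/ m)%:R => xm; have x0 : 0 <= x by [].
have pp0 : 0 < p%:R ^+ 2 :> R by rewrite exprn_gt0 // ltr0n.
have xm' : x ^+ 3 <= 13 * Y%:R ^+ 3 / p%:R ^+ 2 by rewrite ler_pdivlMr.
have : (x + 1) ^+ 3 <= 4 * (x ^+ 3 + 1).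
  rewrite -subr_ge0.
  have -> : 4 * (x ^+ 3 + 1) - (x + 1) ^+ 3 = 3 * (x + 1) * (x - 1) ^+ 2 by ring.
  by rewrite mulr_ge0 ?sqr_ge0 // mulr_ge0 // addr_ge0.
have -> : 364 * Y%:R ^+ 3 / p%:R ^+ 2 = 28 * (13 * Y%:R ^+ 3 / p%:R ^+ 2) :> R.
  by ring.
lra.
Qed.


(** The hypothesis w <= D Y makes (Y + w)^3 - Y^3 linear in w, where w = 104 * 2^k. If p | M the
    count is 0, norms being 1 modulo M. *)
Lemma box_count_upper p r M Y (D : nat) : prime p -> r \in croots p ->
  (104 * 2 ^ trunc_log 8 p <= D * Y)%N ->
  (box_count p r%:Z M Y)%:R <=
  (Y%:R ^+ 3 + (3 + 3 * D%:R + D%:R ^+ 2) * Y%:R ^+ 2 *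
     (104 * 2 ^+ trunc_log 8 p)) / p%:R :> R.
Proof.
move=> pp cr hD; have p0 := prime_gt0 pp.
rewrite ler_pdivlMr ?ltr0n // [leLHS]mulrC -[leLHS]natrM.
set k := trunc_log 8 p in hD *.
have wE : 104 * 2 ^+ k = (104 * 2 ^ k)%N%:R :> R by rewrite natrM natrX.
rewrite wE; apply: (@le_trans _ _ ((Y + 104 * 2 ^ k) ^ 3)%N%:R).
  rewrite ler_nat; have [/eqP cop|cop] := boolP (coprime p M).
    by apply: box_count_le => //; [exact/eqP|exact: croots_dvdz].
  rewrite /box_count (_ : [set _ | _] = finset.set0) ?cards0 ?muln0 //.
  apply/setP => t; rewrite !inE; apply/negbTE/negP => h.
  have : (p %| M)%N by move: cop; rewrite prime_coprime // negbK.
  move=> /(box_norm_ndvd t pp) /negP; apply.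
  exact: nform_dvd_ell (croots_dvdz cr) h.
move: hD; rewrite -(ler_nat R) natrX natrD [(D * Y)%:R]natrM.
set w := (104 * 2 ^ k)%N%:R => hD; have w0 : 0 <= w by [].
have y0 : 0 <= Y%:R :> R by []; have d0 : 0 <= D%:R :> R by [].
rewrite (_ : (Y%:R + w) ^+ 3 = Y%:R ^+ 3 +
  (3 * Y%:R ^+ 2 + 3 * Y%:R * w + w ^+ 2) * w); last by ring.
rewrite lerD2l ler_wpM2r //.
have h1 : Y%:R * w <= Y%:R * (D%:R * Y%:R) by rewrite ler_wpM2l.
have h2 : w ^+ 2 <= (D%:R * Y%:R) ^+ 2 by rewrite lerXn2r ?nnegrE // mulr_ge0.
have -> : (3 + 3 * D%:R + D%:R ^+ 2) * Y%:R ^+ 2 = 3 * Y%:R ^+ 2 +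
  3 * (Y%:R * (D%:R * Y%:R)) + (D%:R * Y%:R) ^+ 2 :> R by ring.
by rewrite lerD // lerD2l -mulrA ler_wpM2l.
Qed.

(** A prime factor of N that annihilates at no root falls under the first two cases of
    [nform_dvd_cases], and these force p^2 | N. *)
Lemma good_ln_le M Y (t : cube Y) B : (0 < M)%N -> (0 < Y)%N ->
  (92 * (M * Y) ^ 3 < B)%N ->
  (forall p, prime p -> ~~ (p%:Z ^+ 2 %| box_norm M t)%Z) ->
  ln (`|box_norm M t|%N%:R) <=
    \sum_(0 <= p < B | prime p) (hits M t p)%:R * ln p%:R :> R.
Proof.
move=> M0 Y0 hB sqf; have /andP[lo up] := box_norm_bounds t M0.
have N0 : (0 < `|box_norm M t|)%N.
  by apply: leq_trans lo; rewrite expn_gt0 muln_gt0 M0 Y0.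
rewrite (@ln_nat_primes R _ B); last by rewrite N0 (leq_ltn_trans up hB).
apply: ler_sum => p pp; rewrite ler_wpM2r ?ln_natr_ge0 // ler_nat.
have l1 : (logn p `|box_norm M t| <= 1)%N.
  rewrite leqNgt -pfactor_dvdn //; apply: contra (sqf p pp).
  by rewrite dvdzE -PoszX.
have [l0|] := posnP (logn p `|box_norm M t|); first by rewrite l0.
rewrite logn_gt0 mem_primes => /and3P[_ _ pN].
apply: leq_trans l1 _; rewrite -has_count; apply/hasP.
have [[ha hb hc]|[s cs [h1 h2]]|[s cs [h1 _ _]]] :=
  @nform_dvd_cases p (box_a M t) (box_b M t) (box_c M t) pp pN.
- case/negP: (sqf p pp).
  have /dvdzP[a aE] := ha; have /dvdzP[b bE] := hb; have /dvdzP[c cE] := hc.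
  rewrite /box_norm aE bE cE ![_ * p%:Z]mulrC nform_scale.
  rewrite (_ : p%:Z ^+ 3 = p%:Z ^+ 2 * p%:Z); last by ring.
  by rewrite -mulrA dvdz_mulr.
- case/negP: (sqf p pp).
  exact: nform_cofactor_dvd (croots_dvdz cs) h1 h2.
by exists s.
Qed.

(** The cutoff on p loses nothing: p^2 | N gives p^2 <= 92 (M Y)^3 < (10 (M Y)^2)^2. *)
Definition bad_set (M Y : nat) : {set cube Y} :=
  [set t | [exists p : 'I_(10 * (M * Y) ^ 2),
              prime p && (p%:Z ^+ 2 %| box_norm M t)%Z]].

Lemma not_bad_squarefree M Y (t : cube Y) : (0 < M)%N -> (0 < Y)%N ->
  t \notin bad_set M Y -> 
  forall p, prime p -> ~~ (p%:Z ^+ 2 %| box_norm M t)%Z.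
Proof.
move=> M0 Y0; rewrite inE negb_exists => /forallP H p pp; apply/negP => dv.
have [pB|Bp] := ltnP p (10 * (M * Y) ^ 2).
  by have := H (Ordinal pB); rewrite /= pp dv.
have MY0 : (0 < M * Y)%N by rewrite muln_gt0 M0.
have /andP[lo up] := box_norm_bounds t M0.
have N0 : (0 < `|box_norm M t|)%N by apply: leq_trans lo; rewrite expn_gt0 MY0.
move: dv; rewrite dvdzE -PoszX => /(dvdn_leq N0) /= le.
have h1 : ((10 * (M * Y) ^ 2) ^ 2 <= p ^ 2)%N by rewrite leq_exp2r.
have h2 : ((M * Y) ^ 3 <= ((M * Y) ^ 2) ^ 2)%N.
  by rewrite -expnM leq_pexp2l.
have h3 : (0 < (M * Y) ^ 3)%N by rewrite expn_gt0 MY0.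
move: h1 (leq_trans le up) h2 h3; rewrite expnMn.
set x := (((M * Y) ^ 2) ^ 2)%N; set z := ((M * Y) ^ 3)%N; lia.
Qed.

(** Primes p <= P divide P! and so divide no norm. The others leave the tail of sum 1 / p^2, at most
    1 / P, and at most 10 (P! Y)^2 terms equal to 28. *)
Lemma bad_set_card P Y : (3 <= P)%N ->
  #|bad_set P`! Y|%:R <=
  364 * Y%:R ^+ 3 / P%:R + 280 * P`!%:R ^+ 2 * Y%:R ^+ 2 :> R.
Proof.
move=> P3; set M := P`!; set B := (10 * (M * Y) ^ 2)%N.
pose bp (p : nat) := [set t : cube Y | (p%:Z ^+ 2 %| box_norm M t)%Z].
have h1 : (#|bad_set M Y| <= \sum_(p < B | prime p) #|bp p|)%N.
  have sw : (\sum_(p < B | prime p) #|bp p| =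
      \sum_(t : cube Y) \sum_(p < B | prime p) (t \in bp p))%N.
    rewrite exchange_big /=; apply: eq_bigr => p _.
    by rewrite -sum1_card big_mkcond.
  rewrite sw -sum1_card big_mkcond /=; apply: leq_sum => t _.
  case: ifP => //; rewrite inE => /existsP[p /andP[pp dv]].
  by rewrite (bigD1 p) //= inE dv.
have h2 : #|bad_set M Y|%:R <= \sum_(P.+1 <= p < B)
    (364 * Y%:R ^+ 3 * (p%:R ^+ 2)^-1 + 28) :> R.
  apply: (@le_trans _ _ (\sum_(0 <= p < B | prime p) #|bp p|)%N%:R).
    by rewrite ler_nat big_mkord.
  have pos p : 0 <= 364 * Y%:R ^+ 3 * (p%:R ^+ 2)^-1 + 28 :> R.
    apply: addr_ge0; last exact: ler0n.
    apply: mulr_ge0; last by rewrite invr_ge0 sqr_ge0.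
    by apply: mulr_ge0; [exact: ler0n|rewrite exprn_ge0].
  have nd p (t : cube Y) : prime p -> (p <= P)%N -> t \notin bp p.
    move=> pp pP; rewrite inE; apply: contra (box_norm_ndvd t pp _).
      by apply: dvdz_trans; rewrite expr2 dvdz_mulr.
    by rewrite dvdn_fact // prime_gt0.
  have nd0 p : prime p -> (p <= P)%N -> #|bp p| = 0%N.
    move=> pp pP; apply/eqP; rewrite cards_eq0; apply/eqP/setP => t.
    by rewrite (negbTE (nd p t pp pP)) inE.
  rewrite natr_sum.
  apply: (@le_trans _ _ (\sum_(0 <= p < B | (P < p)%N)
    (364 * Y%:R ^+ 3 * (p%:R ^+ 2)^-1 + 28))).
    rewrite big_mkcond [leRHS]big_mkcond /=; apply: ler_sum => p _.
    case: ifP => pp; case: ltnP => Pp //; last by rewrite nd0.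
    apply: box_bad_card_real => //; first by exact: leq_ltn_trans Pp.
    rewrite prime_coprime //; apply/negP => pM.
    have : (p %| P`!)%N by [].
    elim: P Pp {P3 M B bp h1 pos nd nd0 pM} => [|P IH] Pp.
      by rewrite fact0 Euclid_dvd1.
    rewrite factS Euclid_dvdM // => /orP[/dvdn_leq|]; last by apply: IH; exact: ltnW.
    by move=> /(_ isT); rewrite leqNgt Pp.
  have [PB|BP] := leqP P.+1 B.
    rewrite (big_cat_nat (n := P.+1)) //= big_nat_cond big1 ?add0r.
      rewrite big_mkcond big_nat [leRHS]big_nat.
      by apply: ler_sum => p /andP[h _]; rewrite h.
    by move=> p /andP[/andP[_ h]]; rewrite ltnS in h; rewrite ltnNge h.
  rewrite big_nat_cond big1 ?sumr_ge0 // => p /andP[/andP[_ h]] Pp.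
  by move: (ltn_trans Pp h); rewrite ltnNge -ltnS BP.
apply: (le_trans h2); rewrite big_split /= -mulr_sumr.
apply: lerD.
  apply: ler_wpM2l.
    by apply: mulr_ge0; [exact: ler0n|rewrite exprn_ge0].
  by apply: sum_inv_sqr_le; exact: leq_trans P3.
rewrite big_const_nat iter_addr_0 -[_ *+ (B - _)]mulr_natl.
apply: (@le_trans _ _ (B%:R * 28)); first by rewrite ler_wpM2r // ler_nat leq_subr.
by rewrite /B natrM natrX natrM le_eqVlt; apply/orP; left; apply/eqP; ring.
Qed.

End MertensLower.

(** * The lower bound, and both bounds at arbitrary cutoffs *)

Section Mertens.
Variable R : realType.

(** With M = P!, 2^(5 M) > 5 M and 5^3 > 92 put all norms below 8^(I + 5 M). The term 840 M^2 comes
    from the 280 M^2 Y^2 in the count of bad points, each of which loses log (Y^3) <= 3 Y. *)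
Lemma mertens_pow8_ge P : (3 <= P)%N -> exists C : R, forall I : nat,
  (1 - 364 / P%:R) * (I%:R * ln 8) - C <= mertens R (8 ^ (I + 5 * P`!)).
Proof.
move=> P3; set M := P`!; have M0 : (0 < M)%N by exact: fact_gt0.
pose D := (104 * 2 ^ (5 * M))%N.
pose E : R := (3 + 3 * D%:R + D%:R ^+ 2) * 104 * 48 * 2 ^+ (5 * M).
exists (E + 840 * M%:R ^+ 2) => I.
pose Y := (2 ^ I)%N; pose y : R := Y%:R; pose I' := (I + 5 * M)%N.
have Y0 : (0 < Y)%N by rewrite expn_gt0.
have y0 : 0 < y by rewrite ltr0n.
have yE : y = 2 ^+ I by rewrite /y natrX.
have y3 : 0 < y ^+ 3 by exact: exprn_gt0.
have lnyE : ln (y ^+ 3) = I%:R * ln 8.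
  by rewrite /y -natrX -expnM mulnC expnM natrX lnXn // -[LHS]mulr_natl.
have hB : (92 * (M * Y) ^ 3 < 8 ^ I')%N.
  have -> : (8 ^ I' = Y ^ 3 * (2 ^ (5 * M)) ^ 3)%N.
    by rewrite -expnMn -expnD -expnM mulnC expnM.
  have h5 : ((5 * M) ^ 3 <= (2 ^ (5 * M)) ^ 3)%N.
    by rewrite leq_exp2r // ltnW // ltn_expl.
  have M3 : (0 < M ^ 3)%N by rewrite expn_gt0 M0.
  have Y3 : (0 < Y ^ 3)%N by rewrite expn_gt0 Y0.
  rewrite [((M * Y) ^ 3)%N]expnMn [(M ^ 3 * _)%N]mulnC mulnCA ltn_pmul2l //.
  apply: leq_trans h5; rewrite expnMn; lia.
pose G := \sum_(t : cube Y | t \notin bad_set M Y) ln (`|box_norm M t|%N%:R) : R.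
have loG : (y ^+ 3 - #|bad_set M Y|%:R) * (I%:R * ln 8) <= G.
  apply: (@le_trans _ _ (\sum_(t : cube Y | t \notin bad_set M Y) (I%:R * ln 8))).
    rewrite sumr_const -[leRHS]mulr_natl.
    rewrite ler_wpM2r ?mulr_ge0 ?ln_natr_ge0 // lerBlDr -natrD /y -natrX ler_nat.
    rewrite -card_cube -(cardC (mem (bad_set M Y))) addnC leq_add2r.
    by rewrite subset_leq_card //; apply/fintype.subsetP => t; rewrite !inE.
  apply: ler_sum => t _; have /andP[lo _] := box_norm_bounds t M0.
  have le : (Y ^ 3 <= `|box_norm M t|)%N.
    by apply: leq_trans lo; rewrite leq_exp2r // leq_pmull.
  rewrite -lnyE /y -natrX ler_ln ?ler_nat // posrE ltr0n ?expn_gt0 ?Y0 //.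
  by apply: leq_trans le; rewrite expn_gt0 Y0.
have upG : G <= \sum_(0 <= p < 8 ^ I' | prime p)
    (\sum_(r <- croots p) box_count p r%:Z M Y)%N%:R * ln p%:R.
  rewrite sum_box_count_ln.
  apply: (@le_trans _ _ (\sum_(t : cube Y | t \notin bad_set M Y)
    \sum_(0 <= p < 8 ^ I' | prime p) (hits M t p)%:R * ln p%:R)).
    apply: ler_sum => t nb; apply: good_ln_le => //.
    exact: not_bad_squarefree.
  rewrite [leRHS](bigID (fun t => t \notin bad_set M Y)) /= lerDl.
  by rewrite sumr_ge0 // => t _; rewrite sumr_ge0 // => p _;
    rewrite mulr_ge0 ?ln_natr_ge0.
pose F : R := (3 + 3 * D%:R + D%:R ^+ 2) * y ^+ 2 * 104.
have F0 : 0 <= F.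
  rewrite /F; apply: mulr_ge0; last exact: ler0n.
  apply: mulr_ge0; last exact: sqr_ge0.
  by rewrite addr_ge0 ?sqr_ge0 // addr_ge0 // mulr_ge0.
have up2 : \sum_(0 <= p < 8 ^ I' | prime p)
    (\sum_(r <- croots p) box_count p r%:Z M Y)%N%:R * ln p%:R <=
    y ^+ 3 * mertens R (8 ^ I') + F * (\sum_(0 <= p < 8 ^ I' | prime p)
       (rho p)%:R * ln p%:R / p%:R * 2 ^+ trunc_log 8 p).
  rewrite /mertens !mulr_sumr -big_split /=.
  rewrite big_nat_cond [leRHS]big_nat_cond; apply: ler_sum => p.
  move=> /andP[/andP[_ pI] pp]; rewrite natr_sum.
  have hD : (104 * 2 ^ trunc_log 8 p <= D * Y)%N.
    rewrite /D /Y -mulnA leq_mul2l -expnD leq_exp2l //= addnC -/I'.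
    rewrite -(leq_exp2l _ _ (isT : (1 < 8)%N)).
    by apply: leq_trans (trunc_logP _ (prime_gt0 pp)) (ltnW pI).
  apply: (@le_trans _ _ ((\sum_(r <- croots p)
     ((y ^+ 3 + (3 + 3 * D%:R + D%:R ^+ 2) * y ^+ 2 *
     (104 * 2 ^+ trunc_log 8 p)) / p%:R)) * ln p%:R)).
    rewrite ler_wpM2r ?ln_natr_ge0 // !big_seq.
    by apply: ler_sum => r cr; exact: box_count_upper.
  rewrite big_const_seq count_predT iter_addr_0 -/(rho p) -[X in X * _]mulr_natl.
  by rewrite /F le_eqVlt; apply/orP; left; apply/eqP; ring.
have hs := sum_rho_scale_le R I'.
have hF : F * (\sum_(0 <= p < 8 ^ I' | prime p)
       (rho p)%:R * ln p%:R / p%:R * 2 ^+ trunc_log 8 p) <= y ^+ 3 * E.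
  apply: (le_trans (ler_wpM2l F0 hs)); rewrite /I' exprD -yE /F /E.
  by rewrite le_eqVlt; apply/orP; left; apply/eqP; ring.
have lnY : I%:R * ln 8 <= 3 * y.
  rewrite -lnyE lnXn // -[leLHS]mulr_natl ler_wpM2l //.
  exact/ltW/ln_sublinear.
have ln0 : 0 <= I%:R * ln 8 :> R by rewrite mulr_ge0 ?ln_natr_ge0.
have bad := bad_set_card R Y P3.
have bad2 : #|bad_set M Y|%:R * (I%:R * ln 8) <=
    364 / P%:R * y ^+ 3 * (I%:R * ln 8) + 840 * M%:R ^+ 2 * y ^+ 3.
  apply: (le_trans (ler_wpM2r ln0 bad)); rewrite mulrDl; apply: lerD.
    by rewrite le_eqVlt -/y; apply/orP; left; apply/eqP; ring.
  rewrite -/M -/y.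
  apply: (@le_trans _ _ (280 * M%:R ^+ 2 * y ^+ 2 * (3 * y))).
    apply: ler_wpM2l; last exact: lnY.
    apply: mulr_ge0; last exact: sqr_ge0.
    by apply: mulr_ge0; [exact: ler0n | exact: sqr_ge0].
  by rewrite le_eqVlt; apply/orP; left; apply/eqP; ring.
rewrite -(ler_pM2l y3).
have -> : y ^+ 3 * ((1 - 364 / P%:R) * (I%:R * ln 8) - (E + 840 * M%:R ^+ 2)) =
  y ^+ 3 * (I%:R * ln 8) - 364 / P%:R * y ^+ 3 * (I%:R * ln 8)
   - y ^+ 3 * E - 840 * M%:R ^+ 2 * y ^+ 3 by ring.
move: loG; rewrite mulrBl => loG.
move: (le_trans loG (le_trans upG up2)) hF bad2; rewrite -/I'.
set a := y ^+ 3 * (_ * ln 8); set b := #|_|%:R * _; set c := y ^+ 3 * mertens _ _.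
set d := F * _; set e := y ^+ 3 * E; set f := 364 / _ * _ * _; set g := 840 * _ * _.
by clearbody a b c d e f g; move=> *; lra.
Qed.

Lemma mertens_mono B B' : (B <= B')%N -> mertens R B <= mertens R B'.
Proof.
move=> BB; rewrite /mertens [leRHS](big_cat_nat (n := B)) //= lerDl.
by rewrite sumr_ge0 // => p _; rewrite mulr_ge0 ?invr_ge0 // mulr_ge0 // ln_natr_ge0.
Qed.

Lemma mertens_le : exists C : R, forall B, (0 < B)%N ->
  mertens R B <= ln B%:R + C.
Proof.
exists (ln 8 + (ln 92 + 3 * 104 * 48)) => B B0.
pose k := trunc_log 8 B.
have lo : (8 ^ k <= B)%N by exact: trunc_logP.
have up : (B < 8 ^ k.+1)%N by exact: trunc_log_ltn.
apply: (le_trans (mertens_mono (ltnW up))).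
apply: (le_trans (mertens_pow8_le _ _)).
rewrite [leRHS]addrA lerD2r -natr1 mulrDl mul1r lerD2r.
rewrite mulr_natl -lnXn // -natrX ler_ln ?ler_nat // posrE ltr0n //.
by rewrite expn_gt0.
Qed.

(** P is taken with 364 / P <= eps and then stays fixed, so the shift 5 * P! costs only a
    constant. *)
Lemma mertens_ge (eps : R) : 0 < eps -> exists C : R, forall B, (0 < B)%N ->
  (1 - eps) * ln B%:R - C <= mertens R B.
Proof.
move=> e0; have [eps1|eps1] := leP 1 eps.
  exists 0 => B B0; rewrite subr0; apply: (@le_trans _ _ 0).
    by rewrite mulr_le0_ge0 ?ln_natr_ge0 // subr_le0.
  by rewrite sumr_ge0 // => p _; rewrite mulr_ge0 ?invr_ge0 // mulr_ge0 // ln_natr_ge0.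
pose P := (maxn 3 (Num.truncn (364 / eps)).+1).
have P3 : (3 <= P)%N by rewrite leq_maxl.
have P0 : 0 < P%:R :> R by rewrite ltr0n (leq_trans _ P3).
have hP : 364 / P%:R <= eps.
  rewrite ler_pdivrMr // mulrC -ler_pdivrMr //.
  apply: (le_trans (ltW (truncnS_gt _))); by rewrite ler_nat leq_maxr.
have [C hC] := mertens_pow8_ge P3.
set mu := (5 * P`!)%N in hC.
exists (mu.+1%:R * ln 8 + `|C|) => B B0.
pose k := trunc_log 8 B.
have lo : (8 ^ k <= B)%N by exact: trunc_logP.
have up : (B < 8 ^ k.+1)%N by exact: trunc_log_ltn.
have l8 : 0 <= ln 8 :> R by exact: ln_natr_ge0.
have lnB : ln B%:R <= (k%:R + 1) * ln 8 :> R.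
  rewrite natr1 [leRHS]mulr_natl -lnXn // -natrX.
  by rewrite ler_ln ?ler_nat ?(ltnW up) // posrE ltr0n // expn_gt0.
have [muk|kmu] := leqP mu k.
  apply: le_trans (mertens_mono lo).
  have := hC (k - mu)%N; rewrite subnK //; apply: le_trans.
  have h1 : (1 - eps) * ((k - mu)%:R * ln 8) <= (1 - 364 / P%:R) * ((k - mu)%:R * ln 8).
    by rewrite ler_wpM2r ?lerD2l ?lerN2 // mulr_ge0.
  have h2 : (1 - eps) * ln B%:R <= (1 - eps) * ((k - mu)%:R * ln 8) + mu.+1%:R * ln 8.
    apply: (@le_trans _ _ ((1 - eps) * ((k%:R + 1) * ln 8))).
      by rewrite ler_wpM2l // subr_ge0 ltW.
    rewrite natrB // -[mu.+1%:R]natr1; have : 0 <= mu%:R :> R by [].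
    have : 0 <= (mu%:R + 1) * ln 8 :> R by rewrite mulr_ge0.
    move=> q0 _.
    rewrite -subr_ge0 (_ : _ - _ = eps * ((mu%:R + 1) * ln 8)); last by ring.
    by rewrite mulr_ge0 // ltW.
  have := ler_norm C; lra.
(* For B below 8^mu the constant makes the left side nonpositive. *)
apply: (@le_trans _ _ 0); last first.
  by rewrite sumr_ge0 // => p _; rewrite mulr_ge0 ?invr_ge0 // mulr_ge0 // ln_natr_ge0.
have : (1 - eps) * ln B%:R <= 1 * ln B%:R.
  by rewrite ler_wpM2r ?ln_natr_ge0 // lerBlDr lerDl ltW.
have : (k%:R + 1) * ln 8 <= mu.+1%:R * ln 8 :> R.
  by rewrite ler_wpM2r // natr1 ler_nat ltnS ltnW.
have := normr_ge0 C; rewrite mul1r; lra.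
Qed.

End Mertens.

(** * From prime sums to integrals *)

Section PrimeSums.
Variable R : realType.
Implicit Types (X a b d u al eps : R).

Local Notation mu := (@lebesgue_measure R).

Definition exp_integral al d b : R :=
  \int[mu]_(s in [set` `[d, b]]) (expR (al * s) / s).

Lemma exp_div_integrable al a b : 0 < a ->
  mu.-integrable [set` `[a, b]] (EFin \o (fun s : R => expR (al * s) / s)).
Proof.
move=> a0; apply: continuous_compact_integrable; first exact: segment_compact.
apply: continuous_in_subspaceT => s; rewrite inE /= in_itv /= => /andP[as_ _].
have s0 : s != 0 by rewrite gt_eqF // (lt_le_trans a0).
apply: cvgM; last exact: cvgV.
apply: continuous_comp; last exact: continuous_expR.
by apply: cvgM => //; exact: cvg_cst.
Qed.

Lemma exp_integral_ge0 al d b : 0 < d -> 0 <= exp_integral al d b.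
Proof.
move=> d0; apply: Rintegral_ge0 => s /=; rewrite in_itv /= => /andP[ds _].
by rewrite divr_ge0 ?expR_ge0 // ltW // (lt_le_trans d0).
Qed.

(** The integrand is at least e^(al b) / b' between b and b'. This increment bound is all that the
    Riemann sums require of a primitive. *)
Lemma exp_integral_step al d b b' : 0 <= al -> 0 < d -> d <= b -> b <= b' ->
  expR (al * b) / b' * (b' - b) <= exp_integral al d b' - exp_integral al d b.
Proof.
move=> al0 d0 db bb; have b0 : 0 < b by exact: lt_le_trans db.
have b'0 : 0 < b' by exact: lt_le_trans bb.
rewrite /exp_integral Rintegral_itvB ?bnd_simp //; last exact: exp_div_integrable.
have int2 : mu.-integrable [set` `]b, b']] (EFin \o (fun s : R => expR (al * s) / s)).
  apply: integrableS (exp_div_integrable al b' b0) => //.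
  by apply: subset_itvr; rewrite bnd_simp.
have -> : expR (al * b) / b' * (b' - b) =
    \int[mu]_(s in [set` `]b, b']]) (expR (al * b) / b').
  rewrite Rintegral_cst //= lebesgue_measure_itv /= lte_fin.
  move: bb; rewrite le_eqVlt => /orP[/eqP ->|-> //].
  by rewrite ltxx subrr !mulr0.
apply: le_Rintegral => //.
  apply: integrableS (_ : mu.-integrable [set` `[b, b']] _) => //.
    by apply: subset_itvr; rewrite bnd_simp.
  apply: continuous_compact_integrable; first exact: segment_compact.
  by apply: continuous_in_subspaceT => s _; exact: cvg_cst.
move=> s /=; rewrite in_itv /= => /andP[bs sb].
have s0 : 0 < s by exact: lt_trans bs.
apply: ler_pM; rewrite ?expR_ge0 ?invr_ge0 ?(ltW b'0) //.
  by rewrite ler_expR ler_wpM2l // ltW.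
by rewrite lef_pV2.
Qed.

(** The case al = 0 with an explicit primitive; [expR (0 * b)] is kept to match the hypothesis
    [step] of the section [Riemann]. *)
Lemma ln_ratio_step d b b' : 0 < d -> d <= b -> b <= b' ->
  expR (0 * b) / b' * (b' - b) <= ln (b' / d) - ln (b / d).
Proof.
move=> d0 db bb; have b0 : 0 < b by exact: lt_le_trans db.
have b'0 : 0 < b' by exact: lt_le_trans bb.
rewrite mul0r expR0 mul1r mulrBr mulVf ?gt_eqF // !ln_div ?posrE //.
have h : ln (b / b') <= b / b' - 1.
  have := @le_ln1Dx R (b / b' - 1); rewrite addrCA subrr addr0; apply.
  by rewrite ltrBrDl subrr divr_gt0.
rewrite ln_div ?posrE // in h; rewrite [b'^-1 * _]mulrC; lra.
Qed.

Lemma near_ln_ge (A : R) : \forall X \near +oo, A <= ln X.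
Proof.
near=> X; have AX : expR A <= X by near: X; exact: nbhs_pinfty_ge.
by rewrite -[A]expRK ler_ln ?posrE ?expR_gt0 // (lt_le_trans (expR_gt0 A)).
Unshelve. all: by end_near. Qed.

(** Half-open, so that adjacent ranges add up in [psum_cat]. *)
Definition in_range X a b (p : nat) : bool :=
  prime p && (X `^ a < p%:R <= X `^ b).

(** [B] only makes the sum finite; the bounds below are uniform in it. *)
Definition psum al X a b (B : nat) : R :=
  \sum_(0 <= p < B | in_range X a b p)
     (rho p)%:R / p%:R * expR (al * (ln p%:R / ln X)).

Lemma psum_cat al X a b c B : 1 <= X -> a <= b -> b <= c ->
  psum al X a c B = psum al X a b B + psum al X b c B.
Proof.
move=> X1 ab bc; rewrite /psum (bigID (fun p => p%:R <= X `^ b)) /=.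
have h1 := ler_powR X1 ab; have h2 := ler_powR X1 bc.
congr (_ + _); apply: eq_bigl => p; rewrite /in_range.
  case: (prime p) => //=; case: (ltP (X `^ a) p%:R) => //= _.
  by case pb : (p%:R <= X `^ b); rewrite ?andbF // (le_trans pb h2).
case: (prime p) => //=; rewrite -ltNge.
case: (ltP (X `^ b) p%:R) => //=; last by rewrite andbF.
by move=> h; rewrite (le_lt_trans h1 h) andbT.
Qed.

Lemma mertens_interval a b eps : 0 < a -> a <= b -> 0 < eps ->
  \forall X \near +oo, forall B,
    \sum_(0 <= p < B | in_range X a b p) (rho p)%:R * ln p%:R / p%:R
      <= (b - a + eps) * ln X.
Proof.
move=> a0 ab e0; have [C1 h1] := mertens_le R.
(* The lower bound at X^a loses e1 a log X <= (eps / 2) log X; the constants, with log 2 from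
   rounding X^b up, take the other half. *)
pose e1 := Num.min 1 (eps / (2 * a)).
have e10 : 0 < e1 by rewrite lt_min ltr01 divr_gt0 // mulr_gt0.
have e11 : e1 <= 1 by rewrite ge_min lexx.
have e1a : e1 * a <= eps / 2.
  have : e1 <= eps / (2 * a) by rewrite ge_min lexx orbT.
  move=> h; apply: (@le_trans _ _ (eps / (2 * a) * a)); first by rewrite ler_wpM2r // ltW.
  by rewrite le_eqVlt; apply/orP; left; apply/eqP; field; rewrite gt_eqF.
have [C2 h2] := mertens_ge e10.
near=> X => B.
have X1 : 1 <= X by near: X; exact: nbhs_pinfty_ge.
have X0 : 0 < X by exact: lt_le_trans X1.
have L0 : (C1 + C2 + ln 2) * 2 / eps <= ln X by near: X; exact: near_ln_ge.
have Lp : 0 <= ln X by exact: ln_ge0.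
pose Bb := (Num.truncn (X `^ b)).+1; pose Ba := (Num.truncn (X `^ a)).+1.
have ltB y (p : nat) : (p < (Num.truncn (X `^ y)).+1)%N = (p%:R <= X `^ y).
  by rewrite ltnS truncn_ge_nat ?powR_ge0.
have BaBb : (Ba <= Bb)%N by rewrite ltnS le_truncn // ler_powR.
have : \sum_(0 <= p < B | in_range X a b p) (rho p)%:R * ln p%:R / p%:R
    <= mertens R Bb - mertens R Ba.
  rewrite /mertens [X in _ <= X - _](big_cat_nat (n := Ba)) //=.
  rewrite [X in _ <= X - _]addrC addrK.
  have pos p : 0 <= (rho p)%:R * ln p%:R / p%:R :> R.
    by rewrite mulr_ge0 ?invr_ge0 // mulr_ge0 // ln_natr_ge0.
  apply: (@le_trans _ _ (\sum_(0 <= p < maxn B Bb | in_range X a b p)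
     (rho p)%:R * ln p%:R / p%:R)).
    rewrite [leRHS](big_cat_nat (n := B)) ?leq_maxl //= lerDl.
    by rewrite sumr_ge0.
  have tail0 : \sum_(Bb <= p < maxn B Bb | in_range X a b p)
      (rho p)%:R * ln p%:R / p%:R = 0 :> R.
    rewrite big_nat_cond big1 // => p /andP[/andP[pb _]] /andP[_ /andP[_]].
    by rewrite -ltB => h; move: pb; rewrite leqNgt h.
  have head0 : \sum_(0 <= p < Ba | in_range X a b p)
      (rho p)%:R * ln p%:R / p%:R = 0 :> R.
    rewrite big_nat_cond big1 // => p /andP[/andP[_]].
    by rewrite ltB => pa /andP[_ /andP[]]; rewrite ltNge pa.
  rewrite (big_cat_nat (n := Bb)) ?leq_maxr //= tail0 addr0.
  rewrite (big_cat_nat (n := Ba)) //= head0 add0r.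
  rewrite big_mkcond [leRHS]big_mkcond; apply: ler_sum => p _.
  by rewrite /in_range; case: prime => //=; case: ifP.
move=> h; apply: (le_trans h).
have hb := h1 Bb isT; have ha := h2 Ba isT.
have lb : ln Bb%:R <= ln 2 + b * ln X.
  rewrite -ln_powR -lnM ?posrE ?powR_gt0 // ler_ln ?posrE ?mulr_gt0 ?powR_gt0 //.
  rewrite -[Bb%:R]natr1 mulr_natl mulr2n lerD ?truncn_le ?powR_ge0 //.
  by rewrite -(powRr0 X) ler_powR // (le_trans (ltW a0)).
have la : a * ln X <= ln Ba%:R.
  rewrite -ln_powR ler_ln ?posrE ?powR_gt0 //; exact/ltW/truncnS_gt.
have la' : (1 - e1) * (a * ln X) <= (1 - e1) * ln Ba%:R.
  by rewrite ler_wpM2l // subr_ge0.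
have ea : e1 * a * ln X <= eps / 2 * ln X by rewrite ler_wpM2r.
have C : C1 + C2 + ln 2 <= eps / 2 * ln X.
  move: L0; rewrite ler_pdivrMr // => L0; lra.
rewrite (_ : (1 - e1) * (a * ln X) = a * ln X - e1 * a * ln X) in la'; last by ring.
rewrite (_ : (b - a + eps) * ln X = b * ln X - a * ln X + eps / 2 * ln X + eps / 2 * ln X);
  last by field.
move: hb ha lb la' ea C.
set x1 := (1 - e1) * _; set x2 := eps / 2 * ln X; set x3 := a * ln X.
set x4 := e1 * a * ln X; set x5 := b * ln X.
by move=> *; lra.
Unshelve. all: by end_near. Qed.

(** On this range 1 <= log p / (a log X), and the exponential is at most e^(al b), which reduces the
    sum to [mertens_interval]. *)
Lemma psum_piece al a b eps : 0 <= al -> 0 < a -> a <= b -> 0 < eps ->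
  \forall X \near +oo, forall B,
    psum al X a b B <= expR (al * b) / a * (b - a) + eps.
Proof.
move=> al0 a0 ab e0; pose c := expR (al * b) / a.
have c0 : 0 < c by rewrite divr_gt0 ?expR_gt0.
have e0' : 0 < eps / c by rewrite divr_gt0.
near=> X.
have h : forall B, \sum_(0 <= p < B | in_range X a b p) (rho p)%:R * ln p%:R / p%:R
      <= (b - a + eps / c) * ln X.
  by near: X; exact: mertens_interval a0 ab e0'.
have L1 : 1 <= ln X by near: X; exact: near_ln_ge.
have L0 : 0 < ln X by exact: lt_le_trans L1.
have X0 : 0 < X by near: X; exact: nbhs_pinfty_gt.
move=> B; have {}h := h B.
rewrite -/c (_ : c * (b - a) + eps = c / ln X * ((b - a + eps / c) * ln X)); last first.
  by field; rewrite !gt_eqF.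
apply: le_trans (ler_wpM2l _ h); last by rewrite divr_ge0 // ltW.
rewrite mulr_sumr; apply: ler_sum => p /andP[pp /andP[pa pb]].
have p0 : 0 < p%:R :> R by rewrite ltr0n prime_gt0.
have lpa : a * ln X <= ln p%:R by rewrite -ln_powR ler_ln ?posrE ?powR_gt0 // ltW.
have lpb : ln p%:R <= b * ln X by rewrite -ln_powR ler_ln ?posrE ?powR_gt0.
have lp0 : 0 <= ln p%:R :> R by exact: ln_natr_ge0.
rewrite (_ : c / ln X * _ = (rho p)%:R / p%:R * (expR (al * b) * (ln p%:R / (a * ln X)))).
  rewrite ler_wpM2l ?divr_ge0 // -[leLHS]mulr1; apply: ler_pM => //.
    by rewrite ler_expR ler_wpM2l // ler_pdivrMr.
  by rewrite ler_pdivlMr ?mul1r // mulr_gt0.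
by rewrite /c; field; rewrite !gt_eqF.
Unshelve. all: by end_near. Qed.

Section Riemann.
Variables (al d : R) (F : R -> R).
Hypotheses (al0 : 0 <= al) (d0 : 0 < d) (Fd : 0 <= F d).
Hypothesis step : forall b b', d <= b -> b <= b' ->
  expR (al * b) / b' * (b' - b) <= F b' - F b.

(** [psum_piece] costs e^(al s') / s per unit length where F provides e^(al s) / s'. The ratio e^(al
    D) (1 + D / s) is at most e^((al + 1/d) D) at every step, so the loss is one common factor. *)
Lemma psum_steps (D eps : R) (j : nat) : 0 <= D -> 0 < eps ->
  \forall X \near +oo, forall B,
    psum al X d (d + j%:R * D) B <=
      expR ((al + d^-1) * D) * F (d + j%:R * D) + eps.
Proof.
move=> D0; elim: j eps => [|j IH] eps e0.
  near=> X => B0; rewrite mul0r addr0 /psum big1; first by rewrite addr_ge0 ?(ltW e0) // mulr_ge0 ?expR_ge0.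
  by move=> p /andP[_ /andP[h1 h2]]; move: (lt_le_trans h1 h2); rewrite ltxx.
set s := d + j%:R * D; set s' := d + j.+1%:R * D.
have sE : s' = s + D by rewrite /s /s' -natr1; ring.
have ds : d <= s by rewrite lerDl mulr_ge0.
have s0 : 0 < s by exact: lt_le_trans ds.
have ss : s <= s' by rewrite sE lerDl.
have s'0 : 0 < s' by exact: lt_le_trans ss.
have e2 : 0 < eps / 2 by rewrite divr_gt0.
near=> X.
have X1 : 1 <= X by near: X; exact: nbhs_pinfty_ge.
have h1 : forall B, psum al X d s B <= expR ((al + d^-1) * D) * F s + eps / 2.
  by near: X; exact: IH _ e2.
have h2 : forall B, psum al X s s' B <= expR (al * s') / s * (s' - s) + eps / 2.
  by near: X; exact: psum_piece al0 s0 ss e2.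
move=> B; have {}h1 := h1 B; have {}h2 := h2 B.
rewrite (psum_cat _ _ X1 ds ss).
suff h3 : expR (al * s') / s * (s' - s) <=
    expR ((al + d^-1) * D) * (F s' - F s).
  by move: h3; rewrite mulrBr; lra.
apply: le_trans (ler_wpM2l (expR_ge0 _) (step ds ss)).
rewrite mulrA ler_wpM2r ?subr_ge0 // mulrA mulrDl expRD.
rewrite sE mulrDr expRD [expR (al * s) * _]mulrC -!mulrA ler_wpM2l ?expR_ge0 //.
rewrite mulrCA ler_wpM2l ?expR_ge0 //.
rewrite -sE ler_pdivlMr // mulrC ler_pdivrMr // sE.
apply: (@le_trans _ _ ((1 + d^-1 * D) * s)).
  rewrite mulrDl mul1r lerD2l mulrAC -[leLHS]mul1r ler_wpM2r //.
  by rewrite mulrC ler_pdivlMr // mul1r.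
by rewrite ler_wpM2r ?expR_ge1Dx // ltW.
Unshelve. all: by end_near. Qed.

Lemma primitive_ge0 b : d <= b -> 0 <= F b.
Proof.
move=> db; have b0 : 0 < b by exact: lt_le_trans db.
have h : 0 <= expR (al * d) / b * (b - d).
  by rewrite mulr_ge0 ?subr_ge0 // divr_ge0 ?expR_ge0 // ltW.
by have := le_trans h (step (lexx d) db); rewrite subr_ge0; exact: le_trans.
Qed.

Lemma psum_open u eps : d <= u -> 0 < eps ->
  \forall X \near +oo, forall B, psum al X d u B <= F u + eps.
Proof.
move=> du e0; have Fu := primitive_ge0 du.
have e2 : 0 < eps / 2 by rewrite divr_gt0.
(* Chosen so that e^x F(u) <= F(u) + eps / 2; the 1 in the denominator covers F(u) = 0. *)
pose x := ln (1 + eps / 2 / (F u + 1)).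
have q0 : 0 < eps / 2 / (F u + 1) by rewrite divr_gt0 // ltr_wpDl.
have x0 : 0 < x by rewrite ln_gt0 // ltrDl.
pose c := al + d^-1.
have c0 : 0 < c by rewrite ltr_wpDl // invr_gt0.
pose m := (Num.truncn (c * (u - d) / x)).+1.
pose D := (u - d) / m%:R.
have D0 : 0 <= D by rewrite divr_ge0 // subr_ge0.
have mD : d + m%:R * D = u.
  by rewrite mulrCA divff ?mulr1 ?pnatr_eq0 // addrC subrK.
have cD : c * D <= x.
  rewrite /D mulrA ler_pdivrMr ?ltr0n // [leRHS]mulrC -ler_pdivrMr //.
  exact/ltW/truncnS_gt.
have := psum_steps m D0 e2; rewrite mD; apply: filterS => X h B.
apply: (le_trans (h B)).
have : expR (c * D) * F u <= F u + eps / 2.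
  apply: (@le_trans _ _ (expR x * F u)); first by rewrite ler_wpM2r // ler_expR.
  rewrite lnK ?posrE; last by rewrite ltr_pwDl // ltW.
  rewrite mulrDl mul1r lerD2l -[leRHS]mulr1 -mulrA ler_wpM2l //; first exact: ltW.
  by rewrite mulrC ler_pdivrMr ?mul1r ?lerDl // ltr_wpDl.
rewrite -/c; lra.
Qed.

(** The lower slack turns p >= X^d into the strict inequality of [in_range]; the upper slack will
    absorb log 9 / log X. *)
Lemma psum_closed u eps : d <= u -> 0 < eps ->
  exists2 kap : R, 0 < kap < d &
  \forall X \near +oo, forall B,
     psum al X (d - kap) (u + kap) B <= F u + eps.
Proof.
move=> du e0; have u0 : 0 < u by exact: lt_le_trans du.
(* A bounds the cost per unit length at the two ends, given kap <= d / 2 and kap <= 1. *)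
pose A := expR (al * d) / (d / 2) + expR (al * (u + 1)) / u.
have A0 : 0 < A by rewrite addr_gt0 // divr_gt0 ?expR_gt0 // divr_gt0.
pose kap := Num.min (Num.min (d / 2) 1) (eps / 2 / A).
have k0 : 0 < kap by rewrite !lt_min ltr01 !divr_gt0.
have kd : kap <= d / 2 by rewrite !ge_min lexx.
have k1 : kap <= 1 by rewrite !ge_min lexx orbT.
have kA : kap * A <= eps / 2.
  by rewrite -ler_pdivlMr // !ge_min lexx orbT.
exists kap; first by rewrite k0 /=; lra.
have dk0 : 0 < d - kap by lra.
have dk : d - kap <= d by lra.
have uk : u <= u + kap by lra.
have e6 : 0 < eps / 6 by rewrite divr_gt0.
near=> X.
have X1 : 1 <= X by near: X; exact: nbhs_pinfty_ge.
have h1 : forall B, psum al X (d - kap) d B <= expR (al * d) / (d - kap) * (d - (d - kap)) + eps / 6.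
  by near: X; exact: psum_piece al0 dk0 dk e6.
have h2 : forall B, psum al X d u B <= F u + eps / 6.
  by near: X; exact: psum_open du e6.
have h3 : forall B, psum al X u (u + kap) B <= expR (al * (u + kap)) / u * (u + kap - u) + eps / 6.
  by near: X; exact: psum_piece al0 u0 uk e6.
move=> B; have {}h1 := h1 B; have {}h2 := h2 B; have {}h3 := h3 B.
rewrite (psum_cat _ _ X1 (le_trans dk du) uk) (psum_cat _ _ X1 dk du).
have g1 : expR (al * d) / (d - kap) * (d - (d - kap)) <= expR (al * d) / (d / 2) * kap.
  rewrite subKr ler_wpM2r ?(ltW k0) // ler_wpM2l ?expR_ge0 //.
  by rewrite lef_pV2 ?posrE ?divr_gt0 //; lra.
have g2 : expR (al * (u + kap)) / u * (u + kap - u) <= expR (al * (u + 1)) / u * kap.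
  rewrite [u + kap - u]addrAC subrr add0r ler_wpM2r ?(ltW k0) // ler_wpM2r ?invr_ge0 ?(ltW u0) //.
  by rewrite ler_expR ler_wpM2l // lerD2l.
have g3 : expR (al * d) / (d / 2) * kap + expR (al * (u + 1)) / u * kap <= eps / 2.
  by rewrite -mulrDl mulrC.
lra.
Unshelve. all: by end_near. Qed.

End Riemann.

End PrimeSums.

(** * Counting values of n^3 + 2 with prescribed prime divisors *)

(** Ordered tuples with repetition, so that sums of products factor as k-th powers; k! is recovered
    in [fact_count_le]. *)
Fixpoint kseqs (k : nat) (P : seq nat) : seq (seq nat) :=
  if k is k'.+1 then [seq x :: t | x <- P, t <- kseqs k' P] else [:: [::]].

Lemma mem_kseqs k P q : (q \in kseqs k P) = (size q == k) && all (mem P) q.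
Proof.
elim: k q => [|k IH] [|x q] //=.
  by apply/negbTE/negP => /allpairsP[[y t] /= [_ _]].
apply/allpairsP/idP => [[[y t] /= [yP tk [-> ->]]]|].
  by move: tk; rewrite IH => /andP[/eqP-> ->]; rewrite eqxx yP.
rewrite eqSS => /andP[sz /andP[xP qP]]; exists (x, q); split => //=.
by rewrite IH sz qP.
Qed.

Lemma sum_kseqs (K : comNzRingType) k (P : seq nat) (g : nat -> K) :
  \sum_(q <- kseqs k P) \prod_(p <- q) g p = (\sum_(p <- P) g p) ^+ k.
Proof.
elim: k => [|k IH]; first by rewrite big_seq1 big_nil expr0.
rewrite /= big_allpairs_dep /= exprS -IH mulr_suml; apply: eq_bigr => x _.
by rewrite mulr_sumr; apply: eq_bigr => t _; rewrite big_cons.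
Qed.

Lemma count_sum (T : Type) (P : pred T) (s : seq T) :
  count P s = (\sum_(n <- s) P n)%N.
Proof. by rewrite -sum1_count big_mkcond; apply: eq_bigr => n _; case: (P n). Qed.

Section Window.
Variable R : realType.
Implicit Types (X : R).

Definition window X : seq nat :=
  [seq n <- iota 0 (Num.truncn (2 * X)).+1 | (X < n%:R <= 2 * X)].

Lemma window_uniq X : uniq (window X).
Proof. exact/filter_uniq/iota_uniq. Qed.

Lemma mem_window X n : (n \in window X) -> X < n%:R <= 2 * X.
Proof. by rewrite mem_filter => /andP[]. Qed.

(** Measured from the least counted n0 > X, the quotients (n - n0) / D are distinct integers in
    [0, X / D]. *)
Lemma count_window_mod X D (P : pred nat) : 0 < X -> (0 < D)%N ->
  (forall n m, P n -> P m -> n = m %[mod D]) ->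
  (count P (window X))%:R <= X / D%:R + 1.
Proof.
move=> X0 D0 hP; rewrite -size_filter; set s := seq.filter P _.
have D0' : 0 < D%:R :> R by rewrite ltr0n.
have us : uniq s by rewrite filter_uniq ?window_uniq.
have [s0|[n0' n0s']] : s = [::] \/ exists n, n \in s.
  by case: s {us} => [|x s']; [left|right; exists x; rewrite mem_head].
  by rewrite s0 addr_ge0 // divr_ge0 // ltW.
have ex : exists n, n \in s by exists n0'.
case: (ex_minnP ex) => n0 n0s min {n0' n0s' ex}.
have sP n : n \in s -> P n /\ X < n%:R <= 2 * X.
  by rewrite mem_filter => /andP[Pn /mem_window].
have [P0 /andP[X1 _]] := sP _ n0s.
have nE n : n \in s -> n = (n0 + (n - n0) %/ D * D)%N.
  move=> ns; have le := min _ ns; have [Pn _] := sP _ ns.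
  rewrite divnK ?subnKC // -eqn_mod_dvd //; apply/eqP; exact: hP.
have inj : {in s &, injective (fun n => (n - n0) %/ D)%N}.
  by move=> n m ns ms e; rewrite (nE _ ns) (nE _ ms) e.
have : (size (map (fun n => (n - n0) %/ D)%N s) <=
    size (iota 0 (Num.truncn (X / D%:R)).+1))%N.
  apply: uniq_leq_size; first by rewrite map_inj_in_uniq.
  move=> _ /mapP[n ns ->]; rewrite mem_iota add0n /= ltnS truncn_ge_nat;
    last by rewrite divr_ge0 // ltW.
  have [_ /andP[_ nX]] := sP _ ns; have le := min _ ns.
  rewrite ler_pdivlMr // -natrM; apply: (@le_trans _ _ (n - n0)%N%:R).
    by rewrite ler_nat leq_trunc_div.
  rewrite natrB //; lra.
rewrite size_map size_iota -(ler_nat R) => /le_trans; apply.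
by rewrite -natr1 lerD2r truncn_le divr_ge0 // ltW.
Qed.

(** Induction on [q]: D and a hold the modulus and residue already fixed, and each new prime splits
    the class into rho(p) classes modulo D p. *)
Lemma count_window_crt X (q : seq nat) D a : 0 < X -> (0 < D)%N ->
  uniq q -> all prime q -> all (coprime D) q ->
  (count (fun n => (n == a %[mod D])%N && all (fun p => p %| n ^ 3 + 2)%N q)
     (window X))%:R <=
  (\prod_(p <- q) rho p)%:R * (X / (D * \prod_(p <- q) p)%:R + 1).
Proof.
move=> X0; elim: q D a => [|p q IH] D a D0.
  move=> _ _ _; rewrite !big_nil mul1r muln1.
  by apply: count_window_mod => // n m /andP[/eqP-> _] /andP[/eqP-> _].
rewrite /= => /andP[pq uq] /andP[pp aq] /andP[cDp cDq].
have D'0 : (0 < D * p)%N by rewrite muln_gt0 D0 prime_gt0.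
have cD' : all (coprime (D * p)) q.
  apply/allP => x xq; rewrite coprimeMl (allP cDq _ xq) /=.
  have px : prime x := allP aq _ xq.
  rewrite prime_coprime // dvdn_prime2 //; apply/negP => /eqP e.
  by move: pq; rewrite e xq.
apply: (@le_trans _ _ (\sum_(r <- croots p)
   (count (fun n => (n == chinese D p a r %[mod D * p])%N &&
      all (fun p => p %| n ^ 3 + 2)%N q) (window X))%:R)).
  rewrite -natr_sum ler_nat.
  under [leqRHS]eq_bigr do rewrite count_sum.
  rewrite exchange_big /= count_sum; apply: leq_sum => n _.
  case: (boolP (_ && _)) => //= /andP[na /andP[pn qn]].
  have nr : (n %% p)%N \in croots p.
    rewrite mem_croots ltn_pmod ?prime_gt0 //= /dvdn -modnDml modnXm modnDml.
    by [].
  rewrite (bigD1_seq (n %% p)%N) ?croots_uniq //= qn andbT.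
  rewrite chinese_remainder // chinese_modl // na /=.
  by rewrite chinese_modr // modn_mod eqxx.
rewrite !big_cons [(rho p * _)%N]mulnC natrM -mulrA [in leRHS]mulrCA.
apply: (@le_trans _ _ (\sum_(r <- croots p)
   (\prod_(j <- q) rho j)%:R * (X / (D * (p * \prod_(j <- q) j))%:R + 1))).
  by apply: ler_sum => r _; rewrite mulnA; exact: IH.
by rewrite big_const_seq count_predT iter_addr_0 -[leLHS]mulr_natl.
Qed.

Lemma theta_le n : \sum_(0 <= p < n.+1 | prime p) ln p%:R <= 4 * n%:R :> R.
Proof.
have [->|n0] := posnP n.
  by rewrite big_mkcond big_nat1 mulr0.
pose i := trunc_log 2 n.
have lo : (2 ^ i <= n)%N by exact: trunc_logP.
have up : (n < 2 ^ i.+1)%N by exact: trunc_log_ltn.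
apply: (@le_trans _ _ (2 ^+ i.+2)); last first.
  by rewrite !exprS mulrA -natrM ler_wpM2l // -natrX ler_nat.
apply: le_trans (theta_pow2_le R i.+1).
rewrite [leRHS](big_cat_nat (n := n.+1)) //=; last by rewrite ltnW.
by rewrite lerDl sumr_ge0 // => p _; exact: ln_natr_ge0.
Qed.

End Window.

(** * Rankin's weighted count of prime tuples *)

Section TupleCount.
Variable R : realType.
Variables (X al beta a b : R) (B : nat).
Hypotheses (lnX : 0 < ln X) (X0 : 0 < X) (al0 : 0 <= al) (a0 : 0 < a).

Local Notation P := [seq p <- index_iota 0 B | in_range X a b p].
Local Notation S := (psum al X a b B).

(** Rankin's weight e^(-beta) m^(al / log X); it is at least 1 exactly when al log m >= beta log
    X. *)
Definition weight (m : nat) : R := expR (al * (ln m%:R / ln X) - beta).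

Definition admissible (q : seq nat) : bool :=
  [&& uniq q, (\prod_(p <- q) p)%N%:R <= 3 * X & 1 <= weight (\prod_(p <- q) p)].

Definition all_dvd_cubic (n : nat) (q : seq nat) : bool :=
  all (fun p => p %| n ^ 3 + 2)%N q.

Lemma mem_range p : p \in P -> prime p /\ X `^ a < p%:R.
Proof. by rewrite mem_filter => /andP[/andP[pp /andP[h _]] _]. Qed.

Lemma expR_ln_prod (q : seq nat) : all (leq 1) q ->
  expR (al * (ln (\prod_(p <- q) p)%N%:R / ln X)) =
  \prod_(p <- q) expR (al * (ln p%:R / ln X)).
Proof.
elim: q => [|p q IH] /=; first by rewrite !big_nil ln1 mul0r mulr0 expR0.
move=> /andP[p0 q0]; rewrite !big_cons -IH // -expRD natrM lnM ?posrE ?ltr0n //.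
  by rewrite -mulrDr -mulrDl.
by rewrite big_seq prodn_cond_gt0 // => x /(allP q0).
Qed.

(** 12 = 3 * 4, from rho(p) <= 3 and Chebyshev's bound 4 z; dividing by log p >= a log X gains the
    logarithm. *)
Lemma sum_range_le z : 0 <= z ->
  \sum_(p <- P | p%:R <= z) (rho p)%:R <= 12 / (a * ln X) * z :> R.
Proof.
move=> z0; have aL : 0 < a * ln X by exact: mulr_gt0.
apply: (@le_trans _ _ (3 / (a * ln X) *
   \sum_(0 <= p < (Num.truncn z).+1 | prime p) ln p%:R)); last first.
  rewrite (_ : 12 / (a * ln X) * z = 3 / (a * ln X) * (4 * z)); last by ring.
  rewrite ler_wpM2l ?divr_ge0 ?(ltW aL) //.
  by apply: (le_trans (theta_le R _)); rewrite ler_wpM2l // truncn_le.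
rewrite big_filter_cond /=.
apply: (@le_trans _ _ (\sum_(0 <= p < maxn B (Num.truncn z).+1 |
    in_range X a b p && (p%:R <= z)) (3 / (a * ln X) * ln p%:R))).
  rewrite [leRHS](big_cat_nat (n := B)) ?leq_maxl //= -[leLHS]addr0.
  have aL' := ltW aL; apply: lerD; last first.
    by apply: sumr_ge0 => p _; rewrite mulr_ge0 ?divr_ge0 // ln_natr_ge0.
  apply: ler_sum => p /andP[/andP[pp /andP[pa _]] _].
  rewrite mulrAC ler_pdivlMr //; apply: ler_pM => //.
    by rewrite ler_nat rho_le3.
  by rewrite -ln_powR ler_ln ?posrE ?powR_gt0 // ?ltW // ltr0n prime_gt0.
have tail0 : \sum_((Num.truncn z).+1 <= p < maxn B (Num.truncn z).+1 |
    in_range X a b p && (p%:R <= z)) (3 / (a * ln X) * ln p%:R) = 0.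
  rewrite big_nat_cond big1 // => p /andP[/andP[zp _] /andP[_ pz]].
  by move: zp; rewrite ltnNge truncn_ge_nat // pz.
rewrite (big_cat_nat (n := (Num.truncn z).+1)) ?leq_maxr //= tail0 addr0 mulr_sumr.
rewrite big_mkcond [leRHS]big_mkcond /=; apply: ler_sum => p _.
rewrite /in_range; case: (prime p) => //=; case: ifP => // _.
by rewrite mulr_ge0 ?divr_ge0 ?(ltW aL) // ln_natr_ge0.
Qed.

(** With all entries but the head fixed, the head is at most 3 X divided by their product, and
    [sum_range_le] applies; 36 = 12 * 3. *)
Lemma sum_rho_prod_le k :
  \sum_(q <- kseqs k.+1 P | (\prod_(p <- q) p)%N%:R <= 3 * X)
     (\prod_(p <- q) rho p)%N%:R <=
  36 / (a * ln X) * X * (\sum_(p <- P) (rho p)%:R / p%:R) ^+ k :> R.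
Proof.
have aL : 0 < a * ln X by exact: mulr_gt0.
rewrite -sum_kseqs mulr_sumr big_mkcond /= big_allpairs_dep /= exchange_big /=.
rewrite big_seq [leRHS]big_seq; apply: ler_sum => t.
rewrite mem_kseqs => /andP[_ /allP tP].
have Q0 : (0 < \prod_(p <- t) p)%N.
  by rewrite big_seq prodn_cond_gt0 // => x /tP /mem_range[/prime_gt0].
have Q0' : 0 < (\prod_(p <- t) p)%N%:R :> R by rewrite ltr0n.
have e : \prod_(p <- t) ((rho p)%:R / p%:R) =
    (\prod_(p <- t) rho p)%N%:R / (\prod_(p <- t) p)%N%:R :> R.
  by rewrite !natr_prod -prodf_div.
pose z := 3 * X / (\prod_(p <- t) p)%N%:R.
have z0 : 0 <= z by rewrite divr_ge0 // mulr_ge0 // ltW.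
rewrite e (_ : _ * (_ / _) = (\prod_(p <- t) rho p)%N%:R * (12 / (a * ln X) * z));
  last by rewrite /z; ring.
apply: le_trans (ler_wpM2l _ (sum_range_le z0)) => //.
rewrite mulr_sumr [leRHS]big_mkcond /=; apply: ler_sum => p _.
rewrite !big_cons natrM -ler_pdivlMr // -/z; case: ifP => // _.
by rewrite natrM mulrC.
Qed.

Lemma sum_rho_le_psum : \sum_(p <- P) (rho p)%:R / p%:R <= S.
Proof.
rewrite /psum big_filter; apply: ler_sum => p /andP[pp _].
rewrite -[leLHS]mulr1 ler_wpM2l ?divr_ge0 //.
rewrite -[leLHS]expR0 ler_expR.
exact: mulr_ge0 al0 (divr_ge0 (ln_natr_ge0 R p) (ltW lnX)).
Qed.

(** All permutations of an admissible tuple are admissible, and its k! permutations differ because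
    its entries do. *)
Lemma fact_count_le k :
  ((k`! * count (fun n => has (fun q => admissible q && all_dvd_cubic n q)
                    (kseqs k P)) (window X))%N <=
   \sum_(q <- kseqs k P | admissible q)
      count (fun n => all_dvd_cubic n q) (window X))%N.
Proof.
under [leqRHS]eq_bigr do rewrite count_sum.
rewrite exchange_big /= count_sum big_distrr /=; apply: leq_sum => n _.
case: hasP => [[q0 q0k /andP[adm dv]]|_]; last by rewrite muln0.
rewrite muln1; have [uq _ _] := and3P adm.
have := q0k; rewrite mem_kseqs => /andP[/eqP sz q0P].
rewrite -{1}sz -size_permutations //.
rewrite [leqRHS](_ : _ = size [seq q <- kseqs k P | admissible q && all_dvd_cubic n q]).
  apply: uniq_leq_size; first exact: permutations_uniq.
  move=> q; rewrite mem_permutations => pq; rewrite mem_filter mem_kseqs.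
  rewrite (perm_size pq) sz eqxx /= (perm_all _ pq) q0P andbT.
  rewrite /all_dvd_cubic (perm_all _ pq) -/(all_dvd_cubic n q0) dv andbT.
  by rewrite /admissible (perm_uniq pq) uq /= !(perm_big _ pq) /=; case/and3P: adm => _ -> ->.
rewrite size_filter -sum1_count [RHS]big_mkcond [LHS]big_mkcond /=.
by apply: eq_bigr => q _; case: admissible; case: all_dvd_cubic.
Qed.

(** Inserting the weight, at least 1 on admissible tuples, frees the main term X / Q of all
    conditions, Q being the product of the tuple, and it factors as S^(k + 1). The rounding term 1
    keeps the condition Q <= 3 X, which bounds its weight. *)
Lemma tuple_count_le k :
  (k.+1)`!%:R * (count (fun n => has (fun q => admissible q && all_dvd_cubic n q)
                    (kseqs k.+1 P)) (window X))%:R <=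
  X * (expR (- beta) * (S ^+ k.+1 +
         expR (al * (ln (3 * X) / ln X)) * (36 / (a * ln X)) * S ^+ k)).
Proof.
have aL : 0 < a * ln X by exact: mulr_gt0.
rewrite -natrM; apply: (@le_trans _ _ (\sum_(q <- kseqs k.+1 P | admissible q)
   expR (- beta) * (expR (al * (ln (\prod_(p <- q) p)%N%:R / ln X)) *
    ((\prod_(p <- q) rho p)%N%:R * (X / (\prod_(p <- q) p)%N%:R + 1))))).
  apply: (@le_trans _ _ (\sum_(q <- kseqs k.+1 P | admissible q)
      count (fun n => all_dvd_cubic n q) (window X))%N%:R).
    by rewrite ler_nat fact_count_le.
  rewrite natr_sum big_seq_cond [leRHS]big_seq_cond; apply: ler_sum => q.
  rewrite mem_kseqs => /andP[/andP[_ /allP qP] /and3P[uq _ w1]].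
  have pq : all prime q by apply/allP => p /qP /mem_range[].
  have c1 : all (coprime 1) q by apply/allP => p _; rewrite coprime1n.
  have := @count_window_crt R X q 1 0 X0 isT uq pq c1.
  rewrite mul1n; under eq_count do rewrite !modn1 eqxx /=.
  move=> h; apply: (le_trans h); rewrite mulrA -expRD [- beta + _]addrC.
  by apply: ler_peMl => //; rewrite mulr_ge0 // addr_ge0 // divr_ge0 // ltW.
rewrite -mulr_sumr [leRHS]mulrCA ler_wpM2l ?expR_ge0 //.
under eq_bigr do rewrite mulrDr mulr1 mulrDr.
rewrite big_split /= mulrDr; apply: lerD.
  apply: (@le_trans _ _ (\sum_(q <- kseqs k.+1 P)
     X * \prod_(p <- q) ((rho p)%:R / p%:R * expR (al * (ln p%:R / ln X))))).
    rewrite big_mkcond big_seq [leRHS]big_seq; apply: ler_sum => q.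
    rewrite -/(kseqs k.+1 P) mem_kseqs => /andP[_ /allP qP].
    have q1 : all (leq 1) q by apply/allP => p /qP /mem_range[/prime_gt0].
    rewrite big_split /= -expR_ln_prod // prodf_div -!natr_prod.
    case: ifP => _; first by rewrite le_eqVlt; apply/orP; left; apply/eqP; ring.
    by rewrite mulr_ge0 ?(ltW X0) // mulr_ge0 ?expR_ge0 // divr_ge0.
  by rewrite -mulr_sumr sum_kseqs /psum big_filter.
apply: (@le_trans _ _ (\sum_(q <- kseqs k.+1 P | (\prod_(p <- q) p)%N%:R <= 3 * X)
   expR (al * (ln (3 * X) / ln X)) * (\prod_(p <- q) rho p)%N%:R)).
  rewrite big_mkcond [leRHS]big_mkcond big_seq [leRHS]big_seq.
  apply: ler_sum => q; rewrite -/(kseqs k.+1 P) mem_kseqs => /andP[_ /allP qP].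
  have Q0 : (0 < \prod_(p <- q) p)%N.
    by rewrite big_seq prodn_cond_gt0 // => x /qP /mem_range[/prime_gt0].
  have pos : 0 <= expR (al * (ln (3 * X) / ln X)) * (\prod_(p <- q) rho p)%N%:R.
    by rewrite mulr_ge0 ?expR_ge0.
  rewrite /admissible; case: (uniq q) => /=; last by case: ifP.
  case: ifP => [/andP[le3 _]|]; last by case: ifP.
  rewrite le3 ler_wpM2r // ler_expR ler_wpM2l // ler_wpM2r ?invr_ge0 ?(ltW lnX) //.
  by rewrite ler_ln // posrE ?ltr0n // mulr_gt0.
rewrite -mulr_sumr; apply: (le_trans (ler_wpM2l (expR_ge0 _) (sum_rho_prod_le k))).
rewrite (_ : X * _ = expR (al * (ln (3 * X) / ln X)) * (36 / (a * ln X) * X * S ^+ k));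
  last by ring.
rewrite ler_wpM2l ?expR_ge0 // ler_wpM2l //.
  by rewrite mulr_ge0 ?(ltW X0) // divr_ge0 // ltW.
apply: lerXn2r; rewrite ?nnegrE.
- by rewrite sumr_ge0 // => p _; rewrite divr_ge0.
- by rewrite sumr_ge0 // => p _; rewrite mulr_ge0 ?expR_ge0 // divr_ge0.
exact: sum_rho_le_psum.
Qed.

End TupleCount.

(** Uniqueness in Hensel's lemma: n^3 - m^3 = (n - m)(n^2 + n m + m^2), whose second factor is
    congruent to the unit 3 n^2. *)
Lemma cubic_sqr_mod_unique p n m : prime p -> (3 < p)%N ->
  n = m %[mod p] -> (p ^ 2 %| n ^ 3 + 2)%N -> (p ^ 2 %| m ^ 3 + 2)%N ->
  n = m %[mod p ^ 2].
Proof.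
move=> pp p3 nm; wlog le : n m nm / (m <= n)%N.
  move=> H hn hm; have [/H|/ltnW /H] := leqP m n; first exact.
  by move=> h; apply/esym/h.
move=> hn hm.
have : (p ^ 2 %| (n ^ 3 + 2) - (m ^ 3 + 2))%N by exact: dvdn_sub.
rewrite subnDr (_ : n ^ 3 - m ^ 3 = (n - m) * (n ^ 2 + n * m + m ^ 2))%N; last first.
  apply/eqP; rewrite -(eqn_add2r (m ^ 3)) subnK ?leq_exp2r //.
  by move: (n - m)%N (subnKC le) => k <-; apply/eqP; ring.
rewrite Gauss_dvdl.
  by move=> h; apply/eqP; rewrite eqn_mod_dvd.
rewrite coprimeXl // prime_coprime //.
have p_n : (p %| n ^ 3 + 2)%N by apply: dvdn_trans hn; rewrite expnS dvdn_mulr.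
have -> : (p %| n ^ 2 + n * m + m ^ 2)%N = (p %| 3 * n ^ 2)%N.
  have -> : (3 * n ^ 2 = n ^ 2 + n * m + m ^ 2 + (n - m) * (2 * n + m))%N.
    by move: (n - m)%N (subnKC le) => k <-; ring.
  by rewrite [RHS]dvdn_addl // dvdn_mulr // -eqn_mod_dvd // nm.
apply/negP; rewrite Euclid_dvdM // => /orP[/dvdn_leq|]; first by move=> /(_ isT); lia.
rewrite Euclid_dvdX // => /andP[pn _].
by move: p_n; rewrite dvdn_addr ?dvdn_exp // => /dvdn_leq => /(_ isT); lia.
Qed.

Section Squares.
Variable R : realType.
Implicit Types (X d eps : R).

Lemma near_powR_ge d (A : R) : 0 < d -> \forall X \near +oo, A <= X `^ d.
Proof.
move=> d0; near=> X; have h : A / d <= ln X by near: X; exact: near_ln_ge.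
have X0 : 0 < X by near: X; exact: nbhs_pinfty_gt.
rewrite -[X `^ d]lnK ?posrE ?powR_gt0 // ln_powR.
apply: le_trans (expR_ge1Dx _).
by move: h; rewrite ler_pdivrMr // mulrC; lra.
Unshelve. all: by end_near. Qed.

Lemma count_sqr_dvd X p : 0 < X -> prime p -> (3 < p)%N ->
  (count (fun n => p ^ 2 %| n ^ 3 + 2)%N (window X))%:R
    <= 3 * (X / p%:R ^+ 2 + 1).
Proof.
move=> X0 pp p3; have p0 := prime_gt0 pp.
apply: (@le_trans _ _ (\sum_(r <- croots p)
   (count (fun n => (n %% p == r) && (p ^ 2 %| n ^ 3 + 2))%N (window X))%:R)).
  rewrite -natr_sum ler_nat; under [leqRHS]eq_bigr do rewrite count_sum.
  rewrite exchange_big /= count_sum; apply: leq_sum => n _.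
  case: (boolP (_ %| _)%N) => //= dv.
  have nr : (n %% p)%N \in croots p.
    rewrite mem_croots ltn_pmod //= /dvdn -modnDml modnXm modnDml.
    by apply: dvdn_trans dv; rewrite expnS dvdn_mulr.
  by rewrite (bigD1_seq (n %% p)%N) ?croots_uniq //= eqxx.
have pos : 0 <= X / p%:R ^+ 2 + 1.
  by rewrite addr_ge0 // divr_ge0 ?(ltW X0) // exprn_ge0.
apply: (@le_trans _ _ (\sum_(r <- croots p) (X / p%:R ^+ 2 + 1))).
  apply: ler_sum => r _; rewrite -natrX; apply: count_window_mod => //.
    by rewrite expn_gt0 p0.
  move=> n m /andP[/eqP n1 n2] /andP[/eqP m1 m2].
  by apply: cubic_sqr_mod_unique => //; rewrite n1 m1.
rewrite big_const_seq count_predT iter_addr_0 -[leLHS]mulr_natl ler_wpM2r //.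
by rewrite ler_nat rho_le3.
Qed.

(** A prime repeated in a tuple with product at most 3 X has p^2 <= 3 X. The cutoff leaves only
    O(sqrt X) of the terms 1 in [count_sqr_dvd]. *)
Definition sqr_bad d X (n : nat) : bool :=
  has (fun p => [&& prime p, X `^ d <= p%:R & (p ^ 2 %| n ^ 3 + 2)%N])
      (iota 0 (Num.truncn (Num.sqrt (3 * X))).+1).

Lemma count_sqr_bad d eps : 0 < d -> 0 < eps ->
  \forall X \near +oo, (count (sqr_bad d X) (window X))%:R <= eps * X.
Proof.
move=> d0 e0; near=> X.
have X1 : 1 <= X by near: X; apply: nbhs_pinfty_ge; exact: num_real.
have X0 : 0 < X by exact: lt_le_trans X1.
have hX : 12 / eps <= X by near: X; apply: nbhs_pinfty_ge; exact: num_real.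
have hX2 : 3 * (6 / eps) ^+ 2 <= X by near: X; apply: nbhs_pinfty_ge; exact: num_real.
have hd : 6 + 12 / eps <= X `^ d by near: X; exact: near_powR_ge.
have e12 : 0 < 12 / eps by rewrite divr_gt0.
set B := (Num.truncn (Num.sqrt (3 * X))).+1.
have Xd0 : 0 <= X `^ d by exact: powR_ge0.
(* One below the integer part: the sum from c + 1 still contains every p >= X^d, and X^d <= c + 2
   makes 1 / c small. *)
pose c := (Num.truncn (X `^ d)).-1.
have t6 : (6 <= Num.truncn (X `^ d))%N by rewrite truncn_ge_nat //; lra.
have c0 : (0 < c)%N by move: t6; rewrite /c; case: (Num.truncn _) => [|[|t]].
have c3 : (3 < c)%N by rewrite /c -ltnS prednK // (leq_trans _ t6).
have cE : c%:R + 2 >= X `^ d.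
  have := truncnS_gt (X `^ d).
  have -> : (Num.truncn (X `^ d)).+1 = (c + 2)%N.
    by rewrite /c addn2 prednK // (leq_trans _ t6).
  by rewrite natrD => /ltW.
apply: (@le_trans _ _ (\sum_(c.+1 <= p < B) (3 * (X / p%:R ^+ 2 + 1)))).
  apply: (@le_trans _ _ (\sum_(0 <= p < B | prime p && (X `^ d <= p%:R))
     (count (fun n => p ^ 2 %| n ^ 3 + 2)%N (window X))%:R)).
    rewrite -natr_sum ler_nat; under [leqRHS]eq_bigr do rewrite count_sum.
    rewrite exchange_big /= count_sum; apply: leq_sum => n _.
    rewrite /sqr_bad; case: hasP => [[p pB /and3P[pp pX dv]]|] //.
    rewrite big_mkcond /index_iota subn0 (bigD1_seq p) ?iota_uniq //=.
    by rewrite pp pX dv.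
  have cp p : X `^ d <= p%:R -> (c < p)%N.
    move=> h; rewrite /c prednK ?(leq_trans _ t6) //.
    by rewrite -(ler_nat R); apply: le_trans h; rewrite truncn_le.
  have pos p : 0 <= 3 * (X / p%:R ^+ 2 + 1) :> R.
    by rewrite mulr_ge0 // addr_ge0 // divr_ge0 ?(ltW X0) // exprn_ge0.
  apply: (@le_trans _ _ (\sum_(0 <= p < B | (c < p)%N) (3 * (X / p%:R ^+ 2 + 1)))).
    rewrite big_mkcond [leRHS]big_mkcond; apply: ler_sum => p _.
    case: (boolP (_ && _)) => [/andP[pp pX]|_]; last by case: ifP.
    rewrite cp //; apply: count_sqr_dvd => //.
    exact: ltn_trans c3 (cp _ pX).
  have [cB|Bc] := leqP c.+1 B.
    rewrite (big_cat_nat (n := c.+1)) //= [X in X + _]big_nat_cond [X in X + _]big1.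
      rewrite add0r big_mkcond big_nat [leRHS]big_nat.
      by apply: ler_sum => p /andP[h _]; rewrite h.
    by move=> p /andP[/andP[_ h]]; rewrite ltnS in h; rewrite ltnNge h.
  rewrite big_nat_cond big1 ?sumr_ge0 // => p /andP[/andP[_ h]] Pp.
  by move: (ltn_trans Pp h); rewrite ltnNge -ltnS Bc.
rewrite -mulr_sumr big_split /= -mulr_sumr.
have s1 := sum_inv_sqr_le R B c0.
have s2 : \sum_(c.+1 <= p < B) (1 : R) <= Num.sqrt (3 * X) + 1.
  rewrite big_const_nat iter_addr_0 -[_ *+ _]mulr_natl mulr1.
  apply: (@le_trans _ _ B%:R); first by rewrite ler_nat leq_subr.
  by rewrite -[B%:R]natr1 lerD2r truncn_le // sqrtr_ge0.
have s3 : Num.sqrt (3 * X) <= eps / 6 * X.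
  have q0 : 0 <= eps / 6 * X by rewrite mulr_ge0 ?(ltW X0) // divr_ge0 // ltW.
  rewrite -[leRHS](ger0_norm q0) -sqrtr_sqr ler_wsqrtr //.
  have h : 3 <= (eps / 6) ^+ 2 * X.
    apply: le_trans (ler_wpM2l (sqr_ge0 (eps / 6)) hX2).
    by rewrite le_eqVlt; apply/orP; left; apply/eqP; field; rewrite gt_eqF.
  rewrite (_ : (eps / 6 * X) ^+ 2 = (eps / 6) ^+ 2 * X * X); last by ring.
  by rewrite ler_wpM2r // ltW.
have ci : c%:R^-1 <= eps / 12.
  rewrite -[eps / 12]invrK lef_pV2 ?posrE ?invr_gt0 ?divr_gt0 ?ltr0n //.
  rewrite invf_div; lra.
have : X * \sum_(c.+1 <= p < B) (p%:R ^+ 2)^-1 <= X * (eps / 12).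
  by rewrite ler_wpM2l ?(ltW X0) // (le_trans s1).
have : 1 <= X * (eps / 12).
  by move: hX; rewrite ler_pdivrMr // mulrA ler_pdivlMr // mul1r.
lra.
Unshelve. all: by end_near. Qed.

End Squares.

Lemma prodn_rem_dvd (q : seq nat) p : p \in q -> (p %| \prod_(x <- q) x)%N.
Proof. by move=> pq; rewrite (big_rem p) //= dvdn_mulr. Qed.

Lemma nuniq_sqr_dvd (q : seq nat) : ~~ uniq q ->
  exists2 p, p \in q & (p ^ 2 %| \prod_(x <- q) x)%N.
Proof.
elim: q => [//|x q IH] /=; rewrite negb_and negbK big_cons.
case/orP => [xq|/IH[p pq dv]].
  by exists x; rewrite ?mem_head // expnS expn1 dvdn_mul // prodn_rem_dvd.
by exists p; [rewrite inE pq orbT|rewrite dvdn_mull].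
Qed.

Lemma exprD_small (R : realFieldType) (x eps : R) n : 0 <= x -> 0 < eps ->
  exists2 e, 0 < e & (x + e) ^+ n <= x ^+ n + eps.
Proof.
move=> x0; elim: n eps => [|n IH] eps e0.
  by exists 1 => //; rewrite !expr0 lerDl ltW.
have x1 : 0 < 2 * (x + 1) by rewrite mulr_gt0 // ltr_wpDl.
have [e1 e10 h1] := IH _ (divr_gt0 e0 x1).
have xn : 0 <= x ^+ n by exact: exprn_ge0.
have q0 : 0 < 2 * (x ^+ n + 1) by rewrite mulr_gt0 // ltr_wpDl.
pose e := Num.min (Num.min e1 1) (eps / (2 * (x ^+ n + 1))).
have ee : 0 < e by rewrite !lt_min e10 ltr01 divr_gt0.
have l1 : e <= e1 by rewrite !ge_min lexx.
have l2 : e <= 1 by rewrite !ge_min lexx orbT.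
have l3 : e * (2 * (x ^+ n + 1)) <= eps.
  by rewrite -ler_pdivlMr // !ge_min lexx orbT.
exists e => //; rewrite !exprS.
have xe : 0 <= x + e by rewrite addr_ge0 // ltW.
have h2 : (x + e) ^+ n <= x ^+ n + eps / (2 * (x + 1)).
  by apply: le_trans h1; rewrite lerXn2r ?nnegrE ?lerD2l // addr_ge0 // ltW.
apply: (le_trans (ler_wpM2l xe h2)); rewrite mulrDr mulrDl -addrA lerD2l.
have h3 : (x + e) * (eps / (2 * (x + 1))) <= eps / 2.
  apply: (@le_trans _ _ ((x + 1) * (eps / (2 * (x + 1))))).
    by rewrite ler_wpM2r ?lerD2l // divr_ge0 // ltW.
  by rewrite le_eqVlt; apply/orP; left; apply/eqP; field; rewrite gt_eqF // ltr_wpDl.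
have h4 : e * x ^+ n <= eps / 2.
  rewrite ler_pdivlMr //; apply: le_trans l3.
  by rewrite -mulrA ler_wpM2l ?(ltW ee) // mulrC ler_wpM2l // lerDl.
lra.
Qed.

(** * Counting the n that have a prescribed type of prime tuple *)

Section Events.
Variable R : realType.
Implicit Types (X d u al beta eps : R).

Definition event X d u al beta (k n : nat) : Prop :=
  exists q : seq nat,
    [/\ size q = k, forall p, p \in q -> prime p /\ X `^ d <= p%:R <= X `^ u,
        (\prod_(p <- q) p)%N%:R <= 3 * X, (\prod_(p <- q) p %| n ^ 3 + 2)%N &
        1 <= weight X al beta (\prod_(p <- q) p)%N].

(** A repeated prime leads to [sqr_bad]; otherwise the tuple is admissible in the range widened by
    kap. *)
Lemma event_cases X d u u' al beta kap k n : 1 < X -> 0 < kap ->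
  u <= u' -> event X d u al beta k n ->
  sqr_bad d X n \/ has (fun q => admissible X al beta q && all_dvd_cubic n q)
    (kseqs k [seq p <- index_iota 0 (Num.truncn (X `^ u')).+1
             | in_range X (d - kap) u' p]).
Proof.
move=> X1 k0 uu [q [sz qP pX dv w1]].
have X0 : 0 < X by exact: lt_trans X1.
have [uq|] := boolP (uniq q).
  right; apply/hasP; exists q; last first.
    rewrite /admissible uq pX w1 /=; apply/allP => p pq.
    by apply: dvdn_trans dv; exact: prodn_rem_dvd.
  rewrite mem_kseqs sz eqxx andTb; apply/allP => p pq; rewrite inE mem_filter.
  have [pp /andP[p1 p2]] := qP _ pq.
  have p3 : p%:R <= X `^ u' by apply: (le_trans p2); rewrite ler_powR // ltW.
  rewrite /in_range pp p3 (mem_index_iota 0) ltnS truncn_ge_nat ?powR_ge0 //= p3 !andbT.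
  apply: lt_le_trans p1.
  by rewrite -ltr_ln ?posrE ?powR_gt0 // !ln_powR ltr_pM2r ?ln_gt0 // gtrBl.
move=> /nuniq_sqr_dvd[p pq pd]; left.
have [pp /andP[p1 _]] := qP _ pq.
have Q0 : (0 < \prod_(x <- q) x)%N.
  by rewrite big_seq prodn_cond_gt0 // => x /qP[/prime_gt0].
apply/hasP; exists p; last by rewrite pp p1 (dvdn_trans pd dv).
rewrite mem_iota add0n ltnS truncn_ge_nat ?sqrtr_ge0 //.
rewrite -[p%:R]ger0_norm // -sqrtr_sqr ler_wsqrtr //.
by apply: le_trans pX; rewrite -natrX ler_nat; exact: dvdn_leq.
Qed.

(** The thirds of eps pay for the n with a square factor, for replacing the prime sum by F(u) in the
    power, and for the rounding term. *)
Lemma event_count (al beta d u : R) (F : R -> R) k eps :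
  0 <= al -> 0 < d -> 0 <= F d ->
  (forall b b', d <= b -> b <= b' ->
     expR (al * b) / b' * (b' - b) <= F b' - F b) ->
  d <= u -> 0 < eps ->
  \forall X \near +oo,
    (count (fun n => `[< event X d (u + ln 9 / ln X) al beta k.+1 n >])
       (window X))%:R <=
    X * (expR (- beta) / (k.+1)`!%:R * F u ^+ k.+1 + eps).
Proof.
move=> al0 d0 Fd step du e0; have Fu := primitive_ge0 d0 Fd step du.
have E0 : 0 < expR (- beta) := expR_gt0 _.
have e30 : 0 < eps / 3 / expR (- beta) by rewrite !divr_gt0.
have [e1 e10 h1] := exprD_small k.+1 Fu e30.
have [kap /andP[k0 kd] hkap] := psum_closed al0 d0 Fd step du e10.
(* A bound independent of X for log X times the rounding term without e^(-beta), as log (3 X) <= 3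
   log X for X >= 3. *)
pose M := expR (al * 3) * 36 / (d - kap) * (F u + e1) ^+ k.
have dk0 : 0 < d - kap by rewrite subr_gt0.
have Fe : 0 <= F u + e1 by rewrite addr_ge0 // ltW.
have M0 : 0 <= M.
  by rewrite /M mulr_ge0 ?exprn_ge0 // divr_ge0 ?(ltW dk0) // mulr_ge0 ?expR_ge0.
near=> X.
have X3 : 3 <= X by near: X; apply: nbhs_pinfty_ge; exact: num_real.
have X1 : 1 < X by apply: lt_le_trans X3; lra.
have X0 : 0 < X by exact: lt_trans X1.
have L0 : 0 < ln X by exact: ln_gt0.
have hS : forall B, psum al X (d - kap) (u + kap) B <= F u + e1.
  by near: X; exact: hkap.
have hb : (count (sqr_bad d X) (window X))%:R <= eps / 3 * X.
  by near: X; apply: count_sqr_bad => //; rewrite divr_gt0.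
have hL : ln 9 / kap <= ln X by near: X; exact: near_ln_ge.
have hL2 : M * expR (- beta) / (eps / 3) <= ln X by near: X; exact: near_ln_ge.
pose u' := u + kap.
have uu : u + ln 9 / ln X <= u'.
  by rewrite lerD2l ler_pdivrMr // mulrC -ler_pdivrMr.
pose B := (Num.truncn (X `^ u')).+1.
pose P2 n := has (fun q => admissible X al beta q && all_dvd_cubic n q)
    (kseqs k.+1 [seq p <- index_iota 0 B | in_range X (d - kap) u' p]).
have c1 : (count (fun n => `[< event X d (u + ln 9 / ln X) al beta k.+1 n >])
    (window X) <= count (sqr_bad d X) (window X) + count P2 (window X))%N.
  rewrite -count_predUI; apply: leq_trans (leq_addr _ _).
  apply: sub_count => n /asboolP /(event_cases X1 k0 uu).
  by move=> h; apply/orP.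
have c2 := tuple_count_le beta u' B L0 X0 al0 dk0 k.
have f0 : 0 < (k.+1)`!%:R :> R by rewrite ltr0n fact_gt0.
have f1 : 1 <= (k.+1)`!%:R :> R by rewrite ler1n fact_gt0.
have S0 : 0 <= psum al X (d - kap) u' B.
  by rewrite sumr_ge0 // => p _; rewrite mulr_ge0 ?expR_ge0 // divr_ge0.
have t1 : expR (- beta) * psum al X (d - kap) u' B ^+ k.+1 <=
    expR (- beta) * F u ^+ k.+1 + eps / 3.
  apply: (@le_trans _ _ (expR (- beta) * (F u + e1) ^+ k.+1)).
    by rewrite ler_wpM2l ?(ltW E0) // lerXn2r ?nnegrE // hS.
  apply: (le_trans (ler_wpM2l (ltW E0) h1)); rewrite mulrDr lerD2l.
  by rewrite mulrC divfK // gt_eqF.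
have t2 : expR (- beta) * (expR (al * (ln (3 * X) / ln X)) *
    (36 / ((d - kap) * ln X)) * psum al X (d - kap) u' B ^+ k) <= eps / 3.
  apply: (@le_trans _ _ (expR (- beta) * (M / ln X))); last first.
    by rewrite mulrA ler_pdivrMr // [leLHS]mulrC [leRHS]mulrC -ler_pdivrMr // divr_gt0.
  rewrite ler_wpM2l ?(ltW E0) //.
  rewrite (_ : M / ln X = expR (al * 3) * (36 / ((d - kap) * ln X)) * (F u + e1) ^+ k);
    last by rewrite /M; field; rewrite !gt_eqF.
  have q0 : 0 <= 36 / ((d - kap) * ln X) by rewrite divr_ge0 // mulr_ge0 // ltW.
  apply: ler_pM.
  - by rewrite mulr_ge0 // expR_ge0.
  - exact: exprn_ge0.
  - rewrite ler_wpM2r // ler_expR ler_wpM2l // ler_pdivrMr //.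
    rewrite lnM ?posrE //; have : ln 3 <= ln X by rewrite ler_ln ?posrE.
    lra.
  by rewrite lerXn2r ?nnegrE // hS.
have c3 : (count P2 (window X))%:R <=
    X * ((expR (- beta) * F u ^+ k.+1 + eps / 3 + eps / 3) / (k.+1)`!%:R).
  rewrite mulrA ler_pdivlMr // mulrC; apply: (le_trans c2).
  by rewrite ler_wpM2l ?(ltW X0) // mulrDr lerD.
have c4 : (eps / 3 + eps / 3) / (k.+1)`!%:R <= eps / 3 + eps / 3.
  by rewrite ler_pdivrMr // ler_peMr // addr_ge0 // divr_ge0 // ltW.
move: c1; rewrite -(ler_nat R) natrD => c1; apply: (le_trans c1).
apply: (le_trans (lerD hb c3)).
rewrite [eps / 3 * X]mulrC -mulrDr ler_wpM2l ?(ltW X0) //.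
rewrite -addrA mulrDl [expR (- beta) / _ * _]mulrAC; lra.
Unshelve. all: by end_near. Qed.

End Events.

(** * The small prime factors of a value with many large ones *)

Lemma nth_le_drop (L : seq nat) j : sorted leq L ->
  all (leq (nth 0 L j)) (drop j L).
Proof.
move=> sL; apply/(all_nthP 0%N) => i; rewrite size_drop nth_drop => ij.
apply: (sorted_leq_nth leq_trans leqnn) => //; rewrite ?inE; first by lia.
- by lia.
- by rewrite leq_addr.
Qed.

Lemma take_le_nth (L : seq nat) j : sorted leq L -> (j < size L)%N ->
  all (fun p => p <= nth 0 L j)%N (take j.+1 L).
Proof.
move=> sL jL; apply/(all_nthP 0%N) => i; rewrite size_takel // => ij.
rewrite nth_take //; apply: (sorted_leq_nth leq_trans leqnn) => //; rewrite ?inE //.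
exact: leq_trans jL.
Qed.

Lemma prod_ge_exp (c : nat) (s : seq nat) : all (leq c) s ->
  (c ^ size s <= \prod_(p <- s) p)%N.
Proof.
elim: s => [|p s IH] /=; first by rewrite big_nil.
by move=> /andP[cp /IH h]; rewrite big_cons expnS leq_mul.
Qed.

Lemma prod_le_exp (c : nat) (s : seq nat) : all (fun p => p <= c)%N s ->
  (\prod_(p <- s) p <= c ^ size s)%N.
Proof.
elim: s => [|p s IH] /=; first by rewrite big_nil.
by move=> /andP[cp /IH h]; rewrite big_cons expnS leq_mul.
Qed.

Lemma prod_ge_exp_real (R : realType) (y : R) (s : seq nat) : 0 <= y ->
  (forall p, p \in s -> y <= p%:R) -> y ^+ size s <= (\prod_(p <- s) p)%N%:R.
Proof.
move=> y0; elim: s => [|p s IH] H /=; first by rewrite big_nil expr0.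
rewrite big_cons exprS natrM; apply: ler_pM => //; first exact: exprn_ge0.
  by apply: H; rewrite mem_head.
by apply: IH => q qs; apply: H; rewrite inE qs orbT.
Qed.

Section PrimeList.
Variable R : realType.
Variables (X d : R) (h : nat) (L : seq nat).
Hypotheses (X1 : 1 < X) (sL : sorted leq L) (szL : size L = h).
Hypothesis LP : forall p, p \in L -> prime p /\ X `^ d <= p%:R.
Hypothesis prodL : (\prod_(p <- L) p)%N%:R <= 9 * X ^+ 3.

Local Notation pr k := (\prod_(p <- take k L) p)%N.

Let X0 : 0 < X := lt_trans ltr01 X1.
Let lnX : 0 < ln X := ln_gt0 X1.

Let prod_gt0 (s : seq nat) : (forall p, p \in s -> p \in L) ->
  (0 < \prod_(p <- s) p)%N.
Proof.
by move=> H; rewrite big_seq prodn_cond_gt0 // => x /H /LP[/prime_gt0].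
Qed.

Let pr_gt0 k : (0 < pr k)%N.
Proof. by apply: prod_gt0 => p; exact: mem_take. Qed.

Let pr_split k : (\prod_(p <- L) p = pr k * \prod_(p <- drop k L) p)%N.
Proof. by rewrite -[in LHS](cat_take_drop k L) big_cat. Qed.

(** At least 2 m further entries are no smaller than the first m, so (pr m)^3 <= 9 X^3 < (3 X)^3. *)
Lemma pr_third_le m : (3 * m <= h)%N -> (pr m)%:R <= 3 * X.
Proof.
move=> mh; rewrite leNgt; apply/negP => gt.
have [m0|m0] := posnP m.
  move: gt; rewrite m0 take0 big_nil; have := X1; lra.
have le3 : ((pr m) ^ 3 <= \prod_(p <- L) p)%N.
  rewrite (pr_split m) expnS leq_mul2l; apply/orP; right.
  have mL : (m.-1 < size L)%N by rewrite szL; lia.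
  have up := prod_le_exp (take_le_nth sL mL); rewrite prednK // size_takel in up;
    last by rewrite szL; lia.
  apply: (@leq_trans (((nth 0 L m.-1) ^ m) ^ 2)); first by rewrite leq_exp2r.
  rewrite -expnM; set x := nth 0 L m.-1.
  have x0 : (0 < x)%N.
    by have /LP[/prime_gt0] := mem_nth 0%N mL.
  apply: (@leq_trans (x ^ size (drop m L))).
    by rewrite leq_pexp2l // size_drop szL; lia.
  apply: prod_ge_exp; apply/allP => p pd.
  have : all (leq x) (drop m.-1 L) by exact: nth_le_drop.
  move/allP; apply; have e : m = (m.-1 + 1)%N by rewrite addn1 prednK.
  by move: pd; rewrite [in drop m L]e addnC -drop_drop; exact: mem_drop.
have : (3 * X) ^+ 3 < (pr m)%:R ^+ 3.
  by rewrite ltrXn2r // ?nnegrE // mulr_ge0 // ltW.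
have := prodL; move: le3; rewrite -(ler_nat R) natrX.
have : 0 < X ^+ 3 by exact: exprn_gt0.
have -> : (3 * X) ^+ 3 = 27 * X ^+ 3 by ring.
lra.
Qed.

(** If x is the k-th entry, k - 1 entries are at least X^d and h - k + 1 are at least x, so X^(d (k
    - 1)) x^(h - k + 1) <= 9 X^3. The factor 9 costs log 9 / log X, the exponent of x being at least
    1. *)
Lemma pr_elt_le k p : (0 < k <= h)%N -> p \in take k L ->
  p%:R <= X `^ ((3 - (k%:R - 1) * d) / (h%:R - k%:R + 1) + ln 9 / ln X).
Proof.
move=> /andP[k0 kh] pk.
have kL : (k.-1 < size L)%N by rewrite szL; lia.
set x := nth 0 L k.-1.
have px : (p <= x)%N.
  by have /allP := take_le_nth sL kL; apply; rewrite prednK.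
have x0 : (0 < x)%N by have /LP[/prime_gt0] := mem_nth 0%N kL.
have x0' : 0 < x%:R :> R by rewrite ltr0n.
apply: (@le_trans _ _ x%:R); first by rewrite ler_nat.
rewrite -ler_ln ?posrE ?powR_gt0 // ln_powR.
have Xd : 0 < X `^ d by exact: powR_gt0.
have h1 : (X `^ d) ^+ k.-1 <= (pr k.-1)%:R.
  have := @prod_ge_exp_real R (X `^ d) (take k.-1 L) (ltW Xd).
  rewrite size_takel; last by rewrite szL; lia.
  by apply => q /mem_take /LP[].
have h2 : x%:R ^+ (h - k.-1) <= (\prod_(p <- drop k.-1 L) p)%N%:R :> R.
  have := prod_ge_exp (nth_le_drop k.-1 sL); rewrite size_drop szL.
  by rewrite -(ler_nat R) natrX.
have h3 : (X `^ d) ^+ k.-1 * x%:R ^+ (h - k.-1) <= 9 * X ^+ 3.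
  apply: le_trans prodL; rewrite (pr_split k.-1) natrM.
  by apply: ler_pM => //; apply: exprn_ge0; apply: ltW.
have h4 : (k%:R - 1) * (d * ln X) + (h%:R - k%:R + 1) * ln x%:R <= ln 9 + 3 * ln X.
  have pa : 0 < (X `^ d) ^+ k.-1 by exact: exprn_gt0.
  have pb : 0 < x%:R ^+ (h - k.-1) :> R by exact: exprn_gt0.
  have P0 : 0 < (X `^ d) ^+ k.-1 * x%:R ^+ (h - k.-1) by exact: mulr_gt0.
  have X30 : 0 < X ^+ 3 by exact: exprn_gt0.
  move: h3; rewrite -ler_ln ?posrE ?mulr_gt0 //.
  rewrite lnM ?posrE ?exprn_gt0 // [ln (9 * _)]lnM ?posrE ?exprn_gt0 //.
  rewrite !lnXn // ln_powR.
  rewrite -[_ *+ k.-1]mulr_natl -[_ *+ (h - k.-1)]mulr_natl -[ln X *+ 3]mulr_natl.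
  have kE : k.-1%:R = k%:R - 1 :> R by rewrite -subn1 natrB.
  rewrite kE.
  have -> : (h - k.-1)%:R = h%:R - k%:R + 1 :> R.
    by rewrite natrB ?(leq_trans (leq_pred k) kh) // kE; ring.
  by [].
have D1 : 1 <= h%:R - k%:R + 1 :> R by rewrite lerDr subr_ge0 ler_nat.
have D0 : 0 < h%:R - k%:R + 1 :> R by exact: lt_le_trans D1.
rewrite mulrDl [ln 9 / _ * _]divfK ?gt_eqF // -(ler_pM2l D0) [leRHS]mulrDr.
have -> : (h%:R - k%:R + 1) * ((3 - (k%:R - 1) * d) / (h%:R - k%:R + 1) * ln X) =
   3 * ln X - (k%:R - 1) * (d * ln X) by field; rewrite gt_eqF.
have l9 : ln 9 <= (h%:R - k%:R + 1) * ln 9 :> R.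
  by rewrite ler_peMl // ln_natr_ge0.
by move: h4 l9; set A := (k%:R - 1) * _; set B := (h%:R - k%:R + 1) * ln x%:R;
  set C := _ * ln 9; move=> *; lra.
Qed.

(** Let j = h - k and let y be the next entry. Eliminating log y from pr k * y^j <= 9 X^3 and pr k *
    y > 3 X gives (j - 1) log (pr k) >= (j - 3) log X + (j - 2) log 3. As 9 = 3^2 and j >= 2, the
    constants help. *)
Lemma pr_weight k al : (k.+2 <= h)%N -> 0 <= al -> (pr k)%:R <= 3 * X ->
  3 * X < (pr k.+1)%:R ->
  1 <= weight X al (al * ((h%:R - k%:R - 3) / (h%:R - k%:R - 1))) (pr k).
Proof.
move=> kh al0 le1 lt1.
have kL : (k < size L)%N by rewrite szL; lia.
set y := nth 0 L k.
have y0 : (0 < y)%N by have /LP[/prime_gt0] := mem_nth 0%N kL.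
have y0' : 0 < y%:R :> R by rewrite ltr0n.
have p0 := pr_gt0 k.
have p0' : 0 < (pr k)%:R :> R by rewrite ltr0n.
have prS : (pr k.+1 = pr k * y)%N.
  by rewrite (take_nth 0%N) // -cats1 big_cat big_seq1.
have h2 : (pr k)%:R * y%:R ^+ (h - k) <= 9 * X ^+ 3.
  apply: le_trans prodL; rewrite (pr_split k) natrM ler_wpM2l //.
  have := prod_ge_exp (nth_le_drop k sL); rewrite size_drop szL.
  by rewrite -(ler_nat R) natrX.
have l1 : ln (pr k)%:R + (h%:R - k%:R) * ln y%:R <= ln 9 + 3 * ln X.
  have X30 : 0 < X ^+ 3 by exact: exprn_gt0.
  have pb : 0 < y%:R ^+ (h - k) :> R by exact: exprn_gt0.
  move: h2; rewrite -ler_ln ?posrE ?mulr_gt0 //.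
  rewrite [ln (9 * _)]lnM ?posrE // [ln (_%:R * _)]lnM ?posrE //.
  rewrite !lnXn //.
  rewrite -[_ *+ (h - k)]mulr_natl -[ln X *+ 3]mulr_natl natrB //; exact: ltnW (ltnW kh).
have l2 : ln 3 + ln X <= ln (pr k)%:R + ln y%:R.
  rewrite -!lnM ?posrE // ler_ln ?posrE ?mulr_gt0 //.
  by rewrite -natrM -prS ltW.
have l9 : ln 9 = 2 * ln 3 :> R.
  by rewrite (_ : 9 = 3 ^+ 2) ?lnXn // ?mulr_natl // -natrX.
have l3 : 0 <= ln 3 :> R by exact: ln_natr_ge0.
rewrite /weight -[leLHS]expR0 ler_expR -mulrBr mulr_ge0 // subr_ge0.
pose j : R := h%:R - k%:R.
have j2 : 2 <= j by rewrite /j lerBrDr -natrD ler_nat; exact: kh.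
rewrite -/j in l1 *; clearbody j.
have j1 : 0 < j - 1 by lra.
rewrite ler_pdivlMr // mulrAC ler_pdivrMr //.
have l2' : j * (ln 3 + ln X) <= j * (ln (pr k)%:R + ln y%:R).
  by rewrite ler_wpM2l //; lra.
have l3' : 2 * ln 3 <= j * ln 3 by rewrite ler_wpM2r.
rewrite !mulrDr in l2'; move: l1 l2' l3'; rewrite l9.
rewrite mulrBl mulrBr [ln _ * j]mulrC.
set a1 := j * ln X; set a2 := j * ln 3; set a3 := j * ln (pr k)%:R.
by set a4 := j * ln y%:R; move=> *; lra.
Qed.

End PrimeList.

(** * The bound for T *)

Section Assembly.
Variable R : realType.
Implicit Types (X delta eps c : R).

Lemma large_primes_list X delta (m h : nat) : (0 < m)%N ->
  (h <= Omega X delta m)%N ->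
  exists L : seq nat, [/\ sorted leq L, size L = h,
    forall p, p \in L -> prime p /\ X `^ delta <= p%:R &
    (\prod_(p <- L) p %| m)%N].
Proof.
move=> m0 hO.
pose ps := flatten [seq nseq (logn p m) p | p <- primes m & (X `^ delta <= p%:R)].
have szps : size ps = Omega X delta m.
  rewrite size_flatten /shape -map_comp sumnE big_map big_filter /Omega.
  by apply: eq_bigr => p _; rewrite /= size_nseq.
pose L := sort leq ps.
exists (take h L); split.
- by apply: take_sorted; apply: sort_sorted; exact: leq_total.
- by rewrite size_takel // size_sort szps.
- move=> p /mem_take; rewrite mem_sort => /flatten_mapP[q].
  rewrite mem_filter mem_primes => /andP[qX /and3P[pq _ _]] /nseqP[-> _].
  by [].
apply: (@dvdn_trans (\prod_(p <- L) p)).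
  by rewrite -[X in (_ %| \prod_(p <- X) p)%N](cat_take_drop h L) big_cat dvdn_mulr.
rewrite (perm_big ps) /=; last by rewrite perm_sort.
rewrite /ps big_flatten big_map big_filter /=.
rewrite [X in (_ %| X)%N](prod_prime_decomp m0) prime_decompE big_map /=.
rewrite [X in (_ %| X)%N](bigID (fun p : nat => X `^ delta <= p%:R)) /=.
apply: dvdn_mulr; under [in X in (X %| _)%N]eq_bigr do rewrite big_nseq iter_muln_1.
exact: dvdnn.
Qed.

Lemma window_cubic_le X n : 2 <= X -> n \in window X ->
  (n ^ 3 + 2)%N%:R <= 9 * X ^+ 3.
Proof.
move=> X2 /mem_window /andP[_ n2].
rewrite natrD natrX.
have h1 : n%:R ^+ 3 <= (2 * X) ^+ 3.
  by rewrite lerXn2r // ?nnegrE //; lra.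
have h2 : 2 ^+ 3 <= X ^+ 3 by rewrite lerXn2r // ?nnegrE //; lra.
have e : (2 * X) ^+ 3 = 8 * X ^+ 3 by ring.
have e2 : 2 ^+ 3 = 8 :> R by ring.
lra.
Qed.

Lemma large_primes_window X delta (h n : nat) : 2 <= X -> n \in window X ->
  (h <= Omega X delta (n ^ 3 + 2))%N ->
  exists L : seq nat, [/\ sorted leq L, size L = h,
    forall p, p \in L -> prime p /\ X `^ delta <= p%:R,
    (\prod_(p <- L) p)%N%:R <= 9 * X ^+ 3 & (\prod_(p <- L) p %| n ^ 3 + 2)%N].
Proof.
move=> X2 nw hO; have m0 : (0 < n ^ 3 + 2)%N by rewrite addn2.
have [L [sL szL LP dv]] := large_primes_list m0 hO; exists L; split => //.
by apply: le_trans (window_cubic_le X2 nw); rewrite ler_nat dvdn_leq.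
Qed.

Lemma T_le_count X h delta : 0 < X ->
  (T X h delta <= count (fun n => h <= Omega X delta (n ^ 3 + 2))%N (window X))%N.
Proof.
move=> X0; rewrite -size_filter; set s := seq.filter _ _.
rewrite /T; set A := (X in fset_set X).
have sub : (A `<=` [set` [fset x in map Posz s]%fset])%classic.
  move=> n [/andP[n1 n2] hO] /=; rewrite inE.
  have n0 : (0 : int) <= n.
    by rewrite -(ler0z R); apply: ltW; exact: lt_trans n1.
  case: n n0 n1 n2 hO => // n _ n1 n2 hO; apply/mapP; exists n => //.
  rewrite mem_filter; apply/andP; split.
    by move: hO; rewrite -[X in `|X|%N]/(Posz n ^+ 3 + Posz 2) -PoszX -PoszD.
  rewrite mem_filter n1 n2 !andTb mem_iota add0n ltnS truncn_ge_nat //.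
  by rewrite mulr_ge0 // ltW.
have finA : finite_set A by apply: sub_finite_set sub _; exact: finite_fset.
have /fsubset_leq_card : (fset_set A `<=` [fset x in map Posz s])%fset.
  by rewrite -[X in fsubset _ X]set_fsetK -fset_set_sub //; exact: finite_fset.
move=> /leq_trans; apply.
by rewrite card_fseq (leq_trans (size_undup _)) // size_map.
Qed.

(** The error is the least nonnegative one that works at each X, so the inequality holds for all X >
    0 and only its limit needs the asymptotic bound. *)
Lemma T_bound_near h delta c :
  (forall eps, 0 < eps ->
     \forall X \near +oo, (T X h delta)%:R <= X * (c + eps)) ->
  T_bound h delta c.
Proof.
move=> H; exists (fun X => Num.max 0 ((T X h delta)%:R / X - c)); last first.
  move=> X X0; rewrite -ler_pdivrMl // -lerBlDl le_max [X^-1 * _]mulrC lexx.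
  by rewrite orbT.
apply/cvgrPdist_le => eps e0; near=> X.
have X0 : 0 < X by near: X; apply: nbhs_pinfty_gt; exact: num_real.
rewrite sub0r normrN ger0_norm ?le_max ?lexx // ge_max (ltW e0) /=.
rewrite lerBlDl ler_pdivrMr // mulrC.
by near: X; exact: H.
Unshelve. all: by end_near. Qed.

Lemma near_all_seq (T : eqType) (s : seq T) (P : T -> R -> Prop) :
  (forall x, x \in s -> \forall X \near +oo, P x X) ->
  \forall X \near +oo, forall x, x \in s -> P x X.
Proof.
elim: s => [|x s IH] H; first by near=> X.
have h1 := H x (mem_head _ _).
have h2 : \forall X \near +oo, forall y, y \in s -> P y X.
  by apply: IH => y ys; apply: H; rewrite inE ys orbT.
near=> X => y; rewrite inE => /predU1P[->|].
  by near: X.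
by move: y; near: X.
Unshelve. all: by end_near. Qed.

(** The product of h primes p >= X^delta is at least X^(h delta), which eventually exceeds 9 X^3, so
    T vanishes. *)
Lemma T_bound_large h delta : 3 < h%:R * delta -> T_bound h delta 0.
Proof.
move=> hd; apply: T_bound_near => eps e0; near=> X.
have X2 : 2 <= X by near: X; apply: nbhs_pinfty_ge; exact: num_real.
have X0 : 0 < X by lra.
have hL : (ln 9 + 1) / (h%:R * delta - 3) <= ln X by near: X; exact: near_ln_ge.
suff -> : T X h delta = 0%N by rewrite add0r mulr_ge0 // ltW.
apply/eqP; rewrite -leqn0; apply: (leq_trans (T_le_count _ _ X0)).
rewrite leqNgt -has_count; apply/hasPn => n nw; apply/negP => hO.
have [L [_ szL LP pL _]] := large_primes_window X2 nw hO.
have Xd : 0 < X `^ delta by exact: powR_gt0.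
have := @prod_ge_exp_real R (X `^ delta) L (ltW Xd) (fun p pL => (LP p pL).2).
rewrite szL => /le_trans /(_ pL).
have X30 : 0 < X ^+ 3 by exact: exprn_gt0.
have Xh : 0 < (X `^ delta) ^+ h by exact: exprn_gt0.
rewrite -ler_ln ?posrE ?mulr_gt0 // [ln (9 * _)]lnM ?posrE // !lnXn // ln_powR.
rewrite -[_ *+ h]mulr_natl -[ln X *+ 3]mulr_natl.
rewrite ler_pdivrMr ?subr_gt0 // in hL.
rewrite (_ : h%:R * (delta * ln X) = ln X * (h%:R * delta - 3) + 3 * ln X);
  last by ring.
by move: hL; set A := ln X * _; set C := ln 9; clearbody A C; lra.
Unshelve. all: by end_near. Qed.

Section Main.
Variables (delta : R) (h K : nat) (alpha : nat -> R).
Hypotheses (d0 : 0 < delta) (hh : (3 <= h)%N).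
Hypothesis hK : (h %/ 3 <= K <= h - 1)%N.
Hypothesis al0 : forall k : nat, (h %/ 3 <= k <= K - 1)%N -> 0 < alpha k.
Hypothesis hd : h%:R * delta <= 3.

(** The last term becomes the case k = K of the others: exponent 0 makes the weight 1, and the
    integral of ds / s is written as a logarithm. *)
Let al (k : nat) : R := if (k < K)%N then alpha k else 0.
Let beta (k : nat) : R := al k * ((h%:R - k%:R - 3) / (h%:R - k%:R - 1)).
Let F (k : nat) (b : R) : R :=
  if (k < K)%N then exp_integral (alpha k) delta b else ln (b / delta).

Let K_lt : (K < h)%N.
Proof. by have /andP[_] := hK; move: hh; case: (h) => // n _; rewrite subn1. Qed.

Let al_ge0 k : (h %/ 3 <= k)%N -> 0 <= al k.
Proof.
move=> hk; rewrite /al; case: ifP => // kK; apply/ltW/al0; rewrite hk /=.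
by move: kK; case: (K) => // n; rewrite subn1.
Qed.

Lemma event_of_Omega X n : 3 <= X -> n \in window X ->
  (h <= Omega X delta (n ^ 3 + 2))%N ->
  exists2 k, (h %/ 3 <= k <= K)%N &
    event X delta (upper_limit h delta k + ln 9 / ln X) (al k) (beta k) k n.
Proof.
move=> X3 nw hO; have X2 : 2 <= X by lra.
have X1 : 1 < X by lra.
have [L [sL szL LP pL dv]] := large_primes_window X2 nw hO.
pose pr k := (\prod_(p <- take k L) p)%N.
have /andP[hK1 _] := hK.
have ev k : (h %/ 3 <= k <= K)%N -> (pr k)%:R <= 3 * X ->
    1 <= weight X (al k) (beta k) (pr k) ->
    event X delta (upper_limit h delta k + ln 9 / ln X) (al k) (beta k) k n.
  move=> /andP[k1 k2] le w.
  have kh : (k <= h)%N by apply: leq_trans k2 (ltnW K_lt).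
  exists (take k L); split => //.
  - by rewrite size_takel // szL.
  - move=> p pk; have [pp Xp] := LP p (mem_take pk); split=> //.
    rewrite Xp /=; apply: (pr_elt_le X1 sL szL LP pL) => //.
    by rewrite kh andbT; apply: leq_trans k1; rewrite divn_gt0.
  apply: dvdn_trans dv.
  by rewrite -[X in (_ %| \prod_(p <- X) p)%N](cat_take_drop k L) big_cat dvdn_mulr.
have le0 : (pr (h %/ 3)%N)%:R <= 3 * X.
  apply: (pr_third_le X1 sL szL LP pL).
  by rewrite mulnC leq_trunc_div.
have [leK|gtK] := leP (pr K)%:R (3 * X).
  exists K; first by rewrite hK1 leqnn.
  apply: ev => //; first by rewrite hK1 leqnn.
  by rewrite /weight /beta /al ltnn !mul0r subrr expR0.
have ex : exists j, 3 * X < (pr j)%:R by exists K.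
(* The required k is j - 1: minimality gives pr (j - 1) <= 3 X, and [le0] places j above [h/3]. *)
case: (ex_minnP ex) => j jgt jmin.
have hj : (h %/ 3 < j)%N.
  rewrite ltnNge; apply/negP => jh; move: jgt; rewrite ltNge => /negP; apply.
  apply: le_trans le0; rewrite ler_nat /pr.
  rewrite -[in leqRHS](cat_take_drop j (take _ L)) big_cat /= take_takel //.
  rewrite leq_pmulr // big_seq prodn_cond_gt0 // => p /mem_drop /mem_take /LP[].
  by move=> /prime_gt0.
have jK : (j <= K)%N by exact: jmin.
have jE : j.-1.+1 = j by rewrite prednK // (leq_ltn_trans _ hj).
have kK : (j.-1 < K)%N by rewrite jE.
have hk : (h %/ 3 <= j.-1 <= K)%N by rewrite -ltnS jE hj ltnW.
exists j.-1 => //; apply: ev => //.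
  by rewrite leNgt; apply/negP => /jmin; rewrite -jE ltnn.
apply: (pr_weight X1 sL szL LP pL).
- by rewrite jE; exact: leq_ltn_trans jK K_lt.
- by apply: al_ge0; case/andP: hk.
- by rewrite leNgt; apply/negP => /jmin; rewrite -jE ltnn.
by rewrite jE.
Qed.

(** After clearing the denominator the terms in k cancel and h delta <= 3 remains. *)
Lemma delta_le_upper k : (k <= K)%N -> delta <= upper_limit h delta k.
Proof.
move=> kK; have kh : k%:R <= h%:R :> R.
  by rewrite ler_nat (leq_trans kK) // ltnW.
rewrite /upper_limit ler_pdivlMr; last by rewrite ltr_wpDl ?subr_ge0.
by move: hd; rewrite !mulrDr !mulrDl; lra.
Qed.

Lemma main_termE : main_term h delta K alpha =
  \sum_((h %/ 3)%N <= k < K.+1)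
    expR (- beta k) / k`!%:R * F k (upper_limit h delta k) ^+ k.
Proof.
have /andP[hK1 _] := hK.
rewrite big_nat_recr //= /main_term; congr (_ + _).
  apply: eq_big_nat => k /andP[_ kK].
  by rewrite /beta /al /F kK mulNr.
rewrite /beta /al /F ltnn mul0r oppr0 expR0 div1r; congr (_ * ln _ ^+ _).
by rewrite /upper_limit invfM mulrA.
Qed.

Lemma T_bound_main : T_bound h delta (main_term h delta K alpha).
Proof.
have /andP[hK1 _] := hK.
apply: T_bound_near => eps e0.
pose c (k : nat) := expR (- beta k) / k`!%:R * F k (upper_limit h delta k) ^+ k.
(* At most K + 1 values of k occur. *)
pose e1 := eps / K.+1%:R.
have e10 : 0 < e1 by rewrite divr_gt0.
pose cnt X k := count (fun n => `[< event X delta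
   (upper_limit h delta k + ln 9 / ln X) (al k) (beta k) k n >]) (window X).
have near_k k : k \in index_iota (h %/ 3)%N K.+1 ->
    \forall X \near +oo, (cnt X k)%:R <= X * (c k + e1).
  rewrite mem_index_iota ltnS => /andP[k1 k2].
  (* h >= 3 makes [h/3] positive; [event_count] takes a successor because its rounding bound sums
     over one free prime. *)
  have k0 : (0 < k)%N by apply: leq_trans k1; rewrite divn_gt0.
  rewrite /cnt /c -(prednK k0); apply: event_count => //; rewrite ?(prednK k0).
  - exact: al_ge0.
  - rewrite /F; case: ifP => _; first exact: exp_integral_ge0.
    by rewrite divff ?gt_eqF // ln1.
  - move=> b b' db bb; rewrite /al /F; case: ifP => kK.
      apply: exp_integral_step => //; have := al_ge0 k1; by rewrite /al kK.
    exact: ln_ratio_step.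
  - exact: delta_le_upper.
have nk := near_all_seq near_k.
near=> X.
have X3 : 3 <= X by near: X; apply: nbhs_pinfty_ge; exact: num_real.
have X0 : 0 < X by lra.
have hX : forall k, k \in index_iota (h %/ 3)%N K.+1 -> (cnt X k)%:R <= X * (c k + e1).
  by near: X.
have h1 : (T X h delta <= \sum_((h %/ 3)%N <= k < K.+1) cnt X k)%N.
  apply: (leq_trans (T_le_count _ _ X0)).
  rewrite /cnt; under [leqRHS]eq_bigr do rewrite count_sum.
  rewrite exchange_big /= count_sum big_seq [leqRHS]big_seq.
  apply: leq_sum => n nw.
  case: (boolP (h <= Omega X delta (n ^ 3 + 2))%N) => // hO.
  have [k kK ev] := event_of_Omega X3 nw hO.
  rewrite (bigD1_seq k) ?iota_uniq ?mem_index_iota //=; last first.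
  by have -> : `[< event X delta (upper_limit h delta k + ln 9 / ln X) (al k) (beta k) k n >]
       = true by exact/asboolP.
apply: (@le_trans _ _ (\sum_((h %/ 3)%N <= k < K.+1) X * (c k + e1))).
  apply: (@le_trans _ _ (\sum_((h %/ 3)%N <= k < K.+1) cnt X k)%N%:R).
    by rewrite ler_nat.
  by rewrite natr_sum big_seq [leRHS]big_seq; apply: ler_sum => k /hX.
rewrite -mulr_sumr ler_wpM2l ?(ltW X0) // big_split /= main_termE lerD2l.
rewrite big_const_nat iter_addr_0 -[leLHS]mulr_natl /e1 mulrA ler_pdivrMr // mulrC.
by rewrite ler_wpM2l ?(ltW e0) // ler_nat leq_subr.
Unshelve. all: by end_near. Qed.

End Main.
End Assembly.

Local Open Scope classical_set_scope.
Local Open Scope ring_scope.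

(* The displayed bound is meaningful when h * delta <= 3, which is equivalent
   to each upper limit of integration being at least delta and to the
   logarithm being nonnegative. When h * delta > 3 the formula can be negative
   or undefined, and the main term is read as 0. *)
Theorem lemma4p2 (R : realType) (delta : R) (h K : nat) (alpha : nat -> R)
    (hdelta : 0 < delta < 1) (hh : (3 <= h)%N)
    (hK : (h %/ 3 <= K <= h - 1)%N)
    (halpha : forall k : nat, (h %/ 3 <= k <= K - 1)%N -> 0 < alpha k) :
  (h%:R * delta <= 3 -> T_bound h delta (main_term h delta K alpha)) /\
  (3 < h%:R * delta -> T_bound h delta 0).
Proof.
have /andP[d0 _] := hdelta; split; last exact: T_bound_large.
exact: T_bound_main.
Qed.
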